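(* Let $d\ge 1$ and let $K$ be a bounded subset of $L^2(\mathbb{R}^d)$ such that $f,\hat f\in L^1(\mathbb{R}^d)\cap L^2(\mathbb{R}^d)$ for all $f\in K$. If $$\lim_{\xi\to+\infty}\ \sup_{f\in K}\int_{\complement Q_\xi}|Wf(x,\omega)|\,dx\,d\omega=0,$$ then $K$ is relatively compact in $L^2(\mathbb{R}^d)$.
   Context: Functions are complex-valued. The Fourier transform on $\mathbb{R}^d$ is $\hat f(\omega)=\int_{\mathbb{R}^d}f(x)e^{-2\pi i x\cdot\omega}\,dx$ (extended to $L^2(\mathbb{R}^d)$ as a unitary operator). The Wigner distribution of $f\in L^2(\mathbb{R}^d)$ is $$Wf(x,\omega)=\int_{\mathbb{R}^d}f\left(x+\tfrac t2\right)\overline{f\left(x-\tfrac t2\right)}e^{-2\pi i t\cdot\omega}\,dt,\qquad x,\omega\in\mathbb{R}^d.$$ For $\xi>0$, $Q_\xi=\{(x,\omega)\in\mathbb{R}^{2d}: |x|\le\xi,\ |\omega|\le\xi\}$, where $|\cdot|$ is the Euclidean norm on $\mathbb{R}^d$, and $\complement Q_\xi=\mathbb{R}^{2d}\setminus Q_\xi$. *)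

(* Defs.v *)
From HB Require Import structures.
From mathcomp Require Import all_boot all_order all_algebra.
From mathcomp Require Import all_classical all_reals all_analysis.
From mathcomp Require Import measurable_realfun generic_quotient.
From mathcomp.real_closed Require Import complex.

Set Implicit Arguments.
Unset Strict Implicit.
Unset Printing Implicit Defensive.

Import Order.TTheory GRing.Theory Num.Theory.
Import numFieldNormedType.Exports.
Import ComplexField.Normc.

Local Open Scope classical_set_scope.
Local Open Scope ring_scope.
Local Open Scope complex_scope.
Local Open Scope quotient_scope.

(* R^d is 'rV[R]_d, with the product (i.e. Borel) sigma-algebra. Its topology
   in the library is that of the sup norm; the Euclidean norm is [enorm]. *)
Section row_measurable.
Context {R : realType} (d : nat).

Definition rV_coord (i : 'I_d) (x : 'rV[R]_d) : R := x ord0 i.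

Let rV_set0 : g_sigma_preimage rV_coord set0.
Proof. exact: sigma_algebra0. Qed.

Let rV_setC A : g_sigma_preimage rV_coord A -> g_sigma_preimage rV_coord (~` A).
Proof. exact: sigma_algebraC. Qed.

Let rV_bigcup (F : _^nat) : (forall i, g_sigma_preimage rV_coord (F i)) ->
  g_sigma_preimage rV_coord (\bigcup_i (F i)).
Proof. exact: sigma_algebra_bigcup. Qed.

HB.instance Definition _ := @isMeasurable.Build default_measure_display
  'rV[R]_d (g_sigma_preimage rV_coord) rV_set0 rV_setC rV_bigcup.

Definition dotv (x y : 'rV[R]_d) : R := \sum_(i < d) x ord0 i * y ord0 i.

Definition enorm (x : 'rV[R]_d) : R := Num.sqrt (dotv x x).

End row_measurable.

Section row_measurable_theory.
Context {R : realType}.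

Lemma measurable_rV_coord d (i : 'I_d) :
  measurable_fun [set: 'rV[R]_d] (fun x : 'rV[R]_d => x ord0 i).
Proof.
move=> _ Y mY; rewrite setTI; apply: sub_sigma_algebra => /=.
rewrite -bigcup_seq/=; exists i => /=; first by rewrite mem_index_enum.
by exists Y => //; rewrite setTI.
Qed.

Lemma measurable_rV d0 (T : measurableType d0) d (f : T -> 'rV[R]_d) :
  (forall i, measurable_fun [set: T] (fun t => f t ord0 i)) ->
  measurable_fun [set: T] f.
Proof.
move=> mf _ B mB; rewrite setTI.
pose G := [set A : set 'rV[R]_d | measurable (f @^-1` A)].
suff : measurable `<=` G by exact.
apply: smallest_sub.
  split => //.
  - by rewrite /G/= preimage_set0.
  - by move=> A GA; rewrite /G/= setTD preimage_setC; exact: measurableC.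
  - by move=> F GF; rewrite /G/= preimage_bigcup; apply: bigcup_measurable => k _; exact: GF.
rewrite -bigcup_seq; apply: bigcup_sub => i _ A [C mC <-].
by have := mf i measurableT C mC; rewrite !setTI.
Qed.

Definition rV_cons d (p : measurableTypeR R * 'rV[R]_d) : 'rV[R]_d.+1 :=
  row_mx (p.1 : R)%:M p.2 : 'rV[R]_(1 + d).

Lemma rV_cons0 d p : @rV_cons d p ord0 ord0 = p.1.
Proof.
transitivity (row_mx (p.1 : R)%:M p.2 ord0 (lshift d (ord0 : 'I_1))).
  by congr (row_mx _ _ _ _); exact: val_inj.
by rewrite row_mxEl mxE eqxx.
Qed.

Lemma rV_consS d p (i : 'I_d) : rV_cons p ord0 (lift ord0 i) = p.2 ord0 i.
Proof.
transitivity (row_mx (p.1 : R)%:M p.2 ord0 (rshift 1 i)).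
  by congr (row_mx _ _ _ _); exact: val_inj.
by rewrite row_mxEr.
Qed.

Lemma measurable_rV_cons d : measurable_fun setT (@rV_cons d).
Proof.
apply: measurable_rV => i; case: (unliftP ord0 i) => [j|] ->.
  under eq_fun do rewrite rV_consS.
  exact: (measurableT_comp (measurable_rV_coord j)).
by under eq_fun do rewrite rV_cons0; exact: measurable_fst.
Qed.

End row_measurable_theory.


Section lebesgue_row.
Context {R : realType}.
Local Open Scope ereal_scope.

Section step.
Variables (d : nat) (mu : {sigma_finite_measure set 'rV[R]_d -> \bar R}).

Definition lebesgue_cons : set 'rV[R]_d.+1 -> \bar R :=
  pushforward (@lebesgue_measure R \x mu) (@rV_cons R d).

Let lebesgue_cons0 : lebesgue_cons set0 = 0.
Proof. by rewrite /lebesgue_cons /pushforward preimage_set0 measure0. Qed.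

Let lebesgue_cons_ge0 A : 0 <= lebesgue_cons A.
Proof. by rewrite /lebesgue_cons /pushforward; exact: measure_ge0. Qed.

Let lebesgue_cons_sigma_additive : semi_sigma_additive lebesgue_cons.
Proof.
rewrite /lebesgue_cons; have := measurable_rV_cons.
move=> /(_ R d) mf F mF tF mUF; rewrite /pushforward preimage_bigcup.
apply: measure_semi_sigma_additive.
- by move=> n; rewrite -[X in measurable X]setTI; exact: mf.
- apply/trivIsetP => /= i j _ _ ij; rewrite -preimage_setI.
  by move/trivIsetP : tF => /(_ _ _ _ _ ij) ->//; rewrite preimage_set0.
- by rewrite -preimage_bigcup -[X in measurable X]setTI; exact: mf.
Qed.

HB.instance Definition _ := isMeasure.Build _ _ _ lebesgue_cons
  lebesgue_cons0 lebesgue_cons_ge0 lebesgue_cons_sigma_additive.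

Let lebesgue_cons_sigma_finite : sigma_finite setT lebesgue_cons.
Proof.
have [F FT mF] : sigma_finite setT (@lebesgue_measure R \x mu).
  have /sigma_finiteP[F [TF ndF Foo]] := sigma_finiteT (@lebesgue_measure R).
  have /sigma_finiteP[G [TG ndG Goo]] := sigma_finiteT mu.
  exists (fun n => F n `*` G n).
    rewrite -setXTT TF TG predeqE => -[x y]; split.
      move=> [/= [n _ Fnx] [k _ Gky]]; exists (maxn n k) => //; split.
      - by move: x Fnx; exact/subsetPset/ndF/leq_maxl.
      - by move: y Gky; exact/subsetPset/ndG/leq_maxr.
    by move=> [n _ []/= ? ?]; split; exists n.
  move=> k; have [? ?] := Foo k; have [? ?] := Goo k.
  split; first exact: measurableX.
  by rewrite product_measure1E// lte_mul_pinfty// ge0_fin_numE.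
pose g (u : 'rV[R]_d.+1) : measurableTypeR R * 'rV[R]_d :=
  (u ord0 ord0, \row_i u ord0 (lift ord0 i)).
have mg : measurable_fun setT g.
  apply/measurable_fun_pairP; split; first exact: measurable_rV_coord.
  apply: measurable_rV => i; rewrite /g/=.
  under eq_fun do rewrite mxE.
  exact: measurable_rV_coord.
have gK : cancel (@rV_cons R d) g.
  move=> [a v]; rewrite /g rV_cons0; congr pair.
  by apply/rowP => i; rewrite mxE rV_consS.
exists (fun n => g @^-1` F n).
  by rewrite -preimage_bigcup -FT preimage_setT.
move=> n; have [mFn Fn] := mF n; split.
  by rewrite -[X in measurable X]setTI; exact: mg.
rewrite /lebesgue_cons /pushforward -comp_preimage.
by rewrite (_ : g \o _ = id) //; apply/funext => x /=; rewrite gK.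
Qed.

HB.instance Definition _ := @Measure_isSigmaFinite.Build _ _ _ lebesgue_cons
  lebesgue_cons_sigma_finite.

End step.

(* Lebesgue measure on R^d, as the d-fold product of [lebesgue_measure];
   R^0 is a point, of mass 1. *)
Fixpoint lebesgue_rV (d : nat) :
    {sigma_finite_measure set 'rV[R]_d -> \bar R} :=
  if d is d'.+1 then lebesgue_cons (lebesgue_rV d') else \d_(0%R : 'rV[R]_0).

End lebesgue_row.

Section lebesgue_box.
Context {R : realType}.
Local Open Scope ereal_scope.

Lemma lebesgue_rV_box d (A : 'I_d -> set R) : (forall i, measurable (A i)) ->
  lebesgue_rV d [set x : 'rV[R]_d | forall i, A i (x ord0 i)] =
  \prod_(i < d) @lebesgue_measure R (A i).
Proof.
elim: d A => [|d IH] A mA /=.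
  by rewrite big_ord0 diracE mem_set// => -[].
rewrite big_ord_recl -IH// -product_measure1E//; [|exact: mA|]; last first.
  rewrite [X in measurable X](_ : _ =
      \bigcap_i ((fun x : 'rV[R]_d => x ord0 i) @^-1` A (lift ord0 i))).
    apply: fin_bigcap_measurable => // i _.
    by rewrite -[X in measurable X]setTI; exact: measurable_rV_coord.
  by apply/seteqP; split=> [x /= Ax i _|x /= Ax i]; exact: Ax.
apply: (congr1 (@lebesgue_measure R \x lebesgue_rV d)%E).
apply/seteqP; split => [[a v]/= Aav|[a v]/= [Aa Av] i].
  split; first by have := Aav ord0; rewrite rV_cons0.
  by move=> i; have := Aav (lift ord0 i); rewrite rV_consS.
by case: (unliftP ord0 i) => [j|] ->; rewrite ?rV_consS ?rV_cons0.
Qed.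

End lebesgue_box.

Section complex_functions.
Context d (T : measurableType d) (R : realType).
Variable mu : {measure set T -> \bar R}.
Implicit Types (f g : T -> R[i]) (p : \bar R).

Definition cmeasurable f :=
  measurable_fun setT (fun x => complex.Re (f x)) /\
  measurable_fun setT (fun x => complex.Im (f x)).

Definition cintegral f : R[i] :=
  (\int[mu]_x complex.Re (f x)) +i* (\int[mu]_x complex.Im (f x)).

Definition cLnorm p f : \bar R := 'N[mu]_p[EFin \o (fun x => normc (f x))].

(* f, as a function, belongs to (script) L^p *)
Definition cLfun p f := cmeasurable f /\ (cLnorm p f < +oo)%E.

End complex_functions.

Section complex_functions_theory.
Context d (T : measurableType d) (R : realType).
Variable mu : {measure set T -> \bar R}.
Implicit Types f g h : T -> R[i].
Local Open Scope ereal_scope.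

Lemma normcE (z : R[i]) : normc z = Num.sqrt (complex.Re z ^+ 2 + complex.Im z ^+ 2).
Proof. by case: z. Qed.

Lemma normc_ge0 (z : R[i]) : (0 <= normc z)%R.
Proof. by rewrite normcE sqrtr_ge0. Qed.

Lemma measurable_normc f : cmeasurable f ->
  measurable_fun setT (fun x => normc (f x)).
Proof.
move=> [mr mi]; under eq_fun do rewrite normcE.
apply: measurableT_comp; first by apply: continuous_measurable_fun; exact: sqrt_continuous.
by apply: measurable_funD; exact: measurable_funX.
Qed.

Lemma cmeasurableB f g : cmeasurable f -> cmeasurable g ->
  cmeasurable (fun x => f x - g x)%R.
Proof.
move=> [fr fi] [gr gi]; split.
  under eq_fun do rewrite raddfB /=.
  exact: measurable_funB.
under eq_fun do rewrite raddfB /=.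
exact: measurable_funB.
Qed.

Lemma cLnorm_ge0 p f : 0 <= cLnorm mu p f.
Proof. exact: Lnorm_ge0. Qed.

Lemma cLnorm_triangle p f g h :
  cmeasurable f -> cmeasurable g -> cmeasurable h -> 1 <= p%:E ->
  cLnorm mu p%:E (fun x => f x - h x)%R <=
  cLnorm mu p%:E (fun x => f x - g x)%R + cLnorm mu p%:E (fun x => g x - h x)%R.
Proof.
move=> mf mg mh p1.
have mfg := measurable_normc (cmeasurableB mf mg).
have mgh := measurable_normc (cmeasurableB mg mh).
apply: le_trans (eminkowski mu mfg mgh p1).
have p0 : (0 < p)%R by rewrite (lt_le_trans ltr01).
rewrite /cLnorm unlock gt0_ler_poweR ?invr_ge0 ?(ltW p0)//.
- by rewrite in_itv/= leey andbT integral_ge0// => x _; exact: poweR_ge0.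
- by rewrite in_itv/= leey andbT integral_ge0// => x _; exact: poweR_ge0.
apply: ge0_le_integral => //.
- by move=> x _; exact: poweR_ge0.
- apply: (measurableT_comp (measurable_poweR _)).
  apply: measurableT_comp => //; apply: measurableT_comp => //.
  exact/measurable_normc/cmeasurableB.
- apply: (measurableT_comp (measurable_poweR _)).
  apply: measurableT_comp => //; apply: measurableT_comp => //.
  exact: measurable_funD.
move=> x _; rewrite gt0_ler_poweR ?(ltW p0)//.
- by rewrite in_itv/= leey andbT lee_fin.
- by rewrite in_itv/= leey andbT lee_fin.
rewrite /= lee_fin !ger0_norm ?addr_ge0 ?normc_ge0//.
by rewrite -(subrKA (g x)) le_normcD.
Qed.

Lemma cLnorm_eq0 p f : cmeasurable f -> 0 < p ->
  cLnorm mu p f = 0 -> {ae mu, forall x, f x = 0%R}.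
Proof.
move=> mf p0 /Lnorm_eq0_eq0 => /(_ _ p0) f0.
have /measurable_EFinP/f0 := measurable_normc mf.
by apply: filterS => x /= /(_ Logic.I)[]; exact: eq0_normc.
Qed.

End complex_functions_theory.

(* The complex space L^2(mu): square-integrable functions modulo equality
   almost everywhere, with the metric of the L^2 norm. *)
Section L2_space.
Context d (T : measurableType d) (R : realType).
Variable mu : {measure set T -> \bar R}.

Record cL2fun := CL2fun {
  cL2fun_val :> T -> R[i];
  cL2fun_Lfun : cLfun mu 2%:E cL2fun_val }.

HB.instance Definition _ := gen_eqMixin cL2fun.
HB.instance Definition _ := gen_choiceMixin cL2fun.

Definition cL2_eq (f g : cL2fun) := `[< {ae mu, forall x, f x = g x} >].

Let cL2_eq_refl : reflexive cL2_eq.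
Proof. by move=> f; apply/asboolP; exact: nearW. Qed.

Let cL2_eq_sym : symmetric cL2_eq.
Proof.
by move=> f g; apply/asboolP/asboolP; apply: filterS => x ->.
Qed.

Let cL2_eq_trans : transitive cL2_eq.
Proof.
move=> g f h /asboolP fg /asboolP gh; apply/asboolP.
by move: fg gh; apply: filterS2 => x -> ->.
Qed.

Canonical cL2_eq_equiv := EquivRel cL2_eq cL2_eq_refl cL2_eq_sym cL2_eq_trans.

Definition cL2 : Type := {eq_quot cL2_eq}.
HB.instance Definition _ := Choice.on cL2.
HB.instance Definition _ := EqQuotient.on cL2.

Definition cL2_fun (f : cL2) : T -> R[i] := repr f.
Coercion cL2_fun : cL2 >-> Funclass.

Definition cL2_dist (f g : cL2) : R :=
  fine (cLnorm mu 2%:E (fun x => f x - g x)).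

Lemma cL2_Lfun (f : cL2) : cLfun mu 2%:E f.
Proof. exact: cL2fun_Lfun. Qed.

Let mcL2 (f : cL2) : cmeasurable f.
Proof. by have [] := cL2_Lfun f. Qed.

Let le12 : (1 <= 2%:E :> \bar R)%E.
Proof. by rewrite lee_fin ler1n. Qed.

Lemma cL2_distE (f g : cL2) :
  (cL2_dist f g)%:E = cLnorm mu 2%:E (fun x => f x - g x).
Proof.
rewrite fineK// ge0_fin_numE ?cLnorm_ge0//.
have m0 : cmeasurable (cst 0 : T -> R[i]) by split; exact: measurable_cst.
apply: le_lt_trans (cLnorm_triangle mu (mcL2 f) m0 (mcL2 g) le12) _.
have [_ foo] := cL2_Lfun f; have [_ goo] := cL2_Lfun g.
apply: lte_add_pinfty.
  by rewrite /cLnorm; under eq_fun do rewrite subr0.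
by rewrite /cLnorm; under eq_fun do rewrite sub0r normcN.
Qed.

Let cL2_dist0 f : cL2_dist f f = 0.
Proof.
rewrite /cL2_dist /cLnorm; under eq_fun do rewrite subrr normc0.
by rewrite [X in Lnorm _ _ X](_ : _ = cst 0%E)// Lnorm0// eqe pnatr_eq0.
Qed.

Let cL2_dist_eq0 f g : cL2_dist f g = 0 -> f = g.
Proof.
move=> fg0; have := cL2_distE f g; rewrite fg0 => /esym.
move/cLnorm_eq0 => /(_ (cmeasurableB (mcL2 f) (mcL2 g))).
rewrite lte_fin ltr0n => /(_ isT) fg.
rewrite -[f]reprK -[g]reprK; apply/eqmodP/asboolP.
by apply: filterS fg => x /eqP; rewrite subr_eq0 => /eqP.
Qed.

Let cL2_dist_sym f g : cL2_dist f g = cL2_dist g f.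
Proof.
by rewrite /cL2_dist /cLnorm; under eq_fun do rewrite -opprB normcN.
Qed.

Let cL2_dist_triangle g f h : cL2_dist f h <= cL2_dist f g + cL2_dist g h.
Proof. by rewrite -lee_fin EFinD !cL2_distE; exact: cLnorm_triangle. Qed.

HB.instance Definition _ := isMetric.Build R cL2
  cL2_dist0 cL2_dist_eq0 cL2_dist_sym cL2_dist_triangle.

End L2_space.

Section time_frequency.
Context {R : realType} {d : nat}.
Implicit Types (f : 'rV[R]_d -> R[i]) (x w t : 'rV[R]_d).

(* e^{i theta} *)
Definition expi (theta : R) : R[i] := cos theta +i* sin theta.

(* The integral formula; on L^1 /\ L^2 it agrees with the unitary extension
   of the Fourier transform to L^2. *)
Definition fourier f w : R[i] :=
  cintegral (lebesgue_rV d) (fun x => f x * expi (- (2 * trigo.pi * dotv x w))).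

Definition wigner f x w : R[i] :=
  cintegral (lebesgue_rV d) (fun t =>
    f (x + 2^-1 *: t) * (f (x - 2^-1 *: t))^* *
    expi (- (2 * trigo.pi * dotv t w))).

Definition Qbox (xi : R) : set ('rV[R]_d * 'rV[R]_d) :=
  [set z | enorm z.1 <= xi /\ enorm z.2 <= xi].

End time_frequency.

Notation L2Rd R d := (cL2 (@lebesgue_rV R d)).

(* Main.v *)
From HB Require Import structures.
Require Import Defs.
From mathcomp Require Import all_boot all_order all_algebra.
From mathcomp Require Import all_classical all_reals all_analysis.
From mathcomp Require Import measurable_realfun ring lra.
From mathcomp.real_closed Require Import complex.

(** By the Kolmogorov-Riesz criterion ([kolmogorov_riesz]), a bounded subset of
    L^2(R^d) is relatively compact as soon as its elements have uniformly small
    tails and move uniformly little under small translations. Both are read off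
    the marginals of the Wigner distribution.

    Write [p x t] for [f (x + t/2)] times the conjugate of [f (x - t/2)], so that
    the Wigner distribution at [(x, .)] is the Fourier transform of [p x]. For a
    weight [b] with values in [[-1, 1]], let [P t] be the integral over [x] of
    [b x * p x t]. As [f] is in L^1 and in L^2, [P] is integrable, bounded and, by
    continuity of translations in L^2, continuous; by Fubini its Fourier transform
    is the integral of [b] against the Wigner distribution in [x]. Fourier
    inversion at the origin, in the form [|P 0| <= \int |P^|]
    ([inversion_inequality]), makes sense in [[0, +oo]] and so asks nothing of the
    integrability of [P^]. It is used twice.
    - For [b] the indicator of [|x| > xi], [P 0] is the energy of [f] over
      [|x| > xi]: it is at most the integral of the absolute value of the Wigner
      distribution over [|x| > xi], a part of the complement of [Qbox xi]
      ([energy_le_wigner], [uniform_tails]).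
    - For [b = 1], the squared L^2 distance from [f] to its translate by [h] is
      twice the real part of [P 0 - P h]. Inversion for [P - P (. + h)] bounds it by
      an integral of the Wigner distribution against a weight that vanishes with
      [h.w] ([shift_dist_le_wigner]). Off [Qbox xi] the weight is bounded and the
      hypothesis applies; on [Qbox xi] the weight is small with [h], whereas the
      Wigner distribution is bounded by a multiple of the energy and [Qbox xi] has
      finite measure ([uniform_shift]).

    Inversion at the origin is proved with an explicit Fourier pair, the products of
    the functions [expR (- |w_i|)] and of the functions
    [2 / (1 + (2 pi t_i)^2)]: testing [P^] against the first kernel, dilated, averages
    [P] against the second one, concentrated at the origin.

    For the criterion itself, a large cube is cut into small cells. On a cell the
    variance of [f - g] is controlled by the translates of [f - g], so that [f] and
    [g] are close as soon as their integrals over the cells are ([cell_estimate]). These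
    finitely many integrals are bounded; rounding them off distributes the set over
    finitely many classes of small diameter. In a complete space ([cL2_complete])
    this gives compactness of the closure ([precompact_finite_partitions]). *)

Import Order.TTheory GRing.Theory Num.Theory.
Import numFieldNormedType.Exports.
Import ComplexField.Normc.

Set Implicit Arguments.
Unset Strict Implicit.
Unset Printing Implicit Defensive.

Local Open Scope classical_set_scope.
Local Open Scope ring_scope.

(** * Affine changes of variables in Lebesgue integrals *)

Section affine1.
Context {R : realType}.
Local Open Scope ereal_scope.
Variables (a b : R).
Hypothesis a0 : (a != 0)%R.

Let phi (x : measurableTypeR R) : measurableTypeR R := (a * x + b)%R.

Let mphi : measurable_fun setT phi.
Proof.
by apply: measurable_funD => //; apply: measurable_funM => //; exact: measurable_id.
Qed.

(** By uniqueness of Lebesgue measure: up to the factor, the two sides agree on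
    half-open intervals. When [a < 0] the preimage of such an interval is half-open
    on the other side, which does not change its length. *)
Lemma lebesgue_measure_affine (A : set R) : measurable A ->
  @lebesgue_measure R ((fun x => a * x + b)%R @^-1` A) =
  (`|a|^-1)%:E * @lebesgue_measure R A.
Proof.
move=> mA.
have a1 : (0 < `|a|)%R by rewrite normr_gt0.
pose m := mscale (NngNum (ltW a1)) 
  (measure_function_pushforward__canonical__measure_function_Measure (@lebesgue_measure R) mphi).
suff -> : @lebesgue_measure R A = m A.
  rewrite /m /mscale /= /pushforward muleA -EFinM mulVf ?mul1e//.
  by rewrite gt_eqF.
apply: lebesgue_measure_unique => //= _ [[c e]] _ <-.
rewrite /m /mscale /= /pushforward/=.
move: a0; rewrite neq_lt => /orP[an|ap].
- rewrite (_ : phi @^-1` _ = `[((e - b) / a)%R, ((c - b) / a)%R[%classic); last first.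
    apply/seteqP; split => x /=; rewrite !in_itv/= /phi.
      by rewrite ltr_ndivlMr// ler_ndivrMr// ltrBlDr lerBrDr [(x * a)%R]mulrC andbC.
    by rewrite ltr_ndivlMr// ler_ndivrMr// ltrBlDr lerBrDr [(x * a)%R]mulrC andbC.
  rewrite !lebesgue_measure_itv/= !lte_fin ltr_nM2r ?invr_lt0// ltrD2r.
  case: ifPn => // _; last by rewrite mule0.
  rewrite -!EFinB -EFinM ltr0_norm//; congr EFin.
  by field; rewrite lt_eqF.
- rewrite (_ : phi @^-1` _ = `]((c - b) / a)%R, ((e - b) / a)%R]%classic); last first.
    apply/seteqP; split => x /=; rewrite !in_itv/= /phi.
      by rewrite ltr_pdivrMr// ler_pdivlMr// ltrBlDr lerBrDr [(x * a)%R]mulrC.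
    by rewrite ltr_pdivrMr// ler_pdivlMr// ltrBlDr lerBrDr [(x * a)%R]mulrC.
  rewrite !lebesgue_measure_itv/= !lte_fin ltr_pM2r ?invr_gt0// ltrD2r.
  case: ifPn => // _; last by rewrite mule0.
  rewrite -!EFinB -EFinM gtr0_norm//; congr EFin.
  by field; rewrite gt_eqF.
Qed.

End affine1.

Section affine_integral.
Context {R : realType}.
Local Open Scope ereal_scope.

Lemma ge0_integral_affine1 (a b : R) (F : R -> \bar R) : (a != 0)%R ->
  measurable_fun setT F -> (forall x, 0 <= F x) ->
  \int[@lebesgue_measure R]_x F (a * x + b)%R =
  (`|a|^-1)%:E * \int[@lebesgue_measure R]_x F x.
Proof.
move=> a0 mF F0.
pose phi (x : measurableTypeR R) : measurableTypeR R := (a * x + b)%R.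
have mphi : measurable_fun setT phi.
  by apply: measurable_funD => //; apply: measurable_funM => //; exact: measurable_id.
transitivity (\int[pushforward (@lebesgue_measure R) phi]_y F y).
  by rewrite ge0_integral_pushforward.
have a1 : (0 <= `|a|^-1)%R by rewrite invr_ge0.
rewrite -(ge0_integral_mscale _ _ (NngNum a1))//.
by apply: eq_measure_integral => //= A mA _; exact: lebesgue_measure_affine.
Qed.

(** Tonelli over the first coordinate, the step of the inductions on the
    dimension. *)
Lemma ge0_integral_cons d (F : 'rV[R]_d.+1 -> \bar R) :
  measurable_fun setT F -> (forall x, 0 <= F x) ->
  \int[lebesgue_rV d.+1]_x F x =
  \int[@lebesgue_measure R]_s \int[lebesgue_rV d]_y F (rV_cons (s, y)).
Proof.
move=> mF F0 /=.
have mc := @measurable_rV_cons R d.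
transitivity (\int[pushforward (@lebesgue_measure R \x lebesgue_rV d) (@rV_cons R d)]_x F x).
  exact: eq_measure_integral.
rewrite ge0_integral_pushforward//= preimage_setT.
rewrite (fubini_tonelli1 (F \o @rV_cons R d))//.
  exact: measurableT_comp.
by move=> x; exact: F0.
Qed.

Lemma measurable_affine d (a : R) (v : 'rV[R]_d) :
  measurable_fun setT (fun x : 'rV[R]_d => a *: x + v)%R.
Proof.
apply: measurable_rV => i; under eq_fun do rewrite !mxE.
by apply: measurable_funD => //; apply: measurable_funM => //; exact: measurable_rV_coord.
Qed.

Lemma ge0_integral_affine d (a : R) (v : 'rV[R]_d) (F : 'rV[R]_d -> \bar R) :
  (a != 0)%R -> measurable_fun setT F -> (forall x, 0 <= F x) ->
  \int[lebesgue_rV d]_x F (a *: x + v)%R =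
  ((`|a| ^+ d)^-1)%:E * \int[lebesgue_rV d]_x F x.
Proof.
move=> a0; elim: d v F => [|d IH] v F mF F0.
  rewrite expr0 invr1 mul1e; apply: eq_integral => x _; congr (F _).
  by apply/rowP => -[].
have maff := measurableT_comp mF (measurable_affine a v).
rewrite !ge0_integral_cons//.
pose v' : 'rV[R]_d := \row_i v ord0 (lift ord0 i).
have consE (s : R) y : (a *: rV_cons (s, y) + v)%R =
    rV_cons (a * s + v ord0 ord0, a *: y + v')%R.
  apply/rowP => i; rewrite 2!mxE; case: (unliftP ord0 i) => [j|] ->.
    by rewrite !rV_consS /= !mxE.
  by rewrite !rV_cons0.
pose G s := \int[lebesgue_rV d]_y F (rV_cons (s, y)).
have mFc : measurable_fun setT (fun z => F (@rV_cons R d z)).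
  by apply: measurableT_comp => //; exact: measurable_rV_cons.
have mG : measurable_fun setT G.
  exact: (measurable_fun_fubini_tonelli_F (fun z => F (rV_cons z))).
transitivity (\int[@lebesgue_measure R]_s
    ((`|a| ^+ d)^-1%:E * G (a * s + v ord0 ord0)%R)).
  apply: eq_integral => s _; rewrite -(IH v' (fun y => F (rV_cons ((a * s + v ord0 ord0)%R, y)))); last 2 first.
  - by apply: measurableT_comp mFc _; exact: measurable_pair1.
  - by move=> y; exact: F0.
  by apply: eq_integral => y _; rewrite consE.
rewrite ge0_integralZl.
- rewrite (@ge0_integral_affine1 a (v ord0 ord0) G a0 mG).
    by rewrite muleA -EFinM exprS invfM mulrC.
  by move=> s; exact: integral_ge0.
- exact: measurableT.
- apply: (measurableT_comp mG).
  by apply: measurable_funD => //; exact: measurable_funM.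
- by move=> s _; exact: integral_ge0.
- by rewrite lee_fin invr_ge0 exprn_ge0.
Qed.

End affine_integral.

Section integral_affine.
Context {R : realType} (d : nat).
Local Open Scope ereal_scope.
Local Notation mu := (@lebesgue_rV R d).
Implicit Types (F : 'rV[R]_d -> \bar R) (a : R) (v : 'rV[R]_d).

Lemma integrable_affine a v F : (a != 0)%R -> mu.-integrable setT F ->
  mu.-integrable setT (fun x => F (a *: x + v)%R).
Proof.
move=> a0 /integrableP[mF Foo]; apply/integrableP; split.
  by apply: measurableT_comp mF _; exact: measurable_affine.
rewrite (ge0_integral_affine v a0 (F := fun x => `|F x|))//; last first.
  exact: measurableT_comp.
by rewrite lte_mul_pinfty// lee_fin invr_ge0 exprn_ge0.
Qed.

Lemma integral_affine a v F : (a != 0)%R -> mu.-integrable setT F ->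
  \int[mu]_x F (a *: x + v)%R = ((`|a| ^+ d)^-1)%:E * \int[mu]_x F x.
Proof.
move=> a0 iF; have mF := measurable_int _ iF.
rewrite [LHS]integralE [X in _ * X]integralE.
have -> : (fun x => F (a *: x + v)%R)^\+ = (fun x => F^\+ (a *: x + v)%R).
  by rewrite -[in LHS]/(F \o _) funepos_comp.
have -> : (fun x => F (a *: x + v)%R)^\- = (fun x => F^\- (a *: x + v)%R).
  by rewrite -[in LHS]/(F \o _) funeneg_comp.
rewrite (ge0_integral_affine v a0 (F := F^\+))//; last exact: measurable_funepos.
rewrite (ge0_integral_affine v a0 (F := F^\-))//; last exact: measurable_funeneg.
by rewrite [RHS]muleBr// fin_num_adde_defr// integrable_pos_fin_num.
Qed.

Lemma ge0_integral_shift v F : measurable_fun setT F -> (forall x, 0 <= F x) ->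
  \int[mu]_x F (x + v)%R = \int[mu]_x F x.
Proof.
move=> mF F0; have /= := ge0_integral_affine v (oner_neq0 R) mF F0.
rewrite normr1 expr1n invr1 mul1e => <-.
by apply: eq_integral => x _; rewrite scale1r.
Qed.

End integral_affine.

(** * The Laplace and Poisson kernels *)

Section poisson1.
Context {R : realType}.
Local Notation leb := (@lebesgue_measure R).

(** The antiderivative is minus [expR (- x)] plus the real part of
    [exp ((i b - 1) x) / (i b - 1)]. *)
Lemma is_derive_expcos (b s : R) :
  is_derive s (1 : R) (fun x : R => - expR (- x) +
      (1 + b ^+ 2)^-1 * (expR (- x) * (b * sin (b * x) - cos (b * x))))
    (expR (- s) * (1 + cos (b * s))).
Proof.
have dE : is_derive s (1 : R) (fun x : R => expR (- x)) (- expR (- s)).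
  by have := is_derive1_comp (is_derive_expR (- s)) (is_deriveNid s (1 : R)); rewrite mulrN1.
have db : is_derive s (1 : R) (fun x : R => b * x) b.
  have := is_deriveZ b (is_derive_id s (1 : R)); rewrite /GRing.scale/= mulr1.
  exact.
have dS : is_derive s (1 : R) (fun x : R => sin (b * x)) (cos (b * s) * b).
  exact: (is_derive1_comp (is_derive_sin (b * s)) db).
have dC : is_derive s (1 : R) (fun x : R => cos (b * x)) (- sin (b * s) * b).
  exact: (is_derive1_comp (is_derive_cos (b * s)) db).
have dBS := is_deriveB (is_deriveZ b dS) dC.
have dM := is_deriveZ (1 + b ^+ 2)^-1 (is_deriveM dE dBS).
have := is_deriveD (is_deriveN dE) dM.
move=> h; apply: is_derive_eq h _.
have b1 : 1 + b ^+ 2 != 0 by rewrite gt_eqF// ltr_pwDl// sqr_ge0.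
transitivity (- - expR (- s) + (1 + b ^+ 2)^-1 *
    (expR (- s) * (b * (cos (b * s) * b) - - sin (b * s) * b) +
     (b * sin (b * s) - cos (b * s)) * - expR (- s))); first by [].
by field.
Qed.

Lemma ge0_1Dcos (x : R) : 0 <= 1 + cos x.
Proof. by have := cos_geN1 x; rewrite -subr_ge0 opprK addrC. Qed.

(** The summand 1 makes the integrand nonnegative, as the fundamental theorem of
    calculus on a half-line requires; [integral_expNnorm_cos] subtracts it. *)
Lemma integral_expNnorm_1Dcos (b : R) :
  (\int[leb]_x (expR (- `|x|) * (1 + cos (b * x)))%:E =
   (2 * (1 + (1 + b ^+ 2)^-1))%:E)%E.
Proof.
have cf : continuous (fun x : R => expR (- `|x|) * (1 + cos (b * x))).
  move=> x; apply: cvgM.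
    apply: (continuous_comp (f := fun x : R => - `|x|)); last exact: continuous_expR.
    by apply: cvgN; exact: norm_continuous.
  apply: cvgD; first exact: cvg_cst.
  apply: (continuous_comp (f := fun x : R => b * x)); last exact: continuous_cos.
  exact: mulrl_continuous.
have f0 (x : R) : 0 <= expR (- `|x|) * (1 + cos (b * x)).
  by rewrite mulr_ge0 ?expR_ge0 ?ge0_1Dcos.
rewrite ge0_symfun_integralT//; last first.
  by move=> x /=; rewrite normrN mulrN cosN.
rewrite EFinM; congr (_ * _)%E.
rewrite -set_itvcy.
transitivity (\int[leb]_(x in `[0%R, +oo[) (expR (- x) * (1 + cos (b * x)))%:E)%E.
  apply: eq_integral => x; rewrite inE/= in_itv/= andbT => x0.
  by rewrite ger0_norm.
pose F (x : R) := - expR (- x) +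
      (1 + b ^+ 2)^-1 * (expR (- x) * (b * sin (b * x) - cos (b * x))).
have dF (x : R) : is_derive x (1 : R) F (expR (- x) * (1 + cos (b * x))).
  exact: is_derive_expcos.
have cF : continuous F.
  by move=> x; apply/differentiable_continuous/derivable1_diffP/(@ex_derive _ _ _ _ _ _ _ (dF x)).
rewrite (@ge0_continuous_FTC2y _ _ F 0 0)//.
- rewrite /F oppr0 expR0 mulr0 sin0 cos0 mulr0 sub0r mul1r mulrN1 add0e.
  by rewrite -opprD EFinN oppeK.
- apply: continuous_subspaceT => x; apply: cvgM.
    apply: (continuous_comp (f := -%R)); last exact: continuous_expR.
    exact: opp_continuous.
  apply: cvgD; first exact: cvg_cst.
  apply: (continuous_comp (f := fun x : R => b * x)); last exact: continuous_cos.
  exact: mulrl_continuous.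
- pose c := 1 + (1 + b ^+ 2)^-1 * (`|b| + 1).
  have lim0 : c * expR (- x) @[x --> +oo] --> (0 : R).
    by rewrite -(mulr0 c); apply: cvgMr; exact: cvgr_expR.
  have limN : - (c * expR (- x)) @[x --> +oo] --> (0 : R).
    by rewrite -oppr0; exact: cvgN.
  apply: (squeeze_cvgr _ limN lim0).
  near=> x; rewrite -ler_norml.
  rewrite /F -mulN1r [X in _ + X]mulrCA mulrC -mulrDr normrM (ger0_norm (expR_ge0 _)).
  rewrite mulrC ler_wpM2r ?expR_ge0//.
  apply: le_trans (ler_normD _ _) _; rewrite normrN1 lerD2l normrM.
  rewrite ger0_norm ?invr_ge0 ?addr_ge0 ?sqr_ge0//.
  rewrite ler_wpM2l ?invr_ge0 ?addr_ge0 ?sqr_ge0//.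
  apply: le_trans (ler_normB _ _) _; rewrite lerD//.
    rewrite normrM ler_piMr// ler_norml sin_le1 andbT; exact: sin_geN1.
  by rewrite ler_norml cos_le1 cos_geN1.
- by apply: cvg_at_right_filter; exact: cF.
- by move=> x _; rewrite derive1E; exact: (@derive_val _ _ _ _ _ _ _ (dF x)).
Unshelve. all: by end_near. Qed.

Lemma measurable_expNnorm : measurable_fun [set: R] (fun x => expR (- `|x|)).
Proof.
apply: measurableT_comp; first exact: measurable_expR.
by apply: measurable_funN; exact: normr_measurable.
Qed.

Lemma integral_expNnorm : (\int[leb]_x (expR (- `|x|))%:E = 2%:E)%E.
Proof.
have := integral_expNnorm_1Dcos 0.
under eq_integral do rewrite mul0r cos0 EFinM muleC.
rewrite ge0_integralZl; last 4 first.
- exact: measurableT.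
- by apply/measurable_EFinP; exact: measurable_expNnorm.
- by move=> x _; rewrite lee_fin expR_ge0.
- by rewrite lee_fin.
rewrite expr0n/= addr0 invr1 => /esym/eqP; rewrite -eqe_pdivrMl//.
by rewrite -EFinM mulKf// => /eqP <-.
Qed.

Lemma integrable_expNnorm : leb.-integrable setT (fun x => (expR (- `|x|))%:E).
Proof.
apply/integrableP; split.
  by apply/measurable_EFinP; exact: measurable_expNnorm.
under eq_integral do rewrite abse_EFin ger0_norm ?expR_ge0//.
by rewrite integral_expNnorm ltry.
Qed.

Lemma measurable_cosM (b : R) : measurable_fun [set: R] (fun x => cos (b * x)).
Proof.
apply: continuous_measurable_fun => x.
apply: (continuous_comp (f := fun x : R => b * x)); last exact: continuous_cos.
exact: mulrl_continuous.
Qed.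

Lemma integrable_expNnorm_cos (b : R) :
  leb.-integrable setT (fun x => (expR (- `|x|) * cos (b * x))%:E).
Proof.
have mc := measurable_cosM b; have me := measurable_expNnorm.
apply: le_integrable integrable_expNnorm => //.
  by apply/measurable_EFinP; exact: measurable_funM.
move=> x _; rewrite lee_fin normrM ler_piMr// ler_norml cos_le1 andbT.
exact: cos_geN1.
Qed.

Lemma integral_expNnorm_cos (b : R) :
  (\int[leb]_x (expR (- `|x|) * cos (b * x))%:E = (2 / (1 + b ^+ 2))%:E)%E.
Proof.
have ie := integrable_expNnorm.
have ic := integrable_expNnorm_cos b.
have := integral_expNnorm_1Dcos b.
under eq_integral do rewrite mulrDr mulr1 EFinD.
rewrite integralD// integral_expNnorm => h.
have : (2%:E + \int[leb]_x (expR (- `|x|) * cos (b * x))%:E - 2%:E =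
  (2 * (1 + (1 + b ^+ 2)^-1))%:E - 2%:E)%E by rewrite h.
by rewrite addeAC subee// add0e => ->; rewrite -EFinB mulrDr mulr1 addrAC subrr add0r.
Qed.

Lemma integral_poisson1 :
  (\int[leb]_x (2 / (1 + (2 * pi * x) ^+ 2))%:E = 1)%E.
Proof.
have d0 (x : R) : 0 < 1 + (2 * pi * x) ^+ 2 by rewrite ltr_pwDl// sqr_ge0.
have cf : continuous (fun x : R => 2 / (1 + (2 * pi * x) ^+ 2)).
  move=> x; apply: cvgM; first exact: cvg_cst.
  apply: cvgV; first by rewrite gt_eqF.
  apply: cvgD; first exact: cvg_cst.
  apply: cvgM; exact: mulrl_continuous.
have f0 (x : R) : 0 <= 2 / (1 + (2 * pi * x) ^+ 2).
  by rewrite divr_ge0// ltW.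
rewrite ge0_symfun_integralT//; last first.
  by move=> x /=; rewrite mulrN sqrrN.
rewrite -set_itvcy.
pose F (x : R) := pi^-1 * atan (2 * pi * x).
have dF (x : R) : is_derive x (1 : R) F (2 / (1 + (2 * pi * x) ^+ 2)).
  have db : is_derive x (1 : R) (fun y : R => 2 * pi * y) (2 * pi).
    have := is_deriveZ (2 * pi) (is_derive_id x (1 : R)); rewrite /GRing.scale/= mulr1.
    exact.
  have := is_deriveZ pi^-1 (is_derive1_comp (is_derive1_atan (2 * pi * x)) db).
  move=> h; apply: is_derive_eq h _.
  transitivity (pi^-1 * ((1 + (2 * pi * x) ^+ 2)^-1 * (2 * pi))); first by [].
  rewrite [_ * (2 * pi)]mulrC mulrA [2 * pi]mulrC mulrA mulVf ?mul1r//.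
  by rewrite gt_eqF// pi_gt0.
have cF : continuous F.
  by move=> x; apply/differentiable_continuous/derivable1_diffP/(@ex_derive _ _ _ _ _ _ _ (dF x)).
rewrite (@ge0_continuous_FTC2y _ _ F 0 2^-1)//.
- by rewrite /F mulr0 atan0 mulr0 sube0 -EFinM divff.
- exact: continuous_subspaceT.
- have -> : 2^-1 = pi^-1 * (pi / 2) :> R by rewrite mulrA mulVf ?mul1r// gt_eqF// pi_gt0.
  apply: cvgMr; apply: (@cvg_comp _ _ _ _ _ _ (pinfty_nbhs R)); last exact: cvgy_atan.
  by apply: gt0_cvgMry => //; rewrite mulr_gt0 ?pi_gt0.
- by apply: cvg_at_right_filter; exact: cF.
- by move=> x _; rewrite derive1E; exact: (@derive_val _ _ _ _ _ _ _ (dF x)).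
Qed.

End poisson1.

Section poisson_kernel.
Context {R : realType}.

(** A Fourier pair of nonnegative integrable functions ([integral_laplace_cos],
    [integral_laplace_sin]). Products over the coordinates, rather than radial
    functions, reduce its computation to one variable. *)
Definition laplace_kernel d (w : 'rV[R]_d) : R := \prod_(i < d) expR (- `|w ord0 i|).

Definition poisson_kernel d (t : 'rV[R]_d) : R :=
  \prod_(i < d) (2 / (1 + (2 * pi * t ord0 i) ^+ 2)).

Lemma prod_rV_cons d (phi : R -> R) s (y : 'rV[R]_d) :
  \prod_(i < d.+1) phi (rV_cons (s, y) ord0 i) =
  phi s * \prod_(i < d) phi (y ord0 i).
Proof.
rewrite big_ord_recl rV_cons0; congr (_ * _).
by apply: eq_bigr => i _; rewrite rV_consS.
Qed.

Lemma dotv_cons d (t : 'rV[R]_d.+1) s (y : 'rV[R]_d) :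
  dotv t (rV_cons (s, y)) =
  t ord0 ord0 * s + dotv (\row_i t ord0 (lift ord0 i)) y.
Proof.
rewrite /dotv big_ord_recl rV_cons0; congr (_ + _).
by apply: eq_bigr => i _; rewrite rV_consS mxE.
Qed.

Lemma measurable_prod_rV d (phi : R -> R) : measurable_fun setT phi ->
  measurable_fun setT (fun x : 'rV[R]_d => \prod_(i < d) phi (x ord0 i)).
Proof.
move=> mphi; apply: measurable_prod => i _.
by apply: measurableT_comp => //; exact: measurable_rV_coord.
Qed.

Lemma measurable_dotv d (t : 'rV[R]_d) : measurable_fun setT (dotv t).
Proof.
apply: measurable_sum => i; apply: measurable_funM => //.
exact: measurable_rV_coord.
Qed.

Local Open Scope ereal_scope.

Lemma integral_rV0 (F : 'rV[R]_0 -> \bar R) :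
  measurable_fun setT F -> \int[lebesgue_rV 0]_x F x = F 0%R.
Proof. by move=> mF /=; rewrite integral_dirac// diracT mul1e. Qed.

Lemma ge0_integral_prod d (phi : R -> R) : measurable_fun setT phi ->
  (forall x, 0 <= phi x)%R ->
  \int[lebesgue_rV d]_x (\prod_(i < d) phi (x ord0 i))%:E =
  (\int[@lebesgue_measure R]_x (phi x)%:E) ^+ d.
Proof.
move=> mphi phi0; elim: d => [|d IH].
  rewrite integral_rV0; first by rewrite big_ord0.
  by apply/measurable_EFinP; exact: measurable_prod_rV.
rewrite ge0_integral_cons.
- transitivity (\int[@lebesgue_measure R]_s ((phi s)%:E * (\int[@lebesgue_measure R]_x (phi x)%:E) ^+ d)).
    apply: eq_integral => s _; rewrite -IH -ge0_integralZl.
    + by apply: eq_integral => y _; rewrite prod_rV_cons.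
    + exact: measurableT.
    + by apply/measurable_EFinP; exact: measurable_prod_rV.
    + by move=> y _; rewrite lee_fin prodr_ge0.
    + by rewrite lee_fin.
  rewrite ge0_integralZr//; first by rewrite expeS.
  + exact/measurable_EFinP.
  + by move=> x _; rewrite lee_fin.
  + by rewrite expe_ge0// integral_ge0// => x _; rewrite lee_fin.
- by apply/measurable_EFinP; exact: measurable_prod_rV.
- by move=> x; rewrite lee_fin prodr_ge0.
Qed.

Lemma integrable_cons d (F : 'rV[R]_d.+1 -> \bar R) :
  (lebesgue_rV d.+1).-integrable setT F ->
  (@lebesgue_measure R \x lebesgue_rV d).-integrable setT (F \o @rV_cons R d).
Proof.
move=> iF; have mF := measurable_int _ iF.
have mc := @measurable_rV_cons R d.
apply/integrableP; split; first exact: measurableT_comp.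
have [_] := integrableP _ _ _ iF.
rewrite ge0_integral_cons//; last exact: measurableT_comp.
apply: le_lt_trans; rewrite (fubini_tonelli1 (fun z => `|F (rV_cons z)|))//.
by apply: measurableT_comp => //; exact: measurableT_comp.
Qed.

Lemma integral_cons d (F : 'rV[R]_d.+1 -> \bar R) :
  (lebesgue_rV d.+1).-integrable setT F ->
  \int[lebesgue_rV d.+1]_x F x =
  \int[@lebesgue_measure R]_s \int[lebesgue_rV d]_y F (rV_cons (s, y)).
Proof.
move=> iF; have mF := measurable_int _ iF.
have mc := @measurable_rV_cons R d.
have iFc := integrable_cons iF.
transitivity (\int[pushforward (@lebesgue_measure R \x lebesgue_rV d) (@rV_cons R d)]_x F x).
  exact: eq_measure_integral.
rewrite integral_pushforward//= preimage_setT.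
by rewrite -(integral12_prod_meas1 iFc).
Qed.

Lemma measurable_laplace_kernel d : measurable_fun setT (@laplace_kernel d).
Proof. exact: (@measurable_prod_rV d _ (@measurable_expNnorm R)). Qed.

Lemma laplace_kernel_ge0 d (w : 'rV[R]_d) : (0 <= laplace_kernel w)%R.
Proof. by apply: prodr_ge0 => i _; exact: expR_ge0. Qed.

Lemma laplace_kernel_le1 d (w : 'rV[R]_d) : (laplace_kernel w <= 1)%R.
Proof.
apply: prodr_ile1 => i _.
by rewrite expR_ge0 -expR0 ler_expR oppr_le0 normr_ge0.
Qed.

Lemma laplace_kernelN d (w : 'rV[R]_d) : laplace_kernel (- w) = laplace_kernel w.
Proof. by apply: eq_bigr => i _; rewrite mxE normrN. Qed.

Lemma integral_laplace_kernel d :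
  \int[lebesgue_rV d]_w (laplace_kernel w)%:E = (2 ^+ d)%:E.
Proof.
rewrite (ge0_integral_prod d (@measurable_expNnorm R)) ?integral_expNnorm ?EFin_expe//.
Qed.

Lemma integrable_laplace_kernel d :
  (lebesgue_rV d).-integrable setT (EFin \o @laplace_kernel d).
Proof.
apply/integrableP; split.
  by apply/measurable_EFinP; exact: measurable_laplace_kernel.
under eq_integral do rewrite /= ger0_norm ?laplace_kernel_ge0//.
by rewrite integral_laplace_kernel ltry.
Qed.

Let measurable_poisson1 : measurable_fun [set: R] (fun x : R => 2 / (1 + (2 * pi * x) ^+ 2))%R.
Proof.
apply: continuous_measurable_fun => x; apply: cvgM; first exact: cvg_cst.
apply: cvgV; first by rewrite gt_eqF// ltr_pwDl// sqr_ge0.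
apply: cvgD; first exact: cvg_cst.
apply: cvgM; exact: mulrl_continuous.
Qed.

Let poisson1_gt0 (x : R) : (0 < 2 / (1 + (2 * pi * x) ^+ 2))%R.
Proof. by rewrite divr_gt0// ltr_pwDl// sqr_ge0. Qed.

Lemma measurable_poisson_kernel d : measurable_fun setT (@poisson_kernel d).
Proof. exact: (@measurable_prod_rV d _ measurable_poisson1). Qed.

Lemma poisson_kernel_ge0 d (t : 'rV[R]_d) : (0 <= poisson_kernel t)%R.
Proof. by apply: prodr_ge0 => i _; exact: ltW. Qed.

Lemma integral_poisson_kernel d :
  \int[lebesgue_rV d]_t (poisson_kernel t)%:E = 1.
Proof.
rewrite (ge0_integral_prod d measurable_poisson1); last by move=> x; exact: ltW.
by rewrite integral_poisson1; elim: d => // d; rewrite expeS mul1e.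
Qed.

Lemma integrableM_le1 d (g h : 'rV[R]_d -> R) :
  (lebesgue_rV d).-integrable setT (EFin \o g) -> measurable_fun setT h ->
  (forall x, `|h x| <= 1)%R ->
  (lebesgue_rV d).-integrable setT (fun x => (g x * h x)%:E).
Proof.
move=> ig mh h1; have /measurable_EFinP mg := measurable_int _ ig.
apply: le_integrable ig => //; first by apply/measurable_EFinP; exact: measurable_funM.
by move=> x _; rewrite lee_fin normrM ler_piMr.
Qed.

Lemma normr_cos_le1 (x : R) : (`|cos x| <= 1)%R.
Proof. by rewrite ler_norml cos_le1 cos_geN1. Qed.

Lemma normr_sin_le1 (x : R) : (`|sin x| <= 1)%R.
Proof. by rewrite ler_norml sin_le1 sin_geN1. Qed.

Lemma measurable_cos_dotv d (t : 'rV[R]_d) :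
  measurable_fun setT (fun w => cos (2 * pi * dotv t w)).
Proof.
apply: measurableT_comp; first by apply: continuous_measurable_fun; exact: continuous_cos.
by apply: measurable_funM => //; exact: measurable_dotv.
Qed.

Lemma measurable_sin_dotv d (t : 'rV[R]_d) :
  measurable_fun setT (fun w => sin (2 * pi * dotv t w)).
Proof.
apply: measurableT_comp; first by apply: continuous_measurable_fun; exact: continuous_sin.
by apply: measurable_funM => //; exact: measurable_dotv.
Qed.

Lemma dotvNr d (t w : 'rV[R]_d) : dotv t (- w) = (- dotv t w)%R.
Proof. by rewrite /dotv -sumrN; apply: eq_bigr => i _; rewrite mxE mulrN. Qed.

(** The integrand is odd. *)
Lemma integral_laplace_sin d (t : 'rV[R]_d) :
  \int[lebesgue_rV d]_w (laplace_kernel w * sin (2 * pi * dotv t w))%:E = 0.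
Proof.
set F := fun w => (laplace_kernel w * sin (2 * pi * dotv t w))%:E.
have iF : (lebesgue_rV d).-integrable setT F.
  apply: integrableM_le1; first exact: integrable_laplace_kernel.
  - exact: measurable_sin_dotv.
  - by move=> x; exact: normr_sin_le1.
have N10 : (- 1 != 0 :> R)%R by rewrite oppr_eq0.
have := integral_affine 0%R N10 iF.
rewrite normrN1 expr1n invr1 mul1e.
rewrite (eq_integral (fun w => - F w)); last first.
  move=> w _; rewrite /F scaleN1r addr0 laplace_kernelN dotvNr mulrN sinN mulrN.
  by rewrite EFinN.
rewrite integralN/=; last exact/integrable_add_def.
have /fineK <- := integrable_fin_num measurableT iF.
move=> -[] /eqP; rewrite eq_sym -subr_eq0 opprK -mulr2n mulrn_eq0/= => /eqP ->.
by [].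
Qed.

(** By induction on the dimension and the addition formula, the sines of the
    tail coordinates integrating to zero. *)
Lemma integral_laplace_cos d (t : 'rV[R]_d) :
  \int[lebesgue_rV d]_w (laplace_kernel w * cos (2 * pi * dotv t w))%:E =
  (poisson_kernel t)%:E.
Proof.
have ilc n (u : 'rV[R]_n) : (lebesgue_rV n).-integrable setT
    (fun w => (laplace_kernel w * cos (2 * pi * dotv u w))%:E).
  apply: integrableM_le1; first exact: integrable_laplace_kernel.
  - exact: measurable_cos_dotv.
  - by move=> x; exact: normr_cos_le1.
have ils n (u : 'rV[R]_n) : (lebesgue_rV n).-integrable setT
    (fun w => (laplace_kernel w * sin (2 * pi * dotv u w))%:E).
  apply: integrableM_le1; first exact: integrable_laplace_kernel.
  - exact: measurable_sin_dotv.
  - by move=> x; exact: normr_sin_le1.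
elim: d t => [|d IH] t.
  rewrite integral_rV0; last exact: measurable_int (ilc _ _).
  by rewrite /laplace_kernel /poisson_kernel /dotv !big_ord0 mulr0 cos0 mulr1.
rewrite integral_cons//.
set t' : 'rV[R]_d := \row_i t ord0 (lift ord0 i).
pose b := (2 * pi * t ord0 ord0)%R.
transitivity (\int[@lebesgue_measure R]_s
    ((poisson_kernel t')%:E * (expR (- `|s|) * cos (b * s))%:E)).
  apply: eq_integral => s _.
  transitivity (\int[lebesgue_rV d]_y
      ((expR (- `|s|) * cos (b * s))%:E *
         (laplace_kernel y * cos (2 * pi * dotv t' y))%:E -
       (expR (- `|s|) * sin (b * s))%:E *
         (laplace_kernel y * sin (2 * pi * dotv t' y))%:E)).
    apply: eq_integral => y _.
    rewrite /laplace_kernel (prod_rV_cons (fun x => expR (- `|x|))) dotv_cons.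
    rewrite mulrDr mulrA -/b cosD -!EFinM -EFinB; congr EFin.
    by rewrite -!/(laplace_kernel _); ring.
  rewrite integralB//; [|exact: integrableZl..].
  by rewrite !integralZl// IH integral_laplace_sin mule0 sube0 muleC.
rewrite integralZl//; last first.
  exact: integrable_expNnorm_cos.
rewrite integral_expNnorm_cos -EFinM mulrC; congr EFin.
rewrite /poisson_kernel [in RHS]big_ord_recl; congr (_ * _)%R.
by apply: eq_bigr => i _; rewrite mxE.
Qed.

End poisson_kernel.

(** * Continuity of translations in L^2 *)

Lemma cvge0_le {R : realType} {I : Type} {F : set_system I} {FF : ProperFilter F}
  (u : I -> \bar R) : u i @[i --> F] --> 0%E ->
  forall e : R, 0 < e -> \forall i \near F, (u i <= e%:E)%E.
Proof.
move=> /fine_cvgP[ufin /cvgrPdist_le cu] e e0.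
move: ufin (cu e e0); apply: filterS2 => n ufin.
rewrite sub0r normrN => une; rewrite -(fineK ufin) lee_fin.
exact: le_trans (ler_norm _) une.
Qed.

Section L1_distance.
Context d (T : measurableType d) (R : realType) (mu : {measure set T -> \bar R}).
Local Open Scope ereal_scope.
Implicit Types f g h : T -> R.

Lemma L1_triangle f g h : measurable_fun setT f -> measurable_fun setT g ->
  measurable_fun setT h ->
  \int[mu]_x `|f x - h x|%:E <=
  \int[mu]_x `|f x - g x|%:E + \int[mu]_x `|g x - h x|%:E.
Proof.
move=> mf mg mh; rewrite -ge0_integralD//=; last 2 first.
- by apply/measurable_EFinP; apply: measurableT_comp => //; exact: measurable_funB.
- by apply/measurable_EFinP; apply: measurableT_comp => //; exact: measurable_funB.
apply: ge0_le_integral => //=.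
- by apply/measurable_EFinP; apply: measurableT_comp => //; exact: measurable_funB.
- by apply/measurable_EFinP; apply: measurable_funD => //;
    apply: measurableT_comp => //; exact: measurable_funB.
by move=> x _; rewrite -EFinD lee_fin ler_distD.
Qed.

End L1_distance.

Lemma measurable_shift {R : realType} d (v : 'rV[R]_d) :
  measurable_fun setT (fun x : 'rV[R]_d => x + v).
Proof.
by have := measurable_affine 1 v; under eq_fun do rewrite scale1r.
Qed.

Section shift_continuity.
Context {R : realType} (d : nat).
Local Notation mu := (@lebesgue_rV R d).
Local Notation X := ('rV[R]_d).
Local Open Scope ereal_scope.
Variable t : X.

Let sh (n : nat) (x : X) : X := (x + n.+1%:R^-1 *: t)%R.

Let measurable_sh n : measurable_fun setT (sh n).
Proof. exact: measurable_shift. Qed.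

(** Translations are followed along the single sequence [t / (n + 1)]: the
    dominated convergence theorem is about sequences, and the proof of
    [inversion_inequality] takes limits along such sequences only. *)
Definition shift_cont (w : X -> R) := mu.-integrable setT (EFin \o w) /\
  forall e : R, (0 < e)%R -> \forall n \near \oo,
    \int[mu]_x `|w (x + n.+1%:R^-1 *: t)%R - w x|%:E <= e%:E.

(** Translations are isometries of L^1. *)
Lemma shift_cont_approx w : mu.-integrable setT (EFin \o w) ->
  (forall e : R, (0 < e)%R ->
    exists2 w', shift_cont w' & \int[mu]_x `|w x - w' x|%:E <= e%:E) ->
  shift_cont w.
Proof.
move=> iw H; split => // e e0.
have e30 : (0 < e / 3)%R by rewrite divr_gt0.
have [w' [iw' /(_ _ e30) cw'] ww'] := H _ e30.
have /measurable_EFinP mw := measurable_int _ iw.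
have /measurable_EFinP mw' := measurable_int _ iw'.
near=> n.
have mws : measurable_fun setT (w \o sh n) by exact: measurableT_comp.
have mws' : measurable_fun setT (w' \o sh n) by exact: measurableT_comp.
apply: le_trans (L1_triangle mu mws mws' mw) _.
have -> : e%:E = (e / 3)%:E + ((e / 3)%:E + (e / 3)%:E) by rewrite -!EFinD; congr EFin; field.
apply: leeD.
  have -> : \int[mu]_x (`|(w \o sh n) x - (w' \o sh n) x|)%:E = \int[mu]_x `|w x - w' x|%:E.
    rewrite -(ge0_integral_shift (n.+1%:R^-1 *: t)%R (F := fun x => (`|w x - w' x|)%:E))//.
    by apply/measurable_EFinP; apply: measurableT_comp => //; exact: measurable_funB.
  exact: ww'.
apply: le_trans (L1_triangle mu mws' mw' mw) _; apply: leeD.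
  by near: n.
by under eq_integral do rewrite distrC.
Unshelve. all: by end_near. Qed.

Lemma shift_contDZ c w w' : shift_cont w -> shift_cont w' ->
  shift_cont (fun x => w x + c * w' x)%R.
Proof.
move=> [iw cw] [iw' cw']; split.
  have -> : EFin \o (fun x => w x + c * w' x)%R =
     (fun x => (w x)%:E + c%:E * (w' x)%:E) by apply/funext => x; rewrite /= EFinD EFinM.
  by apply: integrableD => //; exact: integrableZl.
move=> e e0.
have e20 : (0 < e / 2)%R by rewrite divr_gt0.
have c0 : (0 < `|c| + 1)%R by rewrite ltr_wpDl.
have ec0 : (0 < e / 2 / (`|c| + 1))%R by rewrite divr_gt0.
have /measurable_EFinP mw := measurable_int _ iw.
have /measurable_EFinP mw' := measurable_int _ iw'.
have := cw _ e20; have := cw' _ ec0; apply: filterS2 => n h' h.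
have mws : measurable_fun setT (w \o sh n) by exact: measurableT_comp.
have mws' : measurable_fun setT (w' \o sh n) by exact: measurableT_comp.
have m1 : measurable_fun setT (fun x => `|w (sh n x) - w x|%R).
  by apply: measurableT_comp => //; exact: measurable_funB.
have m2 : measurable_fun setT (fun x => `|w' (sh n x) - w' x|%R).
  by apply: measurableT_comp => //; exact: measurable_funB.
apply: (@le_trans _ _ (\int[mu]_x ((`|w (sh n x) - w x|)%:E +
    (`|c| + 1)%:E * (`|w' (sh n x) - w' x|)%:E))).
  apply: ge0_le_integral => //=.
  - apply/measurable_EFinP; apply: measurableT_comp => //; apply: measurable_funB.
      by apply: measurable_funD => //; exact: measurable_funM.
    by apply: measurable_funD => //; exact: measurable_funM.
  - by apply/measurable_EFinP; apply: measurable_funD => //; exact: measurable_funM.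
  move=> x _; rewrite -EFinM -EFinD lee_fin -/(sh n x).
  have -> : (w (sh n x) + c * w' (sh n x) - (w x + c * w' x) =
    (w (sh n x) - w x) + c * (w' (sh n x) - w' x))%R by ring.
  apply: le_trans (ler_normD _ _) _; rewrite lerD2l normrM ler_wpM2r//.
  by rewrite lerDl.
rewrite ge0_integralD//=; last 2 first.
- exact/measurable_EFinP.
- by apply/measurable_EFinP; exact: measurable_funM.
rewrite ge0_integralZl//=; last exact/measurable_EFinP.
rewrite [leRHS](_ : _ = (e / 2)%:E + (`|c| + 1)%:E * (e / 2 / (`|c| + 1))%:E); last first.
  by rewrite -EFinM -EFinD; congr EFin; field; rewrite gt_eqF.
apply: leeD; first exact: h.
by apply: lee_wpmul2l; [rewrite lee_fin ltW|exact: h'].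
Qed.

Lemma shift_cont0 : shift_cont (fun=> 0%R).
Proof.
split; first exact: integrable0.
move=> e e0; apply: nearW => n.
under eq_integral do rewrite subrr normr0.
by rewrite integral0 lee_fin ltW.
Qed.

Lemma shift_cont_sum (I : Type) (s : seq I) (c : I -> R) (w : I -> X -> R) :
  (forall i, shift_cont (w i)) ->
  shift_cont (fun x => \sum_(i <- s) c i * w i x)%R.
Proof.
move=> cw; elim: s => [|i s IH].
  by under eq_fun do rewrite big_nil; exact: shift_cont0.
under eq_fun do rewrite big_cons addrC.
exact: shift_contDZ.
Qed.

End shift_continuity.

Section shift_continuity_indic.
Context {R : realType} (d : nat).
Local Notation mu := (@lebesgue_rV R d).
Local Notation X := ('rV[R]_d).
Local Open Scope ereal_scope.
Variable t : X.

(** The absolute value of [1_O (x + h) - 1_O x] is the sum of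
    [1_O x * (1 - 1_O (x + h))] and [(1 - 1_O x) * 1_O (x + h)]. These have the same
    integral, each completing that of [1_O x * 1_O (x + h)] to the measure of [O];
    the first tends to zero by dominated convergence. *)
Lemma shift_cont_open (O : set X) : measurable O -> mu O < +oo ->
  (forall x, O x -> \forall n \near \oo, O (x + n.+1%:R^-1 *: t)%R) ->
  shift_cont t \1_O.
Proof.
move=> mO Ooo openO.
have i1 : mu.-integrable setT (EFin \o \1_O).
  apply/integrableP; split; first by apply/measurable_EFinP; exact: measurable_indic.
  by under eq_integral do rewrite /= ger0_norm//; rewrite integral_indic// setIT.
split => // e e0.
pose h n : X := (n.+1%:R^-1 *: t)%R.
pose a (x : X) : R := \1_O x.
have a01 x : (a x == 0)%R || (a x == 1)%R.
  by rewrite /a indicE; case: (x \in O); rewrite ?eqxx ?orbT.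
have ma : measurable_fun setT a by exact: measurable_indic.
have mas n : measurable_fun setT (fun x : X => a (x + h n)%R).
  exact: (measurableT_comp ma (measurable_shift (h n))).
pose g n x : \bar R := (a x * (1 - a (x + h n)))%:E.
have mg n : measurable_fun setT (g n).
  by apply/measurable_EFinP; apply: measurable_funM => //; exact: measurable_funB.
pose g' n x : \bar R := ((1 - a x) * a (x + h n))%:E.
have mg' n : measurable_fun setT (g' n).
  by apply/measurable_EFinP; apply: measurable_funM => //; exact: measurable_funB.
have a0 x : (0 <= a x)%R by rewrite /a indicE.
have a1 x : (0 <= 1 - a x)%R by rewrite subr_ge0 /a indicE; case: (x \in O).
have g0 n x : 0 <= g n x by rewrite lee_fin mulr_ge0.
have g'0 n x : 0 <= g' n x by rewrite lee_fin mulr_ge0.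
pose b n x : \bar R := (a x * a (x + h n))%:E.
have mb n : measurable_fun setT (b n) by apply/measurable_EFinP; exact: measurable_funM.
have b0 n x : 0 <= b n x by rewrite lee_fin mulr_ge0.
have intb n : \int[mu]_x b n x \is a fin_num.
  rewrite ge0_fin_numE ?integral_ge0//.
  apply: (@le_lt_trans _ _ (\int[mu]_x (a x)%:E)).
    apply: ge0_le_integral => //; first exact/measurable_EFinP.
    move=> x _; rewrite lee_fin ler_piMr//.
    by rewrite -subr_ge0.
  by rewrite integral_indic// setIT.
have muE : mu O = \int[mu]_x (a x)%:E by rewrite integral_indic// setIT.
have gg' n : \int[mu]_x g' n x = \int[mu]_x g n x.
  have gb : \int[mu]_x g n x + \int[mu]_x b n x = mu O.
    rewrite muE -ge0_integralD//.
    apply: eq_integral => x _; rewrite -EFinD; congr EFin; ring.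
  have gb' : \int[mu]_x g' n x + \int[mu]_x b n x = mu O.
    rewrite muE -ge0_integralD//.
    rewrite -[RHS](ge0_integral_shift (h n) (F := EFin \o a))//; last first.
      exact/measurable_EFinP.
    by apply: eq_integral => x _; rewrite -EFinD /=; congr EFin; ring.
  by rewrite -[LHS](addeK _ (intb n)) gb' -gb addeK.
have cg : \int[mu]_x g n x @[n --> \oo] --> 0.
  rewrite -(integral0 mu setT).
  apply: (@dominated_cvg _ _ _ mu setT _ g (cst 0) (EFin \o a)) => //.
  - move=> x _; apply: cvg_near_cst.
    have [Ox|Ox] := boolP (x \in O); last first.
      by apply: nearW => n; rewrite /g /a indicE (negbTE Ox) mul0r.
    move: (Ox); rewrite inE => /openO; apply: filterS => n On.
    by rewrite /g /a [X in (1 - X)%R]indicE mem_set// subrr mulr0.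
  - move=> n x _; rewrite gee0_abs//= lee_fin ler_piMr// lerBlDr lerDl.
    exact: a0.
have e20 : (0 < e / 2)%R by rewrite divr_gt0.
move: cg => /fine_cvgP[_ /cvgrPdist_le /(_ _ e20)] H.
have fg n : \int[mu]_x g n x \is a fin_num.
  rewrite ge0_fin_numE ?integral_ge0//.
  apply: (@le_lt_trans _ _ (\int[mu]_x (a x)%:E)).
    apply: ge0_le_integral => //; first exact/measurable_EFinP.
    by move=> x _; rewrite lee_fin ler_piMr// lerBlDr lerDl.
  by rewrite integral_indic// setIT.
apply: filterS H => n /=; rewrite sub0r normrN => Hn.
rewrite (eq_integral (fun x => g n x + g' n x)); last first.
  move=> x _; rewrite /g /g' -EFinD -/(a x) -/(a (x + h n)%R); congr EFin.
  by case/orP: (a01 x) => /eqP->; case/orP: (a01 (x + h n)%R) => /eqP->;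
    rewrite !(subrr, subr0, sub0r, normrN, normr0, normr1, mulr0, mulr1, mul0r, addr0, add0r).
rewrite ge0_integralD// gg'.
have -> : e%:E = (e / 2)%:E + (e / 2)%:E by rewrite -EFinD; congr EFin; field.
have : \int[mu]_x g n x <= (e / 2)%:E.
  rewrite -(fineK (fg n)) lee_fin; apply: le_trans Hn; exact: ler_norm.
by move=> k; exact: leeD.
Qed.

End shift_continuity_indic.

Section rectangles.
Context {R : realType} (d : nat).
Local Notation X := ('rV[R]_d).

Definition rect (O : 'I_d -> set R) : set X := [set x | forall i, O i (x ord0 i)].

Definition open_rect : set (set X) :=
  [set rect O | O in [set O | forall i, open (O i)]].

Lemma measurable_rect O : (forall i, measurable (O i)) -> measurable (rect O).
Proof.
move=> mO; rewrite [X in measurable X](_ : _ =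
    \bigcap_i ((fun x : X => x ord0 i) @^-1` O i)).
  apply: fin_bigcap_measurable => // i _.
  by rewrite -[X in measurable X]setTI; exact: measurable_rV_coord.
by apply/seteqP; split=> [x /= Ax i _|x /= Ax i]; exact: Ax.
Qed.

(** Open half-lines generate the Borel sets of the line, and the condition that one
    coordinate lies in a half-line defines an open rectangle. *)
Lemma measurable_open_rect : (@measurable _ X) = <<s open_rect >>.
Proof.
apply/seteqP; split.
  apply: smallest_sub; first exact: smallest_sigma_algebra.
  rewrite -bigcup_seq; apply: bigcup_sub => i _ A [C mC <-]; rewrite setTI.
  have : <<s @RGenOInfty.G R >> `<=` [set B | <<s open_rect >> (rV_coord i @^-1` B)].
    apply: smallest_sub.
      split => /=.
      - by rewrite preimage_set0; exact: sigma_algebra0.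
      - by move=> B GB; rewrite setTD preimage_setC -setTD; exact: sigma_algebraCD.
      - by move=> F GF; rewrite preimage_bigcup; exact: sigma_algebra_bigcup.
    move=> _ [x ->] /=; apply: sub_sigma_algebra.
    exists (fun j => if j == i then `]x, +oo[%classic else setT).
      by move=> j /=; case: ifP => _; [exact: interval_open|exact: openT].
    apply/seteqP; split => [y /(_ i)/=|y /= iy j]; first by rewrite eqxx.
    by case: eqP => // ->.
  apply; move: mC.
  change ((@ocitv R).-sigma.-measurable C -> (@RGenOInfty.G R).-sigma.-measurable C).
  by rewrite RGenOInfty.measurableE.
apply: smallest_sub; first exact: sigma_algebra_measurable.
move=> _ [U oU <-]; apply: measurable_rect => i; exact: open_measurable.
Qed.

Lemma open_rect_setI : setI_closed open_rect.
Proof.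
move=> _ _ [U oU <-] [V oV <-]; exists (fun i => U i `&` V i).
  by move=> i; exact: openI.
by apply/seteqP; split => [x /= H|x [/= H H'] i]; [split=> i; have [] := H i|split].
Qed.

Lemma open_rect_shift A (x t : X) : open_rect A -> A x ->
  \forall n \near \oo, A (x + n.+1%:R^-1 *: t).
Proof.
move=> [U oU <-] Ux; rewrite /rect/=.
have H i : \forall n \near \oo, U i ((x + n.+1%:R^-1 *: t) ord0 i).
  have : (x ord0 i + n.+1%:R^-1 * t ord0 i) @[n --> \oo] --> x ord0 i.
    rewrite -[X in _ --> X]addr0 -[X in _ --> _ + X](mul0r (t ord0 i)).
    apply: cvgD; first exact: cvg_cst.
    apply: cvgMl; exact: cvg_harmonic.
  move/(_ (U i)); have : nbhs (x ord0 i) (U i) by apply: open_nbhs_nbhs; split.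
  move=> nU /(_ nU)[N _ HN]; exists N => // n /HN /=.
  by rewrite !mxE.
exact: (@filter_forall _ _ (fun i n => U i ((x + n.+1%:R^-1 *: t) ord0 i)) _ _ H).
Qed.

Lemma rect_itv_fin_num (a b : 'I_d -> R) (p q : bool) :
  lebesgue_rV d (rect (fun i => [set` Interval (BSide p (a i)) (BSide q (b i))]))
    \is a fin_num.
Proof.
rewrite lebesgue_rV_box; last by move=> i; exact: measurable_itv.
apply: (@big_ind _ (fun x : \bar R => x \is a fin_num)) => // [x y|i _].
  exact: fin_numM.
by rewrite lebesgue_measure_itv/=; case: ifP => // _; rewrite -EFinB.
Qed.

End rectangles.

Section shift_continuity_indic_rV.
Context {R : realType} (d : nat).
Local Notation mu := (@lebesgue_rV R d).
Local Notation X := ('rV[R]_d).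
Local Open Scope ereal_scope.
Variable t : X.

Definition obox (N : nat) : set X :=
  rect (fun _ => `](- N%:R)%R, (N%:R)%R[%classic).

Lemma open_obox N : open_rect (obox N).
Proof. by exists (fun=> `](- N%:R)%R, (N%:R)%R[%classic) => // i; exact: interval_open. Qed.

Lemma measurable_obox N : measurable (obox N).
Proof. by apply: measurable_rect => i; exact: measurable_itv. Qed.

Lemma obox_fin N : mu (obox N) < +oo.
Proof.
rewrite -ge0_fin_numE ?measure_ge0//.
exact: (rect_itv_fin_num (fun=> - N%:R)%R (fun=> N%:R)%R false true).
Qed.

(** Dynkin induction from open rectangles. The box keeps all measures finite: the
    complement is taken inside it, and it dominates the partial sums over a disjoint
    union. *)
Lemma shift_cont_indic N A : measurable A -> shift_cont t \1_(A `&` obox N).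
Proof.
rewrite measurable_open_rect; have mON := measurable_obox N.
have I1 A' : measurable A' -> mu (A' `&` obox N) < +oo.
  move=> mA'; apply: le_lt_trans (obox_fin N); apply: le_measure; rewrite ?inE//.
  exact: measurableI.
move: A; refine (@dynkin_induction _ X (@open_rect R d)
  (fun A => shift_cont t \1_(A `&` obox N)) (@measurable_open_rect R d)
  (@open_rect_setI R d) _ _ _ _).
- rewrite setTI; apply: shift_cont_open; [exact: measurable_obox|exact: obox_fin|].
  by move=> x; exact/open_rect_shift/open_obox.
- move=> A' oA; have oAN := open_rect_setI oA (open_obox N).
  have mA : measurable A' by rewrite measurable_open_rect; exact: sub_sigma_algebra.
  apply: shift_cont_open; [exact: measurableI|exact: I1|].
  by move=> x; exact: open_rect_shift.
- move=> S mS VS.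
  have VB : shift_cont t \1_(obox N).
    apply: shift_cont_open; [exact: measurable_obox|exact: obox_fin|].
    by move=> x; exact/open_rect_shift/open_obox.
  have := shift_contDZ (-1)%R VB VS; congr shift_cont; apply/funext => x.
  rewrite !indicE !in_setI in_setC; case: (x \in obox N); case: (x \in S) => /=;
    by rewrite ?mulr1 ?mulr0 ?addr0 ?subrr.
- move=> F mF tF VF.
  have mUF : measurable (\bigcup_k F k) by exact: bigcup_measurable.
  have m1 B : measurable B -> measurable_fun setT (\1_(B `&` obox N) : X -> R).
    by move=> mB; apply: measurable_indic; exact: measurableI.
  have i1 B : measurable B -> mu.-integrable setT (EFin \o \1_(B `&` obox N)).
    move=> mB; apply/integrableP; split; first by apply/measurable_EFinP; exact: m1.
    under eq_integral do rewrite /= ger0_norm//.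
    by rewrite integral_indic// ?setIT; [exact: I1|exact: measurableI].
  apply: shift_cont_approx; first exact: i1.
  move=> e e0.
  pose S n (x : X) : R := (\sum_(i < n) 1 * \1_(F i `&` obox N) x)%R.
  have mS n : measurable_fun setT (S n).
    by apply: measurable_sum => i; apply: measurable_funM => //; exact: m1.
  have F0 x i j : F i x -> j != i -> (\1_(F j `&` obox N) x = 0 :> R)%R.
    move=> Fix ji; rewrite indicE in_setI memNset// => Fjx.
    have /trivIsetP/(_ j i Logic.I Logic.I ji) := tF.
    by apply/eqP/set0P; exists x.
  have SE x i n : F i x -> S n x = if (i < n)%N then \1_(obox N) x else 0%R.
    move=> Fix; case: ifPn => [ni|]; last first.
      rewrite -leqNgt => ni; rewrite /S big1// => j _; rewrite (F0 _ _ _ Fix) ?mulr0//.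
      by rewrite ltn_eqF// (leq_trans _ ni).
    rewrite /S (bigD1 (Ordinal ni))//= big1 ?addr0; last first.
      by move=> j ji; rewrite (F0 _ _ _ Fix) ?mulr0.
    by rewrite mul1r !indicE in_setI mem_set.
  have S0 x n : ~ (\bigcup_k F k) x -> S n x = 0%R.
    move=> nF; rewrite /S big1// => i _; rewrite indicE in_setI memNset ?mulr0// => Fi.
    by apply: nF; exists i.
  have U1 x i : F i x -> (\1_(\bigcup_k F k `&` obox N) x = \1_(obox N) x :> R)%R.
    by move=> Fix; rewrite !indicE in_setI mem_set//; exists i.
  have U0 x : ~ (\bigcup_k F k) x -> (\1_(\bigcup_k F k `&` obox N) x = 0 :> R)%R.
    by move=> nF; rewrite indicE in_setI memNset.
  have cvg0 : \int[mu]_x (`|\1_(\bigcup_k F k `&` obox N) x - S n x|)%:E @[n --> \oo] --> 0.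
    rewrite -(integral0 mu setT).
    apply: (@dominated_cvg _ _ _ mu setT _ _ (cst 0) (EFin \o \1_(setT `&` obox N))) => //.
    + move=> n; apply/measurable_EFinP; apply: measurableT_comp => //.
      by apply: measurable_funB => //; exact: m1.
    + move=> x _; have [[i _ Fix]|nF] := pselect ((\bigcup_k F k) x).
        apply: cvg_near_cst; near=> n; rewrite (SE x i)// (U1 x i)//.
        have -> : (i < n)%N by near: n; exact: nbhs_infty_gt.
        by rewrite subrr normr0.
      by apply: cvg_near_cst; apply: nearW => n; rewrite U0// S0// subrr normr0.
    + exact: i1.
    + move=> n x _; rewrite lee_fin/= setTI normr_id.
      have [[i _ Fix]|nF] := pselect ((\bigcup_k F k) x); last first.
        by rewrite U0// S0// subrr normr0.
      rewrite (U1 x i)// (SE x i)//; case: ifP => _; first by rewrite subrr normr0.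
      by rewrite subr0 ger0_norm.
  have [M _ /(_ M (leqnn M)) Mle] := cvge0_le cvg0 e0; exists (S M) => //.
  exact: (@shift_cont_sum _ _ _ _ _ _ (fun i : 'I_M => \1_(F i `&` obox N))).
Unshelve. all: by end_near. Qed.

End shift_continuity_indic_rV.

Lemma sqrB_le_normB (K : realDomainType) (a b : K) :
  (a - b) ^+ 2 <= 2 * `|a * `|a| - b * `|b| |.
Proof.
have key (x y : K) : 0 <= y -> y <= x -> (x - y) ^+ 2 <= 2 * (x ^+ 2 - y ^+ 2).
  move=> y0 yx; have : 0 <= (x - y) * (x + y + y + y).
    by rewrite mulr_ge0 ?subr_ge0// !addr_ge0// (le_trans y0).
  by nra.
have pos (x y : K) : 0 <= x -> 0 <= y -> (x - y) ^+ 2 <= 2 * `|x * `|x| - y * `|y| |.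
  move=> x0 y0; rewrite (ger0_norm x0) (ger0_norm y0) -!expr2.
  have [xy|yx] := leP x y.
    rewrite -[_ - _ in leLHS]opprB sqrrN ler0_norm ?subr_le0 ?ler_sqr ?nnegrE//.
    by rewrite opprB; exact: key.
  by rewrite ger0_norm ?subr_ge0 ?ler_sqr ?nnegrE ?(ltW yx)//; apply: key => //; exact: ltW.
have mix (x y : K) : 0 <= x -> y <= 0 -> (x - y) ^+ 2 <= 2 * `|x * `|x| - y * `|y| |.
  move=> x0 y0; rewrite (ger0_norm x0) (ler0_norm y0) mulrN opprK -!expr2.
  rewrite ger0_norm ?addr_ge0 ?sqr_ge0//.
  by have := sqr_ge0 (x + y); nra.
have [a0|/ltW a0] := leP 0 a; have [b0|/ltW b0] := leP 0 b.
- exact: pos.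
- exact: mix.
- by rewrite -opprB sqrrN distrC; exact: mix.
- have := pos (- a) (- b); rewrite !oppr_ge0 => /(_ a0 b0).
  by rewrite !normrN !mulNr -!opprD sqrrN normrN.
Qed.

Section shift_continuity_L2.
Import HBSimple.
Context {R : realType} (d : nat).
Local Notation mu := (@lebesgue_rV R d).
Local Notation X := ('rV[R]_d).
Local Open Scope ereal_scope.
Variable t : X.
Local Notation obox := (@obox R d).

(** Truncation to a large box, then approximation by a simple function. *)
Lemma shift_cont_integrable (w : X -> R) :
  mu.-integrable setT (EFin \o w) -> shift_cont t w.
Proof.
move=> iw; apply: shift_cont_approx => // e e0.
have e20 : (0 < e / 2)%R by rewrite divr_gt0.
have /measurable_EFinP mw := measurable_int _ iw.
have mO N := @measurable_obox R d N.
have mB N : measurable_fun setT (\1_(obox N) : X -> R) by exact: measurable_indic.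
have cvg0 : \int[mu]_x `|w x - w x * \1_(obox N) x|%:E @[N --> \oo] --> 0.
  rewrite -(integral0 mu setT).
  apply: (@dominated_cvg _ _ _ mu setT _ _ (cst 0) (fun x => `|w x|%:E)) => //.
  - move=> N; apply/measurable_EFinP; apply: measurableT_comp => //.
    by apply: measurable_funB => //; exact: measurable_funM.
  - move=> x _; apply: cvg_near_cst.
    have H i : \forall N \near \oo, x ord0 i \in `](- N%:R)%R, (N%:R)%R[.
      have : \forall N \near \oo, (`|x ord0 i| < N%:R)%R by exact: nbhs_infty_gtr.
      by apply: filterS => N; rewrite in_itv/= ltr_norml.
    have : \forall N \near \oo, forall i, x ord0 i \in `](- N%:R)%R, (N%:R)%R[.
      exact: (@filter_forall _ _ (fun i N => x ord0 i \in `](- N%:R)%R, (N%:R)%R[) _ _ H).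
    apply: filterS => N xN; rewrite indicE mem_set ?mulr1 ?subrr ?normr0//.
  - by move/integrable_abse : iw.
  - move=> N x _; rewrite lee_fin normr_id indicE; case: (x \in obox N).
      by rewrite mulr1 subrr normr0.
    by rewrite mulr0 subr0.
have [N _ /(_ N (leqnn N)) wN] := cvge0_le cvg0 e20.
have iwN : mu.-integrable (obox N) (EFin \o w) by exact: integrableS iw.
have [g [_ _]] := approximation_sfun_integrable (@measurable_obox R d N) iwN.
move=> /cvge0_le /(_ _ e20) [k _ /(_ k (leqnn k))].
set h := g k => wh.
have mh : measurable_fun setT h by exact: measurable_funP.
exists (fun x => h x * \1_(obox N) x)%R.
  rewrite (_ : (fun x => _) = (fun x => \sum_(y <- finmap.enum_fset (fset_set (range h)))
      y * \1_((h @^-1` [set y]) `&` obox N) x)%R).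
    apply: shift_cont_sum => y; apply: shift_cont_indic.
    by rewrite -[X in measurable X]setTI; exact: mh.
  apply/funext => x; rewrite [in LHS](fimfunE h x) fsbig_finite//=.
  rewrite mulr_suml; apply: eq_bigr => y _; rewrite -mulrA; congr (_ * _)%R.
  by rewrite !indicE in_setI; case: (x \in h @^-1` [set y]) => /=; rewrite ?mul1r ?mul0r.
have m1 : measurable_fun setT (fun x => w x * \1_(obox N) x)%R.
  exact: measurable_funM.
have m2 : measurable_fun setT (fun x => h x * \1_(obox N) x)%R.
  exact: measurable_funM.
apply: le_trans (L1_triangle mu mw m1 m2) _.
have -> : e%:E = (e / 2)%:E + (e / 2)%:E by rewrite -EFinD; congr EFin; field.
apply: leeD => //; apply: le_trans wh.
rewrite [leRHS]integral_mkcond; apply: ge0_le_integral => //.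
- apply/measurable_EFinP; apply: measurableT_comp => //; exact: measurable_funB.
- apply/(measurable_restrictT _ (mO N)).
  apply/measurable_EFinP; apply: measurable_funTS.
  by apply: measurableT_comp => //; exact: measurable_funB.
- move=> x _; rewrite patchE indicE; case: ifP => _.
    by rewrite !mulr1 -EFinB.
  by rewrite !mulr0 subrr normr0.
Qed.

(** For [w = u * `|u|] one has [(a - b)^2 <= 2 `|a `|a| - b `|b| |], so that the
    L^1 statement for [w] gives the L^2 statement for [u]. *)
Lemma shift_cont_L2 (u : X -> R) : measurable_fun setT u ->
  \int[mu]_x (u x ^+ 2)%:E < +oo ->
  forall e : R, (0 < e)%R -> \forall n \near \oo,
  \int[mu]_x ((u (x + n.+1%:R^-1 *: t)%R - u x) ^+ 2)%:E <= e%:E.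
Proof.
move=> mu_ u2 e e0; pose w x := (u x * `|u x|)%R.
have mw : measurable_fun setT w.
  by apply: measurable_funM => //; exact: measurableT_comp.
have iw : mu.-integrable setT (EFin \o w).
  apply/integrableP; split; first exact/measurable_EFinP.
  under eq_integral do rewrite /= normrM normr_id -expr2 real_normK ?num_real//.
  by [].
have e20 : (0 < e / 2)%R by rewrite divr_gt0.
have [_ /(_ _ e20)] := shift_cont_integrable iw.
apply: filterS => n wn.
have ms : measurable_fun setT (fun x : X => u (x + n.+1%:R^-1 *: t)%R).
  exact: (measurableT_comp mu_ (measurable_shift _)).
have msw : measurable_fun setT (fun x : X => w (x + n.+1%:R^-1 *: t)%R).
  exact: (measurableT_comp mw (measurable_shift _)).
have mD : measurable_fun setT (fun x : X => `|w (x + n.+1%:R^-1 *: t) - w x|%:E).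
  by apply/measurable_EFinP; apply: measurableT_comp => //; exact: measurable_funB.
apply: (@le_trans _ _ (\int[mu]_x (2%:E * `|w (x + n.+1%:R^-1 *: t)%R - w x|%:E))).
  apply: ge0_le_integral => //.
  - by move=> x _; rewrite lee_fin sqr_ge0.
  - by apply/measurable_EFinP; apply: measurable_funX; exact: measurable_funB.
  - exact: measurable_funeM.
  move=> x _; rewrite -EFinM lee_fin /w.
  move: (u (x + _)%R) (u x) => a b.
  exact: sqrB_le_normB.
rewrite ge0_integralZl//.
have -> : e%:E = 2%:E * (e / 2)%:E by rewrite -EFinM; congr EFin; field.
by apply: lee_wpmul2l => //; rewrite lee_fin.
Qed.

End shift_continuity_L2.

(** * Fourier inversion at the origin, as an inequality *)

Lemma integrable_measurable_fun d (T : measurableType d) (R : realType)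
    (mu : {measure set T -> \bar R}) (D : set T) (f : T -> R) :
  mu.-integrable D (EFin \o f) -> measurable_fun D f.
Proof. by move=> /measurable_int/measurable_EFinP. Qed.

Section integrable_prod.
Context d1 d2 (T1 : measurableType d1) (T2 : measurableType d2) (R : realType).
Variables (m1 : {sigma_finite_measure set T1 -> \bar R})
  (m2 : {sigma_finite_measure set T2 -> \bar R}).
Local Open Scope ereal_scope.

Lemma integrable_tensor (g : T1 -> R) (h : T2 -> R) :
  m1.-integrable setT (EFin \o g) -> m2.-integrable setT (EFin \o h) ->
  (m1 \x m2).-integrable setT (fun z => (g z.1 * h z.2)%:E).
Proof.
move=> ig ih.
have /measurable_EFinP mg := measurable_int _ ig.
have /measurable_EFinP mh := measurable_int _ ih.
apply/integrable12ltyP.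
  apply/measurable_EFinP; apply: measurable_funM.
    by apply: measurableT_comp mg _; exact: measurable_fst.
  by apply: measurableT_comp mh _; exact: measurable_snd.
have /integrableP[_ goo] := ig; have /integrableP[_ hoo] := ih.
rewrite (eq_integral (fun x => (`|g x|%:E * \int[m2]_y `|h y|%:E))); last first.
  move=> x _; rewrite -ge0_integralZl//; last first.
    by apply/measurable_EFinP; exact: measurableT_comp.
  by apply: eq_integral => y _; rewrite /= normrM EFinM.
rewrite ge0_integralZr//; last 2 first.
- by apply/measurable_EFinP; exact: measurableT_comp.
- exact: integral_ge0.
by apply: lte_mul_pinfty => //; [exact: integral_ge0|rewrite ge0_fin_numE ?integral_ge0].
Qed.

Lemma measurable_Rintegral (f : T1 * T2 -> R) : measurable_fun setT f ->
  measurable_fun setT (fun x => \int[m2]_y f (x, y))%R.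
Proof.
move=> mf; apply: measurableT_comp; first exact: fine_measurable.
have mEf : measurable_fun setT (EFin \o f) by exact/measurable_EFinP.
rewrite [X in measurable_fun _ X](_ : _ =
   (fun x => \int[m2]_y (EFin \o f)^\+ (x, y) - \int[m2]_y (EFin \o f)^\- (x, y))).
  apply: emeasurable_funB.
    exact: (measurable_fun_fubini_tonelli_F _ (measurable_funepos mEf)).
  exact: (measurable_fun_fubini_tonelli_F _ (measurable_funeneg mEf)).
apply/funext => x; rewrite [LHS]integralE; congr (_ - _); apply: eq_integral => y _.
  by have := funepos_comp (EFin \o f) (pair x) => /(congr1 (@^~ y)).
by have := funeneg_comp (EFin \o f) (pair x) => /(congr1 (@^~ y)).
Qed.

End integrable_prod.

Section inversion.
Context {R : realType} (d : nat).
Local Notation mu := (@lebesgue_rV R d).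
Local Notation X := ('rV[R]_d).
Local Open Scope ereal_scope.

Lemma measurable_dotv2 :
  measurable_fun setT (fun z : X * X => dotv z.1 z.2).
Proof.
apply: measurable_sum => i; apply: measurable_funM.
  by apply: measurableT_comp (measurable_rV_coord i) _; exact: measurable_fst.
by apply: measurableT_comp (measurable_rV_coord i) _; exact: measurable_snd.
Qed.

Lemma dotvZl (a : R) (t w : X) : dotv (a *: t) w = (a * dotv t w)%R.
Proof. by rewrite /dotv mulr_sumr; apply: eq_bigr => i _; rewrite mxE mulrA. Qed.

Lemma dotvC (t w : X) : dotv t w = dotv w t.
Proof. by apply: eq_bigr => i _; rewrite mulrC. Qed.

Lemma dotvZr (a : R) (t w : X) : dotv t (a *: w) = (a * dotv t w)%R.
Proof. by rewrite dotvC dotvZl dotvC. Qed.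

Lemma measurable_cos_dotv2 :
  measurable_fun setT (fun z : X * X => cos (2 * pi * dotv z.1 z.2)).
Proof.
apply: measurableT_comp; first by apply: continuous_measurable_fun; exact: continuous_cos.
by apply: measurable_funM => //; exact: measurable_dotv2.
Qed.

Lemma measurable_sin_dotv2 :
  measurable_fun setT (fun z : X * X => sin (2 * pi * dotv z.1 z.2)).
Proof.
apply: measurableT_comp; first by apply: continuous_measurable_fun; exact: continuous_sin.
by apply: measurable_funM => //; exact: measurable_dotv2.
Qed.

(** The real part of the Fourier transform at [w] of [P + iQ]; its imaginary part is
    [refourier Q (- P)]. *)
Definition refourier (P Q : X -> R) (w : X) : R :=
  (\int[mu]_t (P t * cos (2 * pi * dotv t w) + Q t * sin (2 * pi * dotv t w)))%R.

Lemma integrable_cosM (g : X -> R) w : mu.-integrable setT (EFin \o g) ->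
  mu.-integrable setT (fun t => (g t * cos (2 * pi * dotv t w))%:E).
Proof.
move=> ig; under eq_fun do rewrite dotvC.
apply: integrableM_le1 => //; first exact: measurable_cos_dotv.
by move=> x; exact: normr_cos_le1.
Qed.

Lemma integrable_sinM (g : X -> R) w : mu.-integrable setT (EFin \o g) ->
  mu.-integrable setT (fun t => (g t * sin (2 * pi * dotv t w))%:E).
Proof.
move=> ig; under eq_fun do rewrite dotvC.
apply: integrableM_le1 => //; first exact: measurable_sin_dotv.
by move=> x; exact: normr_sin_le1.
Qed.

Lemma integrable_refourier (P Q : X -> R) w :
  mu.-integrable setT (EFin \o P) -> mu.-integrable setT (EFin \o Q) ->
  mu.-integrable setT (EFin \o (fun t =>
    P t * cos (2 * pi * dotv t w) + Q t * sin (2 * pi * dotv t w))%R).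
Proof.
move=> iP iQ; rewrite (_ : EFin \o _ =
  (fun t => (P t * cos (2 * pi * dotv t w))%:E + (Q t * sin (2 * pi * dotv t w))%:E)).
  by apply: integrableD => //; [exact: integrable_cosM|exact: integrable_sinM].
by apply/funext => t; rewrite /= EFinD.
Qed.

Variables P Q : X -> R.
Hypotheses (iP : mu.-integrable setT (EFin \o P)) (iQ : mu.-integrable setT (EFin \o Q)).

Let mP : measurable_fun setT P. Proof. exact: integrable_measurable_fun iP. Qed.
Let mQ : measurable_fun setT Q. Proof. exact: integrable_measurable_fun iQ. Qed.

Lemma refourierE w : (refourier P Q w)%:E =
  \int[mu]_t (P t * cos (2 * pi * dotv t w) + Q t * sin (2 * pi * dotv t w))%:E.
Proof.
rewrite /refourier /Rintegral fineK//.
exact: (integrable_fin_num measurableT (integrable_refourier w iP iQ)).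
Qed.

Variable M : R.
Hypothesis PM : forall t, (`|P t| <= M)%R.

Variable n : nat.
Let a : R := n.+1%:R.
Let a_neq0 : a != 0%R. Proof. by rewrite /a. Qed.
Let aV_neq0 : (a^-1 != 0)%R. Proof. by rewrite invr_eq0. Qed.

Let Phi (z : X * X) : \bar R := ((P z.1 * cos (2 * pi * dotv z.1 z.2) +
   Q z.1 * sin (2 * pi * dotv z.1 z.2)) * laplace_kernel (a^-1 *: z.2))%:E.

Let imn : mu.-integrable setT (fun w => (laplace_kernel (a^-1 *: w))%:E).
Proof.
have := integrable_affine 0%R aV_neq0 (@integrable_laplace_kernel R d).
by under eq_fun do rewrite addr0.
Qed.

Let mmn : measurable_fun setT (fun w : X => laplace_kernel (a^-1 *: w)).
Proof. exact: integrable_measurable_fun imn. Qed.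

Let iPhi : (mu \x mu).-integrable setT Phi.
Proof.
have iPQn : mu.-integrable setT (EFin \o (fun t => `|P t| + `|Q t|)%R).
  rewrite (_ : EFin \o _ = (fun t => `|(P t)%:E| + `|(Q t)%:E|)).
    by apply: integrableD => //; exact: integrable_abse.
  by apply/funext => t.
have m1 : measurable_fun setT (fun z : X * X => P z.1).
  by apply: measurableT_comp mP _; exact: measurable_fst.
have m2 : measurable_fun setT (fun z : X * X => Q z.1).
  by apply: measurableT_comp mQ _; exact: measurable_fst.
have m3 : measurable_fun setT (fun z : X * X => laplace_kernel (a^-1 *: z.2)).
  by apply: measurableT_comp mmn _; exact: measurable_snd.
apply: le_integrable (integrable_tensor iPQn imn) => //.
  apply/measurable_EFinP; apply: measurable_funM => //.
  by apply: measurable_funD; apply: measurable_funM => //;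
    [exact: measurable_cos_dotv2|exact: measurable_sin_dotv2].
move=> z _; rewrite lee_fin !normrM ler_wpM2r// [leRHS]ger0_norm ?addr_ge0//.
apply: le_trans (ler_normD _ _) _; rewrite !normrM lerD// ler_piMr//.
  exact: normr_cos_le1.
exact: normr_sin_le1.
Qed.

Let iH : mu.-integrable setT (fun t => (P (a^-1 *: t)%R * poisson_kernel t)%:E).
Proof.
have mk := @measurable_poisson_kernel R d.
have ik : mu.-integrable setT (fun t => (M * poisson_kernel t)%:E).
  under eq_fun do rewrite EFinM; apply: integrableZl => //.
  apply/integrableP; split; first exact/measurable_EFinP.
  under eq_integral do rewrite abse_EFin ger0_norm ?poisson_kernel_ge0//.
  by rewrite integral_poisson_kernel ltry.
apply: le_integrable ik => //.
  apply/measurable_EFinP; apply: measurable_funM => //.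
  have := measurableT_comp mP (measurable_affine a^-1 (0%R : X)).
  by under eq_fun do rewrite addr0.
move=> t _; rewrite lee_fin !normrM ler_wpM2r//.
exact: le_trans (PM _) (ler_norm _).
Qed.

(** Fubini, then the change of variables [w := a w], then [t := a t]. *)
Lemma integral_refourier_laplace :
  \int[mu]_w (refourier P Q w * laplace_kernel (a^-1 *: w))%:E =
  \int[mu]_t (P (a^-1 *: t)%R * poisson_kernel t)%:E.
Proof.
transitivity (\int[mu]_w \int[mu]_t Phi (t, w)).
  apply: eq_integral => w _; rewrite EFinM refourierE -integralZr//.
  exact: integrable_refourier.
transitivity (\int[mu]_t \int[mu]_w Phi (t, w)); first exact: esym (Fubini iPhi).
have a0 : (0 < a)%R by rewrite /a.
have ic (t : X) := integrableM_le1 (@integrable_laplace_kernel R d)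
  (measurable_cos_dotv (a *: t)) (fun x => normr_cos_le1 _).
have is_ (t : X) := integrableM_le1 (@integrable_laplace_kernel R d)
  (measurable_sin_dotv (a *: t)) (fun x => normr_sin_le1 _).
have scale (t w : X) : dotv (a *: t) (a^-1 *: w + 0)%R = dotv t w.
  by rewrite addr0 dotvZl dotvZr mulrA divff// mul1r.
have aVd : ((`|a^-1| ^+ d)^-1 = a ^+ d)%R.
  by rewrite normrV ?unitfE// exprVn invrK gtr0_norm.
transitivity (\int[mu]_t ((a ^+ d)%:E * (P t * poisson_kernel (a *: t))%:E)).
  apply: eq_integral => t _.
  rewrite (eq_integral (fun w : X => (P t)%:E *
      (laplace_kernel (a^-1 *: w + 0) * cos (2 * pi * dotv (a *: t) (a^-1 *: w + 0)))%:E +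
      (Q t)%:E *
      (laplace_kernel (a^-1 *: w + 0) * sin (2 * pi * dotv (a *: t) (a^-1 *: w + 0)))%:E)); last first.
    move=> w _; rewrite !scale addr0 -!EFinM -EFinD; congr EFin => /=; ring.
  have ic' := integrable_affine 0%R aV_neq0 (ic t).
  have is' := integrable_affine 0%R aV_neq0 (is_ t).
  rewrite integralD//; [|exact: integrableZl..].
  rewrite !integralZl//.
  have := integral_affine 0%R aV_neq0 (ic t) => ->.
  have := integral_affine 0%R aV_neq0 (is_ t) => ->.
  rewrite integral_laplace_cos integral_laplace_sin !mule0 adde0 aVd.
  by rewrite muleCA EFinM.
pose H t := (P (a^-1 *: t)%R * poisson_kernel t)%:E.
have iHa : mu.-integrable setT (fun t => (P t * poisson_kernel (a *: t))%:E).
  have := integrable_affine 0%R a_neq0 iH.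
  by under eq_fun do rewrite addr0 scalerA mulVf// scale1r.
have hH : \int[mu]_t (P t * poisson_kernel (a *: t))%:E =
    ((`|a| ^+ d)^-1)%:E * \int[mu]_t H t.
  rewrite -(integral_affine 0%R a_neq0 iH).
  by apply: eq_integral => t _; rewrite addr0 scalerA mulVf// scale1r.
rewrite integralZl// hH gtr0_norm// muleA -EFinM divff ?mul1e//.
by rewrite expf_neq0.
Qed.

End inversion.

Section inversion_inequality.
Context {R : realType} (d : nat).
Local Notation mu := (@lebesgue_rV R d).
Local Notation X := ('rV[R]_d).
Local Open Scope ereal_scope.

Lemma measurable_refourier (P Q : X -> R) :
  mu.-integrable setT (EFin \o P) -> mu.-integrable setT (EFin \o Q) ->
  measurable_fun setT (refourier P Q).
Proof.
move=> /integrable_measurable_fun mP /integrable_measurable_fun mQ.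
apply: (@measurable_Rintegral _ _ X X R mu (fun z : X * X =>
  P z.2 * cos (2 * pi * dotv z.2 z.1) + Q z.2 * sin (2 * pi * dotv z.2 z.1))%R).
have m1 : measurable_fun setT (fun z : X * X => cos (2 * pi * dotv z.2 z.1)).
  by under eq_fun do rewrite dotvC; exact: measurable_cos_dotv2.
have m2 : measurable_fun setT (fun z : X * X => sin (2 * pi * dotv z.2 z.1)).
  by under eq_fun do rewrite dotvC; exact: measurable_sin_dotv2.
apply: measurable_funD; apply: measurable_funM => //.
  by apply: measurableT_comp mP _; exact: measurable_snd.
by apply: measurableT_comp mQ _; exact: measurable_snd.
Qed.

(** The integral of [refourier P Q w * laplace_kernel (w / n)] is the average of
    [P (t / n)] against the Poisson kernel, which has mass 1, hence tends to [P 0];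
    and it is at most the right-hand side since the Laplace kernel has values in
    [[0, 1]]. *)
Lemma inversion_inequality (P Q : X -> R) (M : R) :
  mu.-integrable setT (EFin \o P) -> mu.-integrable setT (EFin \o Q) ->
  (forall t, `|P t| <= M)%R ->
  (forall t, P (n.+1%:R^-1 *: t)%R @[n --> \oo] --> P 0%R) ->
  `|P 0%R|%:E <= \int[mu]_w `|refourier P Q w|%:E.
Proof.
move=> iP iQ PM cP.
have mP : measurable_fun setT P by exact: integrable_measurable_fun iP.
have mk := @measurable_poisson_kernel R d.
have ik : mu.-integrable setT (fun t => (M * poisson_kernel t)%:E).
  under eq_fun do rewrite EFinM; apply: integrableZl => //.
  apply/integrableP; split; first exact/measurable_EFinP.
  under eq_integral do rewrite abse_EFin ger0_norm ?poisson_kernel_ge0//.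
  by rewrite integral_poisson_kernel ltry.
have cI : \int[mu]_t (P (n.+1%:R^-1 *: t)%R * poisson_kernel t)%:E @[n --> \oo] -->
    \int[mu]_t (P 0%R * poisson_kernel t)%:E.
  apply: (@dominated_cvg _ _ _ mu setT _ _ _ (fun t => (M * poisson_kernel t)%:E)) => //.
  - move=> n; apply/measurable_EFinP; apply: measurable_funM => //.
    have := measurableT_comp mP (measurable_affine n.+1%:R^-1 (0%R : X)).
    by under eq_fun do rewrite addr0.
  - by move=> t _; apply: cvg_EFin; [exact: nearW|apply: cvgMl; exact: cP].
  - move=> n t _; rewrite lee_fin !normrM (ger0_norm (poisson_kernel_ge0 _)).
    by rewrite ler_wpM2r// poisson_kernel_ge0.
have P0 : \int[mu]_t (P 0%R * poisson_kernel t)%:E = (P 0%R)%:E.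
  under eq_integral do rewrite EFinM.
  rewrite integralZl//; first by rewrite integral_poisson_kernel mule1.
  apply/integrableP; split; first exact/measurable_EFinP.
  under eq_integral do rewrite abse_EFin ger0_norm ?poisson_kernel_ge0//.
  by rewrite integral_poisson_kernel ltry.
rewrite P0 in cI.
have cN : `|\int[mu]_t (P (n.+1%:R^-1 *: t)%R * poisson_kernel t)%:E| @[n --> \oo] -->
    `|(P 0%R)%:E| by exact: cvg_abse.
rewrite -[leLHS](cvg_lim _ cN)//; apply: lime_le.
  by apply/cvg_ex; exists `|(P 0%R)%:E|.
have mA := measurable_refourier iP iQ.
have mm n : measurable_fun setT (fun w : X => laplace_kernel (n.+1%:R^-1 *: w)).
  have := measurableT_comp (@measurable_laplace_kernel R d)
    (measurable_affine n.+1%:R^-1 (0%R : X)).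
  by under eq_fun do rewrite addr0.
apply: nearW => n; rewrite -(integral_refourier_laplace iP iQ PM).
apply: le_trans (le_abse_integral _ _ _) _ => //.
  by apply/measurable_EFinP; exact: measurable_funM.
apply: ge0_le_integral => //.
- apply: measurableT_comp => //.
  by apply/measurable_EFinP; exact: measurable_funM.
- by apply/measurable_EFinP; exact: measurableT_comp.
move=> w _; rewrite lee_fin normrM ler_piMr// ger0_norm ?laplace_kernel_ge0//.
exact: laplace_kernel_le1.
Qed.

End inversion_inequality.

(** * Correlations and the Wigner distribution *)

Section complex_lemmas.
Context {R : realType}.
Implicit Types z w : R[i].
Local Open Scope complex_scope.

Definition sqn z : R := complex.Re z ^+ 2 + complex.Im z ^+ 2.

Lemma sqn_ge0 z : 0 <= sqn z. Proof. by rewrite addr_ge0// sqr_ge0. Qed.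

Lemma sqr_normc z : normc z ^+ 2 = sqn z.
Proof. by rewrite Defs.normcE sqr_sqrtr// sqn_ge0. Qed.

(** The real and imaginary parts of [z] times the conjugate of [w]. *)
Definition redot z w : R := complex.Re z * complex.Re w + complex.Im z * complex.Im w.
Definition imdot z w : R := complex.Im z * complex.Re w - complex.Re z * complex.Im w.

Lemma ReMexpi z w t : complex.Re (z * w^* * expi (- t)) =
  redot z w * cos t + imdot z w * sin t.
Proof.
by case: z w => [a b] [c e]; rewrite /redot /imdot /expi cosN sinN /=; ring.
Qed.

Lemma ImMexpi z w t : complex.Im (z * w^* * expi (- t)) =
  imdot z w * cos t - redot z w * sin t.
Proof.
by case: z w => [a b] [c e]; rewrite /redot /imdot /expi cosN sinN /=; ring.
Qed.

Lemma normr_Re_le z : `|complex.Re z| <= normc z.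
Proof.
rewrite -ler_sqr ?nnegrE ?Defs.normc_ge0// sqr_normc real_normK ?num_real//.
by rewrite lerDl sqr_ge0.
Qed.

Lemma normr_Im_le z : `|complex.Im z| <= normc z.
Proof.
rewrite -ler_sqr ?nnegrE ?Defs.normc_ge0// sqr_normc real_normK ?num_real//.
by rewrite lerDr sqr_ge0.
Qed.

Lemma normc_le_ReIm z : normc z <= `|complex.Re z| + `|complex.Im z|.
Proof.
rewrite -ler_sqr ?nnegrE ?Defs.normc_ge0 ?addr_ge0// sqr_normc sqrrD !real_normK ?num_real//.
by rewrite /sqn lerD2r lerDl mulrn_wge0// mulr_ge0.
Qed.

Lemma normr_redot_le z w : `|redot z w| <= normc z * normc w.
Proof.
rewrite -ler_sqr ?nnegrE ?mulr_ge0 ?Defs.normc_ge0// exprMn !sqr_normc real_normK ?num_real//.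
by rewrite /redot /sqn -subr_ge0; have := sqr_ge0 (imdot z w); rewrite /imdot; nra.
Qed.

Lemma normr_imdot_le z w : `|imdot z w| <= normc z * normc w.
Proof.
rewrite -ler_sqr ?nnegrE ?mulr_ge0 ?Defs.normc_ge0// exprMn !sqr_normc real_normK ?num_real//.
by rewrite /imdot /sqn -subr_ge0; have := sqr_ge0 (redot z w); rewrite /redot; nra.
Qed.

Lemma sqnB z w : sqn (z - w) = sqn z + sqn w - 2 * redot z w.
Proof. by case: z w => [a b] [c e]; rewrite /sqn /redot /=; ring. Qed.

Lemma redotB z w z' w' :
  redot z w - redot z' w' = redot (z - z') w + redot z' (w - w').
Proof. by case: z w z' w' => [a b] [c e] [a' b'] [c' e']; rewrite /redot /=; ring. Qed.

End complex_lemmas.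

Section local_autocorrelation.
Context {R : realType} (d : nat).
Local Notation mu := (@lebesgue_rV R d).
Local Notation X := ('rV[R]_d).
Local Open Scope ereal_scope.

Lemma measurable_addZ (c : R) : measurable_fun setT (fun z : X * X => z.1 + c *: z.2)%R.
Proof.
apply: measurable_rV => i; under eq_fun do rewrite !mxE.
apply: measurable_funD.
  by apply: measurableT_comp (measurable_rV_coord i) _; exact: measurable_fst.
apply: measurable_funM => //.
by apply: measurableT_comp (measurable_rV_coord i) _; exact: measurable_snd.
Qed.

Lemma measurable_add2 : measurable_fun setT (fun z : X * X => z.1 + z.2)%R.
Proof. by have := measurable_addZ 1; under eq_fun do rewrite scale1r. Qed.

Variable f : X -> R[i].

(** The integrand of the Wigner distribution before the exponential factor: its real
    part, imaginary part and modulus. *)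
Definition corr_re (x t : X) : R := redot (f (x + 2^-1 *: t)) (f (x - 2^-1 *: t)).
Definition corr_im (x t : X) : R := imdot (f (x + 2^-1 *: t)) (f (x - 2^-1 *: t)).
Definition corr_abs (x t : X) : R :=
  (normc (f (x + 2^-1 *: t)) * normc (f (x - 2^-1 *: t)))%R.

Lemma corr_abs_ge0 x t : (0 <= corr_abs x t)%R.
Proof. by rewrite mulr_ge0// Defs.normc_ge0. Qed.

Lemma normr_corr_re x t : (`|corr_re x t| <= corr_abs x t)%R.
Proof. exact: normr_redot_le. Qed.

Lemma normr_corr_im x t : (`|corr_im x t| <= corr_abs x t)%R.
Proof. exact: normr_imdot_le. Qed.

Lemma Re_wignerE x w :
  complex.Re (wigner f x w) = refourier (corr_re x) (corr_im x) w.
Proof. by apply: eq_Rintegral => t _; rewrite ReMexpi. Qed.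

Lemma Im_wignerE x w :
  complex.Im (wigner f x w) = refourier (corr_im x) (fun t => - corr_re x t)%R w.
Proof. by apply: eq_Rintegral => t _; rewrite ImMexpi mulNr. Qed.

Hypothesis mf : cmeasurable f.

Let mu_ : measurable_fun setT (fun x => complex.Re (f x)). Proof. by case: mf. Qed.
Let mv : measurable_fun setT (fun x => complex.Im (f x)). Proof. by case: mf. Qed.
Let ma : measurable_fun setT (fun x => normc (f x)). Proof. exact: measurable_normc. Qed.

Let mplus := measurable_addZ 2^-1.
Let mminus : measurable_fun setT (fun z : X * X => z.1 - 2^-1 *: z.2)%R.
Proof. by under eq_fun do rewrite -scaleNr; exact: measurable_addZ. Qed.

Lemma measurable_corr_re : measurable_fun setT (fun z : X * X => corr_re z.1 z.2).
Proof.
by apply: measurable_funD; apply: measurable_funM;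
  [exact: (measurableT_comp mu_ mplus)|exact: (measurableT_comp mu_ mminus)|
   exact: (measurableT_comp mv mplus)|exact: (measurableT_comp mv mminus)].
Qed.

Lemma measurable_corr_im : measurable_fun setT (fun z : X * X => corr_im z.1 z.2).
Proof.
by apply: measurable_funB; apply: measurable_funM;
  [exact: (measurableT_comp mv mplus)|exact: (measurableT_comp mu_ mminus)|
   exact: (measurableT_comp mu_ mplus)|exact: (measurableT_comp mv mminus)].
Qed.

Lemma measurable_corr_abs : measurable_fun setT (fun z : X * X => corr_abs z.1 z.2).
Proof.
by apply: measurable_funM;
  [exact: (measurableT_comp ma mplus)|exact: (measurableT_comp ma mminus)].
Qed.

Lemma measurable_wigner :
  cmeasurable (fun z : X * X => wigner f z.1 z.2).
Proof.
have m1 : measurable_fun setT (fun z : (X * X) * X => cos (2 * pi * dotv z.2 z.1.2)).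
  apply: (measurableT_comp (f := fun z : X * X => cos (2 * pi * dotv z.1 z.2))
    (g := fun z : (X * X) * X => (z.2, z.1.2))); first exact: measurable_cos_dotv2.
  apply/measurable_fun_pairP; split; first exact: measurable_snd.
  exact: (measurableT_comp measurable_snd measurable_fst).
have m2 : measurable_fun setT (fun z : (X * X) * X => sin (2 * pi * dotv z.2 z.1.2)).
  apply: (measurableT_comp (f := fun z : X * X => sin (2 * pi * dotv z.1 z.2))
    (g := fun z : (X * X) * X => (z.2, z.1.2))); first exact: measurable_sin_dotv2.
  apply/measurable_fun_pairP; split; first exact: measurable_snd.
  exact: (measurableT_comp measurable_snd measurable_fst).
have mxt : measurable_fun setT (fun z : (X * X) * X => (z.1.1, z.2)).
  apply/measurable_fun_pairP; split; last exact: measurable_snd.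
  exact: (measurableT_comp measurable_fst measurable_fst).
have m3 := measurableT_comp measurable_corr_re mxt.
have m4 := measurableT_comp measurable_corr_im mxt.
split.
  under eq_fun do rewrite Re_wignerE.
  apply: (@measurable_Rintegral _ _ (X * X)%type X R mu (fun z : (X * X) * X =>
    corr_re z.1.1 z.2 * cos (2 * pi * dotv z.2 z.1.2) +
    corr_im z.1.1 z.2 * sin (2 * pi * dotv z.2 z.1.2))%R).
  by apply: measurable_funD; exact: measurable_funM.
under eq_fun do rewrite Im_wignerE.
apply: (@measurable_Rintegral _ _ (X * X)%type X R mu (fun z : (X * X) * X =>
    corr_im z.1.1 z.2 * cos (2 * pi * dotv z.2 z.1.2) +
    - corr_re z.1.1 z.2 * sin (2 * pi * dotv z.2 z.1.2))%R).
by apply: measurable_funD; apply: measurable_funM => //; exact: measurable_funN.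
Qed.

Hypothesis f1 : \int[mu]_x (normc (f x))%:E < +oo.

(** Translating [x] by [t / 2] turns the integrand into [|f (x + t)| * |f x|], whose
    double integral is the square of the L^1 norm of [f]. *)
Lemma integrable_corr_abs :
  (mu \x mu).-integrable setT (fun z => (corr_abs z.1 z.2)%:E).
Proof.
apply/integrable21ltyP; first by apply/measurable_EFinP; exact: measurable_corr_abs.
pose a x := normc (f x).
have a0 x : (0 <= a x)%R by exact: Defs.normc_ge0.
have mb : measurable_fun setT (fun z : X * X => (a (z.1 + z.2)%R * a z.1)%:E).
  apply/measurable_EFinP; apply: measurable_funM.
    exact: (measurableT_comp ma measurable_add2).
  exact: (measurableT_comp ma measurable_fst).
rewrite (eq_integral (fun t => \int[mu]_x (a (x + t)%R * a x)%:E)); last first.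
  move=> t _.
  rewrite -(ge0_integral_shift (2^-1 *: t)%R (F := fun x => `|(corr_abs x t)%:E|))//.
    apply: eq_integral => x _; rewrite gee0_abs ?lee_fin ?corr_abs_ge0//=.
    rewrite /corr_abs addrK; congr (a _ * _)%:E.
    by rewrite -addrA -scalerDl; congr (_ + _)%R; rewrite -[RHS]scale1r; congr (_ *: _)%R; field.
  apply: measurableT_comp => //; apply/measurable_EFinP.
  exact: (measurableT_comp measurable_corr_abs (measurable_pair2 t)).
rewrite -(fubini_tonelli (fun z : X * X => (a (z.1 + z.2)%R * a z.1)%:E))//; last first.
  by move=> z; rewrite lee_fin mulr_ge0.
rewrite (eq_integral (fun x => (a x)%:E * \int[mu]_y (a y)%:E)); last first.
  move=> x _; rewrite -[in RHS](ge0_integral_shift x (F := fun y => (a y)%:E))//; last first.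
    exact/measurable_EFinP.
  rewrite -ge0_integralZl; last 4 first.
  - exact: measurableT.
  - by apply/measurable_EFinP; exact: (measurableT_comp ma (measurable_shift x)).
  - by move=> t _; rewrite lee_fin.
  - by rewrite lee_fin.
  by apply: eq_integral => t _; rewrite -EFinM/= mulrC [(x + t)%R]addrC.
rewrite ge0_integralZr; last 4 first.
- exact: measurableT.
- exact/measurable_EFinP.
- by move=> x _; rewrite lee_fin.
- by apply: integral_ge0 => x _; rewrite lee_fin.
apply: lte_mul_pinfty => //; first by apply: integral_ge0 => x _; rewrite lee_fin.
by rewrite ge0_fin_numE// integral_ge0// => x _; rewrite lee_fin.
Qed.

End local_autocorrelation.

(** * Marginals of the Wigner distribution *)

Section marginal.
Context {R : realType} (d : nat).
Local Notation mu := (@lebesgue_rV R d).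
Local Notation X := ('rV[R]_d).
Local Open Scope ereal_scope.

Variable g : X * X -> R.
Hypothesis ig : (mu \x mu).-integrable setT (EFin \o g).
Hypothesis igx : forall t, mu.-integrable setT (fun x => (g (x, t))%:E).

Definition marginal (t : X) : R := (\int[mu]_x g (x, t))%R.

Lemma marginalE t : (marginal t)%:E = \int[mu]_x (g (x, t))%:E.
Proof. by rewrite /marginal /Rintegral fineK//; exact: integrable_fin_num (igx t). Qed.

Lemma integrable_marginal : mu.-integrable setT (EFin \o marginal).
Proof.
rewrite (_ : EFin \o marginal = fubini_G mu (EFin \o g)).
  have mg := measurable_int _ ig.
  apply/integrableP; split; first exact: (measurable_fubini_G ig).
  apply: le_lt_trans ((integrable21ltyP _ _ mg).1 ig).
  have mag : measurable_fun setT (abse \o (EFin \o g)) by exact: measurableT_comp.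
  apply: ge0_le_integral => //.
  - by apply: measurableT_comp => //; exact: (measurable_fubini_G ig).
  - exact: (measurable_fun_fubini_tonelli_G (abse \o (EFin \o g)) mag (fun=> abse_ge0 _)).
  by move=> t _; apply: le_abse_integral => //; exact: (measurable_int mu (igx t)).
by apply/funext => t; rewrite /= marginalE.
Qed.

End marginal.

Section fourier_transform_of_marginal.
Context {R : realType} (d : nat).
Local Notation mu := (@lebesgue_rV R d).
Local Notation X := ('rV[R]_d).
Local Open Scope ereal_scope.
Variables g h : X * X -> R.
Hypothesis ig : (mu \x mu).-integrable setT (EFin \o g).
Hypothesis ih : (mu \x mu).-integrable setT (EFin \o h).
Hypothesis igx : forall t, mu.-integrable setT (fun x => (g (x, t))%:E).
Hypothesis ihx : forall t, mu.-integrable setT (fun x => (h (x, t))%:E).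
Hypothesis igt : forall x, mu.-integrable setT (fun t => (g (x, t))%:E).
Hypothesis iht : forall x, mu.-integrable setT (fun t => (h (x, t))%:E).

Lemma refourier_marginal w : (refourier (marginal g) (marginal h) w)%:E =
  \int[mu]_x (refourier (fun t => g (x, t)) (fun t => h (x, t)) w)%:E.
Proof.
pose F (z : X * X) := (g z * cos (2 * pi * dotv z.2 w) + h z * sin (2 * pi * dotv z.2 w))%:E.
have mc : measurable_fun setT (fun z : X * X => cos (2 * pi * dotv z.2 w)).
  under eq_fun do rewrite dotvC.
  exact: (measurableT_comp (measurable_cos_dotv w) measurable_snd).
have ms : measurable_fun setT (fun z : X * X => sin (2 * pi * dotv z.2 w)).
  under eq_fun do rewrite dotvC.
  exact: (measurableT_comp (measurable_sin_dotv w) measurable_snd).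
have iF : (mu \x mu).-integrable setT F.
  rewrite (_ : F = (fun z => (g z * cos (2 * pi * dotv z.2 w))%:E +
      (h z * sin (2 * pi * dotv z.2 w))%:E)); last by apply/funext => z; rewrite -EFinD.
  apply: integrableD => //.
    apply: le_integrable ig => //.
      apply/measurable_EFinP; apply: measurable_funM => //.
      exact: integrable_measurable_fun ig.
    by move=> z _; rewrite lee_fin normrM ler_piMr// normr_cos_le1.
  apply: le_integrable ih => //.
    apply/measurable_EFinP; apply: measurable_funM => //.
    exact: integrable_measurable_fun ih.
  by move=> z _; rewrite lee_fin normrM ler_piMr// normr_sin_le1.
have iM := integrable_marginal ig igx; have iN := integrable_marginal ih ihx.
rewrite refourierE//.
transitivity (\int[mu]_t \int[mu]_x F (x, t)).
  apply: eq_integral => t _; rewrite /F.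
  pose c := cos (2 * pi * dotv t w); pose s := sin (2 * pi * dotv t w).
  have i1 : mu.-integrable setT (fun x => (g (x, t))%:E * c%:E) by exact: integrableZr.
  have i2 : mu.-integrable setT (fun x => (h (x, t))%:E * s%:E) by exact: integrableZr.
  transitivity (\int[mu]_x ((g (x, t))%:E * c%:E + (h (x, t))%:E * s%:E)).
    by rewrite integralD// !integralZr// -!marginalE// -!EFinM -EFinD.
  by apply: eq_integral => x _; rewrite -!EFinM -EFinD.
rewrite -(Fubini iF); apply: eq_integral => x _.
by rewrite (refourierE (igt x) (iht x)).
Qed.

End fourier_transform_of_marginal.

Section wigner_marginal.
Context {R : realType} (d : nat).
Local Notation mu := (@lebesgue_rV R d).
Local Notation X := ('rV[R]_d).
Local Open Scope ereal_scope.
Variable f : X -> R[i].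
Hypothesis mf : cmeasurable f.
Hypothesis f1 : \int[mu]_x (normc (f x))%:E < +oo.
Hypothesis f2 : \int[mu]_x (normc (f x) ^+ 2)%:E < +oo.

Definition energy : \bar R := \int[mu]_x (normc (f x) ^+ 2)%:E.

Let ma : measurable_fun setT (fun x => normc (f x)). Proof. exact: measurable_normc. Qed.
Let ma2 : measurable_fun setT (fun x => (normc (f x) ^+ 2)%:E).
Proof. by apply/measurable_EFinP; exact: measurable_funX. Qed.
Let a2_ge0 x : 0 <= (normc (f x) ^+ 2)%:E. Proof. by rewrite lee_fin sqr_ge0. Qed.

Let half_neq0 : (2^-1 != 0 :> R)%R. Proof. by rewrite invr_eq0. Qed.
Let Nhalf_neq0 : (- 2^-1 != 0 :> R)%R. Proof. by rewrite oppr_eq0. Qed.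

Lemma energy_ge0 : 0 <= energy. Proof. exact: integral_ge0. Qed.
Lemma energy_fin_num : energy \is a fin_num. Proof. by rewrite ge0_fin_numE// energy_ge0. Qed.

Lemma corr_abs_le x t : (corr_abs f x t)%:E <=
  (2^-1)%:E * ((normc (f (x + 2^-1 *: t)) ^+ 2)%:E + (normc (f (x - 2^-1 *: t)) ^+ 2)%:E).
Proof.
rewrite -EFinD -EFinM lee_fin /corr_abs.
move: (normc _) (normc _) => a b; have := sqr_ge0 (a - b); nra.
Qed.

Let mpt (v : X) : measurable_fun setT (fun x : X => (normc (f (x + v)%R) ^+ 2)%:E).
Proof. exact: (measurableT_comp ma2 (measurable_shift v)). Qed.

Let maff (c : R) (x : X) : measurable_fun setT (fun t : X => (normc (f (x + c *: t)%R) ^+ 2)%:E).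
Proof.
have := measurableT_comp ma2 (measurable_affine c x).
by apply: eq_measurable_fun => t _ /=; rewrite addrC.
Qed.

(** After [2 a b <= a^2 + b^2] ([corr_abs_le]), each half is the energy of a
    translate of [f]. *)
Lemma integral_corr_abs_snd_le t : \int[mu]_x (corr_abs f x t)%:E <= energy.
Proof.
have mN : measurable_fun setT (fun x : X => (normc (f (x - 2^-1 *: t)%R) ^+ 2)%:E) by exact: mpt.
apply: (@le_trans _ _ (\int[mu]_x ((2^-1)%:E *
    ((normc (f (x + 2^-1 *: t)%R) ^+ 2)%:E + (normc (f (x - 2^-1 *: t)%R) ^+ 2)%:E)))).
  apply: ge0_le_integral => //.
  - by move=> x _; rewrite lee_fin corr_abs_ge0.
  - apply/measurable_EFinP.
    exact: (measurableT_comp (measurable_corr_abs mf) (measurable_pair2 t)).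
  - by apply: measurable_funeM; exact: emeasurable_funD.
  by move=> x _; exact: corr_abs_le.
rewrite ge0_integralZl//; last 2 first.
- exact: emeasurable_funD.
- by move=> x _; rewrite adde_ge0.
rewrite ge0_integralD//.
rewrite (ge0_integral_shift (2^-1 *: t)%R ma2)//.
rewrite (ge0_integral_shift (- (2^-1 *: t))%R ma2)// -/energy.
have /fineK <- := energy_fin_num.
by rewrite -EFinD -EFinM lee_fin; lra.
Qed.

(** As for [integral_corr_abs_snd_le], with the Jacobian [2 ^+ d] of the substitution
    [t := 2 t]. *)
Lemma integral_corr_abs_fst_le x :
  \int[mu]_t (corr_abs f x t)%:E <= (2 ^+ d)%:E * energy.
Proof.
have mN : measurable_fun setT (fun t : X => (normc (f (x - 2^-1 *: t)%R) ^+ 2)%:E).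
  by under eq_fun do rewrite -scaleNr; exact: maff.
apply: (@le_trans _ _ (\int[mu]_t ((2^-1)%:E *
    ((normc (f (x + 2^-1 *: t)%R) ^+ 2)%:E + (normc (f (x - 2^-1 *: t)%R) ^+ 2)%:E)))).
  apply: ge0_le_integral => //.
  - by move=> t _; rewrite lee_fin corr_abs_ge0.
  - apply/measurable_EFinP.
    exact: (measurableT_comp (measurable_corr_abs mf) (measurable_pair1 x)).
  - by apply: measurable_funeM; exact: emeasurable_funD.
  by move=> t _; exact: corr_abs_le.
rewrite ge0_integralZl//; last 2 first.
- exact: emeasurable_funD.
- by move=> t _; rewrite adde_ge0.
have e1 : \int[mu]_t (normc (f (x + 2^-1 *: t)%R) ^+ 2)%:E = (2 ^+ d)%:E * energy.
  have := ge0_integral_affine x half_neq0 ma2 a2_ge0.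
  rewrite ger0_norm ?invr_ge0// exprVn invrK => <-.
  by apply: eq_integral => t _; rewrite addrC.
have e2 : \int[mu]_t (normc (f (x - 2^-1 *: t)%R) ^+ 2)%:E = (2 ^+ d)%:E * energy.
  have := ge0_integral_affine x Nhalf_neq0 ma2 a2_ge0.
  rewrite normrN ger0_norm ?invr_ge0// exprVn invrK => <-.
  by apply: eq_integral => t _; rewrite addrC scaleNr.
rewrite ge0_integralD// e1 e2.
have /fineK <- := energy_fin_num.
by rewrite -!EFinM lee_fin; lra.
Qed.

End wigner_marginal.

Section shift_distance.
Context {R : realType} (d : nat).
Local Notation mu := (@lebesgue_rV R d).
Local Notation X := ('rV[R]_d).
Local Open Scope ereal_scope.
Variable f : X -> R[i].
Hypothesis mf : cmeasurable f.
Hypothesis f2 : \int[mu]_x (normc (f x) ^+ 2)%:E < +oo.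

Definition shift_dist (s : X) : \bar R :=
  \int[mu]_x (normc (f (x + s)%R - f x)%R ^+ 2)%:E.

Lemma cmeasurable_shift (s : X) : cmeasurable (fun x : X => f (x + s)%R).
Proof.
by case: mf => m1 m2; split;
  [exact: (measurableT_comp m1 (measurable_shift s))|
   exact: (measurableT_comp m2 (measurable_shift s))].
Qed.

Lemma measurable_shift_dist (s s' : X) :
  measurable_fun setT (fun x : X => (normc (f (x + s)%R - f (x + s')%R)%R ^+ 2)%:E).
Proof.
apply/measurable_EFinP; apply: measurable_funX; apply: measurable_normc.
by apply: cmeasurableB; exact: cmeasurable_shift.
Qed.

Lemma shift_distE (s v : X) :
  \int[mu]_x (normc (f (x + (v + s))%R - f (x + v)%R)%R ^+ 2)%:E = shift_dist s.
Proof.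
rewrite /shift_dist -[RHS](ge0_integral_shift v
  (F := fun x => (normc (f (x + s)%R - f x)%R ^+ 2)%:E)).
- by apply: eq_integral => x _; rewrite addrA.
- have := measurable_shift_dist s 0%R.
  by apply: eq_measurable_fun => x _; rewrite addr0.
- by move=> x; rewrite lee_fin sqr_ge0.
Qed.

Lemma shift_dist_cvg0 (t : X) (e : R) : (0 < e)%R -> \forall n \near \oo,
  shift_dist (n.+1%:R^-1 *: t) <= e%:E.
Proof.
move=> e0; have e20 : (0 < e / 2)%R by rewrite divr_gt0.
have [mu_ mv] := mf.
have u2 : \int[mu]_x (complex.Re (f x) ^+ 2)%:E < +oo.
  apply: le_lt_trans f2; apply: ge0_le_integral => //.
  - by move=> x _; rewrite lee_fin sqr_ge0.
  - by apply/measurable_EFinP; exact: measurable_funX.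
  - by apply/measurable_EFinP; apply: measurable_funX; exact: measurable_normc.
  by move=> x _; rewrite lee_fin sqr_normc lerDl sqr_ge0.
have v2 : \int[mu]_x (complex.Im (f x) ^+ 2)%:E < +oo.
  apply: le_lt_trans f2; apply: ge0_le_integral => //.
  - by move=> x _; rewrite lee_fin sqr_ge0.
  - by apply/measurable_EFinP; exact: measurable_funX.
  - by apply/measurable_EFinP; apply: measurable_funX; exact: measurable_normc.
  by move=> x _; rewrite lee_fin sqr_normc lerDr sqr_ge0.
have := shift_cont_L2 t mu_ u2 e20; have := shift_cont_L2 t mv v2 e20.
apply: filterS2 => n vn un.
have [mus mvs] := cmeasurable_shift (n.+1%:R^-1 *: t).
have -> : e%:E = (e / 2)%:E + (e / 2)%:E by rewrite -EFinD; congr EFin; field.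
apply: le_trans (leeD un vn); rewrite -ge0_integralD//.
- apply: ge0_le_integral => //.
  + by move=> x _; rewrite lee_fin sqr_ge0.
  + have := measurable_shift_dist (n.+1%:R^-1 *: t) 0%R.
    by apply: eq_measurable_fun => x _; rewrite addr0.
  + by apply: emeasurable_funD; apply/measurable_EFinP; apply: measurable_funX;
      exact: measurable_funB.
  by move=> x _; rewrite -EFinD lee_fin sqr_normc /sqn !raddfB.
- by move=> x _; rewrite lee_fin sqr_ge0.
- by apply/measurable_EFinP; apply: measurable_funX; exact: measurable_funB.
- by move=> x _; rewrite lee_fin sqr_ge0.
- by apply/measurable_EFinP; apply: measurable_funX; exact: measurable_funB.
Qed.

End shift_distance.

Section weighted_correlation.
Context {R : realType} (d : nat).
Local Notation mu := (@lebesgue_rV R d).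
Local Notation X := ('rV[R]_d).
Local Open Scope ereal_scope.
Variable f : X -> R[i].
Hypothesis mf : cmeasurable f.
Hypothesis f1 : \int[mu]_x (normc (f x))%:E < +oo.
Hypothesis f2 : \int[mu]_x (normc (f x) ^+ 2)%:E < +oo.
Variable b : X -> R.
Hypothesis mb : measurable_fun setT b.
Hypothesis b1 : forall x, (`|b x| <= 1)%R.

(** The weight [b] selects where [x] is integrated: an indicator for the tails of
    [f], the constant 1 for its translates. *)
Definition wcorr_re (z : X * X) : R := (b z.1 * corr_re f z.1 z.2)%R.
Definition wcorr_im (z : X * X) : R := (b z.1 * corr_im f z.1 z.2)%R.

Let E : R := fine (energy f).
Let energyE : energy f = E%:E.
Proof. by rewrite fineK// energy_fin_num. Qed.

Let mb2 : measurable_fun setT (fun z : X * X => b z.1).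
Proof. exact: (measurableT_comp mb measurable_fst). Qed.

Lemma measurable_wcorr_re : measurable_fun setT wcorr_re.
Proof. by apply: measurable_funM => //; exact: measurable_corr_re. Qed.

Lemma measurable_wcorr_im : measurable_fun setT wcorr_im.
Proof. by apply: measurable_funM => //; exact: measurable_corr_im. Qed.

Lemma normr_wcorr_re z : (`|wcorr_re z| <= corr_abs f z.1 z.2)%R.
Proof.
rewrite normrM; apply: le_trans (normr_corr_re _ _ _).
by rewrite ler_piMl.
Qed.

Lemma normr_wcorr_im z : (`|wcorr_im z| <= corr_abs f z.1 z.2)%R.
Proof.
rewrite normrM; apply: le_trans (normr_corr_im _ _ _).
by rewrite ler_piMl.
Qed.

Let integrable_abs2 t : mu.-integrable setT (fun x => (corr_abs f x t)%:E).
Proof.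
apply/integrableP; split.
  apply/measurable_EFinP.
  exact: (measurableT_comp (measurable_corr_abs mf) (measurable_pair2 t)).
under eq_integral do rewrite abse_EFin ger0_norm ?corr_abs_ge0//.
by rewrite (le_lt_trans (integral_corr_abs_snd_le mf f2 t))// energyE ltry.
Qed.

Let integrable_abs1 x : mu.-integrable setT (fun t => (corr_abs f x t)%:E).
Proof.
apply/integrableP; split.
  apply/measurable_EFinP.
  exact: (measurableT_comp (measurable_corr_abs mf) (measurable_pair1 x)).
under eq_integral do rewrite abse_EFin ger0_norm ?corr_abs_ge0//.
by rewrite (le_lt_trans (integral_corr_abs_fst_le mf f2 x))// energyE -EFinM ltry.
Qed.

Section dominated.
Variable g : X * X -> R.
Hypothesis mg : measurable_fun setT g.
Hypothesis g_le : forall z, (`|g z| <= corr_abs f z.1 z.2)%R.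

Lemma integrable_dominated : (mu \x mu).-integrable setT (EFin \o g).
Proof.
apply: le_integrable (integrable_corr_abs mf f1) => //; first exact/measurable_EFinP.
by move=> z _; rewrite lee_fin [leRHS]ger0_norm ?corr_abs_ge0.
Qed.

Lemma integrable_dominated1 x : mu.-integrable setT (fun t => (g (x, t))%:E).
Proof.
apply: le_integrable (integrable_abs1 x) => //.
  by apply/measurable_EFinP; exact: (measurableT_comp mg (measurable_pair1 x)).
by move=> t _; rewrite lee_fin [leRHS]ger0_norm ?corr_abs_ge0//; exact: (g_le (x, t)).
Qed.

Lemma integrable_dominated2 t : mu.-integrable setT (fun x => (g (x, t))%:E).
Proof.
apply: le_integrable (integrable_abs2 t) => //.
  by apply/measurable_EFinP; exact: (measurableT_comp mg (measurable_pair2 t)).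
by move=> x _; rewrite lee_fin [leRHS]ger0_norm ?corr_abs_ge0//; exact: (g_le (x, t)).
Qed.

Lemma normr_marginal_le t : (`|marginal g t| <= E)%R.
Proof.
rewrite -lee_fin -energyE -abse_EFin marginalE; last exact: integrable_dominated2.
apply: le_trans (integral_corr_abs_snd_le mf f2 t).
have mgt : measurable_fun setT (fun x => (g (x, t))%:E).
  by apply/measurable_EFinP; exact: (measurableT_comp mg (measurable_pair2 t)).
apply: le_trans (le_abse_integral _ _ mgt) _ => //.
apply: ge0_le_integral => //.
- exact: measurableT_comp.
- exact: (measurable_int mu (integrable_abs2 t)).
by move=> x _; rewrite lee_fin; exact: (g_le (x, t)).
Qed.

End dominated.

Definition autocorr_re := marginal wcorr_re.
Definition autocorr_im := marginal wcorr_im.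

Lemma integrable_autocorr_re : mu.-integrable setT (EFin \o autocorr_re).
Proof.
apply: integrable_marginal.
- exact: (integrable_dominated measurable_wcorr_re normr_wcorr_re).
- exact: (integrable_dominated2 measurable_wcorr_re normr_wcorr_re).
Qed.

Lemma integrable_autocorr_im : mu.-integrable setT (EFin \o autocorr_im).
Proof.
apply: integrable_marginal.
- exact: (integrable_dominated measurable_wcorr_im normr_wcorr_im).
- exact: (integrable_dominated2 measurable_wcorr_im normr_wcorr_im).
Qed.

Lemma normr_autocorr_re_le t : (`|autocorr_re t| <= fine (energy f))%R.
Proof. exact: (normr_marginal_le measurable_wcorr_re normr_wcorr_re). Qed.

(** Fubini: the Fourier transform in [t] of the integral over [x] is the integral over
    [x] of the Fourier transforms in [t], which are Wigner distributions. *)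
Lemma refourier_autocorr_re w : (refourier autocorr_re autocorr_im w)%:E =
  \int[mu]_x (b x * complex.Re (wigner f x w))%:E.
Proof.
rewrite refourier_marginal.
- apply: eq_integral => x _; congr EFin; rewrite Re_wignerE.
  rewrite /refourier -RintegralZl//.
    by apply: eq_Rintegral => t _; rewrite /wcorr_re/wcorr_im/=; ring.
  rewrite [X in _.-integrable _ X](_ : _ = (fun t => (corr_re f x t * cos (2 * pi * dotv t w))%:E +
     (corr_im f x t * sin (2 * pi * dotv t w))%:E)); last by apply/funext => t; rewrite -EFinD.
  apply: integrableD => //.
    apply: integrable_cosM; apply: (@integrable_dominated1 (fun z => corr_re f z.1 z.2)) => //.
      exact: measurable_corr_re.
    by move=> z; exact: normr_corr_re.
  apply: integrable_sinM; apply: (@integrable_dominated1 (fun z => corr_im f z.1 z.2)) => //.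
    exact: measurable_corr_im.
  by move=> z; exact: normr_corr_im.
- exact: (integrable_dominated measurable_wcorr_re normr_wcorr_re).
- exact: (integrable_dominated measurable_wcorr_im normr_wcorr_im).
- exact: (integrable_dominated2 measurable_wcorr_re normr_wcorr_re).
- exact: (integrable_dominated2 measurable_wcorr_im normr_wcorr_im).
- exact: (integrable_dominated1 measurable_wcorr_re normr_wcorr_re).
- exact: (integrable_dominated1 measurable_wcorr_im normr_wcorr_im).
Qed.

Lemma refourier_autocorr_im w : (refourier autocorr_im (fun t => - autocorr_re t)%R w)%:E =
  \int[mu]_x (b x * complex.Im (wigner f x w))%:E.
Proof.
have i2 t : mu.-integrable setT (fun x => (wcorr_re (x, t))%:E).
  exact: (integrable_dominated2 measurable_wcorr_re normr_wcorr_re t).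
have iN2 t : mu.-integrable setT (fun x => (- wcorr_re (x, t))%:E).
  by under eq_fun do rewrite EFinN; exact: integrableN.
have PN : (fun t => - autocorr_re t)%R = marginal (fun z => - wcorr_re z)%R.
  apply/funext => t; apply: EFin_inj; rewrite EFinN !marginalE// -integralN//.
  exact: integrable_add_def.
have mN : measurable_fun setT (fun z => - wcorr_re z)%R.
  by apply: measurable_funN; exact: measurable_wcorr_re.
have le_N z : (`|- wcorr_re z| <= corr_abs f z.1 z.2)%R by rewrite normrN normr_wcorr_re.
rewrite PN refourier_marginal.
- apply: eq_integral => x _; congr EFin; rewrite Im_wignerE.
  rewrite /refourier -RintegralZl//.
    by apply: eq_Rintegral => t _; rewrite /wcorr_re/wcorr_im/=; ring.
  rewrite [X in _.-integrable _ X](_ : _ = (fun t => (corr_im f x t * cos (2 * pi * dotv t w))%:E +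
     (- corr_re f x t * sin (2 * pi * dotv t w))%:E)); last by apply/funext => t; rewrite -EFinD.
  apply: integrableD => //.
    apply: integrable_cosM; apply: (@integrable_dominated1 (fun z => corr_im f z.1 z.2)) => //.
      exact: measurable_corr_im.
    by move=> z; exact: normr_corr_im.
  apply: integrable_sinM; apply: (@integrable_dominated1 (fun z => - corr_re f z.1 z.2)%R) => //.
    by apply: measurable_funN; exact: measurable_corr_re.
  by move=> z; rewrite normrN; exact: normr_corr_re.
- exact: (integrable_dominated measurable_wcorr_im normr_wcorr_im).
- exact: (integrable_dominated mN le_N).
- exact: (integrable_dominated2 measurable_wcorr_im normr_wcorr_im).
- exact: (integrable_dominated2 mN le_N).
- exact: (integrable_dominated1 measurable_wcorr_im normr_wcorr_im).
- exact: (integrable_dominated1 mN le_N).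
Qed.

End weighted_correlation.

Section refourier_algebra.
Context {R : realType} (d : nat).
Local Notation mu := (@lebesgue_rV R d).
Local Notation X := ('rV[R]_d).
Local Open Scope ereal_scope.

Lemma integrable_oppR (P : X -> R) :
  mu.-integrable setT (EFin \o P) -> mu.-integrable setT (EFin \o (fun t => - P t)%R).
Proof. by move=> iP; rewrite (_ : EFin \o _ = \- (EFin \o P)) //; exact: integrableN. Qed.

Lemma refourierB (P Q P' Q' : X -> R) w :
  mu.-integrable setT (EFin \o P) -> mu.-integrable setT (EFin \o Q) ->
  mu.-integrable setT (EFin \o P') -> mu.-integrable setT (EFin \o Q') ->
  (refourier (fun t => P t - P' t) (fun t => Q t - Q' t) w =
   refourier P Q w - refourier P' Q' w)%R.
Proof.
move=> iP iQ iP' iQ'; rewrite /refourier -RintegralB//; last 2 first.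
- exact: integrable_refourier.
- exact: integrable_refourier.
by apply: eq_Rintegral => t _; ring.
Qed.

Lemma integrable_shiftR (P : X -> R) (h : X) : mu.-integrable setT (EFin \o P) ->
  mu.-integrable setT (EFin \o (fun t => P (t + h)%R)).
Proof.
move=> iP; have := integrable_affine h (oner_neq0 R) iP.
by apply: eq_integrable => // t _; rewrite scale1r.
Qed.

Lemma dotvBl (t h w : X) : dotv (t - h) w = (dotv t w - dotv h w)%R.
Proof.
by rewrite /dotv -sumrB; apply: eq_bigr => i _; rewrite !mxE mulrBl.
Qed.

(** Translating a function multiplies its Fourier transform by a phase. *)
Lemma refourier_shift (P Q : X -> R) (h w : X) :
  mu.-integrable setT (EFin \o P) -> mu.-integrable setT (EFin \o Q) ->
  (refourier (fun t => P (t + h)) (fun t => Q (t + h)) w =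
   cos (2 * pi * dotv h w) * refourier P Q w -
   sin (2 * pi * dotv h w) * refourier Q (fun t => - P t) w)%R.
Proof.
move=> iP iQ; have iN := integrable_oppR iP.
set c := cos (2 * pi * dotv h w); set s := sin (2 * pi * dotv h w).
pose F t := (c * (P t * cos (2 * pi * dotv t w) + Q t * sin (2 * pi * dotv t w)) -
   s * (Q t * cos (2 * pi * dotv t w) + - P t * sin (2 * pi * dotv t w)))%R.
have i1 := integrable_refourier w iP iQ; have i2 := integrable_refourier w iQ iN.
have iZ (a : R) (g : X -> R) : mu.-integrable setT (EFin \o g) ->
    mu.-integrable setT (EFin \o (fun t => a * g t)%R).
  move=> ig; rewrite (_ : EFin \o _ = (fun t => a%:E * (EFin \o g) t))//.
  exact: integrableZl.
have iF : mu.-integrable setT (EFin \o F).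
  rewrite (_ : EFin \o F = (fun t =>
      (c * (P t * cos (2 * pi * dotv t w) + Q t * sin (2 * pi * dotv t w)))%:E -
      (s * (Q t * cos (2 * pi * dotv t w) + - P t * sin (2 * pi * dotv t w)))%:E)).
    by apply: integrableB => //; exact: iZ.
  by apply/funext => t; rewrite /= EFinB.
transitivity (\int[mu]_t F t)%R; last first.
  by rewrite RintegralB//; [rewrite !RintegralZl|exact: iZ|exact: iZ].
rewrite /refourier /Rintegral; congr fine.
have := integral_affine h (oner_neq0 R) iF.
rewrite normr1 expr1n invr1 mul1e => <-.
apply: eq_integral => t _; rewrite /F /= !scale1r; congr EFin.
have -> : dotv t w = (dotv (t + h)%R w - dotv h w)%R by rewrite -dotvBl addrK.
rewrite mulrBr cosB sinB -/c -/s; ring.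
Qed.

End refourier_algebra.

Section wigner_bounds.
Context {R : realType} (d : nat).
Local Notation mu := (@lebesgue_rV R d).
Local Notation X := ('rV[R]_d).
Local Open Scope ereal_scope.
Variable f : X -> R[i].
Hypothesis mf : cmeasurable f.
Hypothesis f1 : \int[mu]_x (normc (f x))%:E < +oo.
Hypothesis f2 : \int[mu]_x (normc (f x) ^+ 2)%:E < +oo.

Let E : R := fine (energy f).
Let energyE : energy f = E%:E. Proof. by rewrite fineK// energy_fin_num. Qed.
Let E_ge0 : (0 <= E)%R. Proof. by rewrite -lee_fin -energyE energy_ge0. Qed.

Let mfs2 (s : X) : measurable_fun setT (fun x : X => (normc (f (x + s)%R) ^+ 2)%:E).
Proof.
apply/measurable_EFinP; apply: measurable_funX; apply: measurable_normc.
exact: cmeasurable_shift.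
Qed.

Let energy_shift (s : X) : \int[mu]_x (normc (f (x + s)%R) ^+ 2)%:E = E%:E.
Proof.
rewrite (ge0_integral_shift s (F := fun x => (normc (f x) ^+ 2)%:E))//.
  by have := mfs2 0%R; under eq_fun do rewrite addr0.
by move=> x; rewrite lee_fin sqr_ge0.
Qed.

Section weight.
Variable b : X -> R.
Hypothesis mb : measurable_fun setT b.
Hypothesis b1 : forall x, (`|b x| <= 1)%R.

Let i2 t : mu.-integrable setT (fun x => (wcorr_re f b (x, t))%:E).
Proof.
exact: (integrable_dominated2 mf f2 (measurable_wcorr_re mf mb) (normr_wcorr_re f b1)).
Qed.

(** By [redotB] the increment of the correlation is a sum of two products, each with a
    factor [f] and a factor that is an increment of [f]; the factors are separated by
    [2 x y <= x^2 / eta + eta y^2]. *)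
Lemma autocorr_diff_le (h s : X) (eta : R) : (0 < eta)%R ->
  `|autocorr_re f b (h + s)%R - autocorr_re f b h|%:E <=
  (eta * E)%:E + (2^-1 / eta)%:E *
    (shift_dist f (2^-1 *: s) + shift_dist f (- (2^-1 *: s))%R).
Proof.
move=> eta0.
have eta'0 : (0 < 2^-1 / eta)%R by rewrite divr_gt0// invr_gt0.
pose A x := (normc (f (x + (2^-1 *: h + 2^-1 *: s))%R - f (x + 2^-1 *: h)%R)%R ^+ 2)%:E.
pose A' x := (normc (f (x + (- (2^-1 *: h) + - (2^-1 *: s)))%R - f (x + - (2^-1 *: h))%R)%R ^+ 2)%:E.
pose B x := (normc (f (x + - (2^-1 *: (h + s)))%R) ^+ 2)%:E.
pose B' x := (normc (f (x + 2^-1 *: h)%R) ^+ 2)%:E.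
have mA : measurable_fun setT A by exact: measurable_shift_dist.
have mA' : measurable_fun setT A' by exact: measurable_shift_dist.
have mB : measurable_fun setT B by exact: mfs2.
have mB' : measurable_fun setT B' by exact: mfs2.
have A0 x : 0 <= A x by rewrite lee_fin sqr_ge0.
have A'0 x : 0 <= A' x by rewrite lee_fin sqr_ge0.
have B0 x : 0 <= B x by rewrite lee_fin sqr_ge0.
have B'0 x : 0 <= B' x by rewrite lee_fin sqr_ge0.
have e20 : 0 <= (eta / 2)%:E by rewrite lee_fin divr_ge0// ltW.
have e'0 : 0 <= (2^-1 / eta)%:E by rewrite lee_fin ltW.
have AA'0 x : 0 <= A x + A' x by exact: adde_ge0.
have BB'0 x : 0 <= B x + B' x by exact: adde_ge0.
have mAA' : measurable_fun setT (fun x => A x + A' x) by exact: emeasurable_funD.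
have mBB' : measurable_fun setT (fun x => B x + B' x) by exact: emeasurable_funD.
pose G x := (eta / 2)%:E * (B x + B' x) + (2^-1 / eta)%:E * (A x + A' x).
have -> : `|autocorr_re f b (h + s)%R - autocorr_re f b h|%:E =
    `|\int[mu]_x (wcorr_re f b (x, (h + s)%R) - wcorr_re f b (x, h))%:E|.
  rewrite /autocorr_re /marginal -RintegralB//; last 2 first.
  - exact: (i2 (h + s)%R).
  - exact: (i2 h).
  rewrite /Rintegral -abse_EFin fineK// integrable_fin_num//.
  by under eq_fun do rewrite EFinB; apply: integrableB.
have mW : measurable_fun setT (fun x => (wcorr_re f b (x, (h + s)%R) - wcorr_re f b (x, h))%:E).
  under eq_fun do rewrite EFinB.
  by apply: emeasurable_funB; [exact: (measurable_int mu (i2 _))|exact: (measurable_int mu (i2 _))].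
apply: le_trans (le_abse_integral _ _ mW) _ => //.
apply: (@le_trans _ _ (\int[mu]_x G x)).
  apply: ge0_le_integral => //.
  - exact: measurableT_comp.
  - by apply: emeasurable_funD; apply: measurable_funeM; exact: emeasurable_funD.
  move=> x _; rewrite abse_EFin /G /A /A' /B /B' -!EFinD lee_fin.
  rewrite /wcorr_re/= -mulrBr normrM.
  apply: (@le_trans _ _ `|corr_re f x (h + s) - corr_re f x h|%R).
    by rewrite ler_piMl.
  rewrite /corr_re redotB; apply: le_trans (ler_normD _ _) _.
  apply: le_trans (lerD (normr_redot_le _ _) (normr_redot_le _ _)) _.
  rewrite -!scalerDr -opprD -scalerDr.
  have young (x1 y1 : R) : (x1 * y1 <= eta / 2 * y1 ^+ 2 + 2^-1 / eta * x1 ^+ 2)%R.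
    have : (0 <= 2^-1 / eta * (x1 - eta * y1) ^+ 2)%R.
      by rewrite mulr_ge0 ?sqr_ge0// ltW.
    rewrite (_ : 2^-1 / eta * (x1 - eta * y1) ^+ 2 =
      eta / 2 * y1 ^+ 2 + 2^-1 / eta * x1 ^+ 2 - x1 * y1)%R; first by rewrite subr_ge0.
    by field; rewrite gt_eqF.
  have y1 := young (normc (f (x + 2^-1 *: (h + s)) - f (x + 2^-1 *: h))%R)
     (normc (f (x - 2^-1 *: (h + s))%R)).
  have y2 := young (normc (f (x - 2^-1 *: (h + s)) - f (x - 2^-1 *: h))%R)
     (normc (f (x + 2^-1 *: h)%R)).
  rewrite [X in (_ + X <= _)%R]mulrC !mulrDr addrACA; exact: lerD.
rewrite ge0_integralD//; last 4 first.
- by move=> x _; exact: mule_ge0.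
- exact: measurable_funeM.
- by move=> x _; exact: mule_ge0.
- exact: measurable_funeM.
rewrite !ge0_integralZl//.
rewrite !ge0_integralD// !energy_shift !shift_distE// -EFinD -EFinM.
by rewrite (_ : eta / 2 * (E + E) = eta * E)%R//; field.
Qed.

Lemma autocorr_cvg (h t : X) : autocorr_re f b (h + n.+1%:R^-1 *: t)%R @[n --> \oo] --> autocorr_re f b h.
Proof.
apply/cvgrPdist_le => e e0.
pose eta := (e / (2 * (E + 1)))%R.
have E1 : (0 < E + 1)%R by rewrite ltr_wpDl.
have eta0 : (0 < eta)%R by rewrite divr_gt0// mulr_gt0.
have ee : (0 < eta * e / 2)%R by rewrite divr_gt0// mulr_gt0.
have D1 := shift_dist_cvg0 mf f2 (2^-1 *: t) ee.
have D2 := shift_dist_cvg0 mf f2 (- (2^-1 *: t))%R ee.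
move: D1 D2; apply: filterS2 => n.
rewrite scalerN !scalerA [(_ * 2^-1)%R]mulrC -scalerA => D1 D2.
rewrite distrC -lee_fin; apply: le_trans (autocorr_diff_le h _ eta0) _.
apply: (@le_trans _ _ ((eta * E)%:E + (2^-1 / eta)%:E * ((eta * e / 2)%:E + (eta * e / 2)%:E))).
  by apply: leeD => //; apply: lee_wpmul2l; [rewrite lee_fin divr_ge0// ltW|exact: leeD].
rewrite -EFinD lee_fin.
rewrite (_ : 2^-1 / eta * (eta * e / 2 + eta * e / 2) = e / 2)%R; last by field; rewrite gt_eqF.
have : (eta * E <= e / 2)%R.
  rewrite /eta (_ : e / (2 * (E + 1)) * E = e / 2 * (E / (E + 1)))%R; last by field; rewrite gt_eqF.
  by rewrite ler_piMr ?divr_ge0 ?(ltW e0)// ler_pdivrMr// mul1r lerDl.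
lra.
Qed.

Lemma autocorr_cvg0 (t : X) :
  autocorr_re f b (n.+1%:R^-1 *: t)%R @[n --> \oo] --> autocorr_re f b 0%R.
Proof.
apply: cvg_trans (@autocorr_cvg 0%R t).
by apply: near_eq_cvg; apply: nearW => n; rewrite add0r.
Qed.

End weight.

Lemma measurable_normc_wigner :
  measurable_fun setT (fun z : X * X => normc (wigner f z.1 z.2)).
Proof. exact: (measurable_normc (measurable_wigner mf)). Qed.

Let mW1 w : measurable_fun setT (fun x => normc (wigner f x w)).
Proof. exact: (measurableT_comp measurable_normc_wigner (measurable_pair2 w)). Qed.

Let mRe w : measurable_fun setT (fun x => complex.Re (wigner f x w)).
Proof. exact: (measurableT_comp (measurable_wigner mf).1 (measurable_pair2 w)). Qed.

Let mIm w : measurable_fun setT (fun x => complex.Im (wigner f x w)).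
Proof. exact: (measurableT_comp (measurable_wigner mf).2 (measurable_pair2 w)). Qed.

Section weight_wigner.
Variable b : X -> R.
Hypothesis mb : measurable_fun setT b.
Hypothesis b1 : forall x, (`|b x| <= 1)%R.

Lemma normr_refourier_autocorr_re w :
  `|refourier (autocorr_re f b) (autocorr_im f b) w|%:E <=
  \int[mu]_x (`|b x| * normc (wigner f x w))%:E.
Proof.
rewrite -abse_EFin refourier_autocorr_re//.
have mbW : measurable_fun setT (fun x => (b x * complex.Re (wigner f x w))%:E).
  by apply/measurable_EFinP; exact: measurable_funM.
apply: le_trans (le_abse_integral _ _ mbW) _ => //; apply: ge0_le_integral => //.
- exact: measurableT_comp.
- by apply/measurable_EFinP; apply: measurable_funM => //; exact: measurableT_comp.
by move=> x _; rewrite lee_fin normrM ler_wpM2l// normr_Re_le.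
Qed.

Lemma normr_refourier_autocorr_im w :
  `|refourier (autocorr_im f b) (fun t => - autocorr_re f b t)%R w|%:E <=
  \int[mu]_x (`|b x| * normc (wigner f x w))%:E.
Proof.
rewrite -abse_EFin refourier_autocorr_im//.
have mbW : measurable_fun setT (fun x => (b x * complex.Im (wigner f x w))%:E).
  by apply/measurable_EFinP; exact: measurable_funM.
apply: le_trans (le_abse_integral _ _ mbW) _ => //; apply: ge0_le_integral => //.
- exact: measurableT_comp.
- by apply/measurable_EFinP; apply: measurable_funM => //; exact: measurableT_comp.
by move=> x _; rewrite lee_fin normrM ler_wpM2l// normr_Im_le.
Qed.

End weight_wigner.

(** The autocorrelation weighted by the indicator of [B] takes at the origin the energy
    of [f] over [B] as its value; its Fourier transform is the part of the frequency
    marginal of the Wigner distribution that comes from [B]. *)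
Lemma energy_le_wigner (B : set X) : measurable B ->
  \int[mu]_(x in B) (normc (f x) ^+ 2)%:E <=
  \int[mu]_w \int[mu]_x (\1_B x * normc (wigner f x w))%:E.
Proof.
move=> mB; pose b : X -> R := \1_B.
have mb : measurable_fun setT b by exact: measurable_indic.
have b0 x : (0 <= b x)%R by rewrite /b indicE.
have b1 x : (`|b x| <= 1)%R by rewrite ger0_norm// /b indicE; case: (_ \in _).
have iP := integrable_autocorr_re mf f1 f2 mb b1.
have iQ := integrable_autocorr_im mf f1 f2 mb b1.
have cP t : autocorr_re f b (n.+1%:R^-1 *: t)%R @[n --> \oo] --> autocorr_re f b 0%R.
  exact: (@autocorr_cvg0 b mb b1 t).
have key := inversion_inequality iP iQ (normr_autocorr_re_le mf f2 mb b1) cP.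
have P0 : \int[mu]_(x in B) (normc (f x) ^+ 2)%:E = (autocorr_re f b 0%R)%:E.
  rewrite marginalE; last exact: (integrable_dominated2 mf f2
    (measurable_wcorr_re mf mb) (normr_wcorr_re f b1)).
  rewrite [LHS]integral_mkcond; apply: eq_integral => x _.
  rewrite /wcorr_re /corr_re/= scaler0 subr0 addr0 patchE /b indicE sqr_normc.
  by case: (x \in B); rewrite ?mul0r// mul1r /redot /sqn !expr2.
apply: (@le_trans _ _ `|autocorr_re f b 0%R|%:E).
  by rewrite P0 lee_fin ler_norm.
apply: le_trans key _.
have mbW : measurable_fun setT (fun z : X * X => (b z.1 * normc (wigner f z.1 z.2))%:E).
  apply/measurable_EFinP; apply: measurable_funM; last exact: measurable_normc_wigner.
  exact: (measurableT_comp mb measurable_fst).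
have bW0 z : 0 <= (b z.1 * normc (wigner f z.1 z.2))%:E.
  by rewrite lee_fin mulr_ge0// Defs.normc_ge0.
apply: ge0_le_integral => //.
- by apply/measurable_EFinP; apply: measurableT_comp => //; exact: measurable_refourier.
- exact: (measurable_fun_fubini_tonelli_G
    (fun z : X * X => (b z.1 * normc (wigner f z.1 z.2))%:E) mbW bW0).
move=> w _; apply: le_trans (normr_refourier_autocorr_re mb b1 w) _.
by under eq_integral do rewrite ger0_norm//.
Qed.

(** Polarisation: [|f (x + h) - f x|^2] integrates to twice the increment of the
    autocorrelation between [0] and [h], whose Fourier transform is the frequency
    marginal of the Wigner distribution times [1 - exp (2 i pi h.w)]. *)
Lemma shift_dist_le_wigner (h : X) :
  shift_dist f h <= 2%:E * \int[mu]_w \int[mu]_x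
    ((`|1 - cos (2 * pi * dotv h w)| + `|sin (2 * pi * dotv h w)|) *
     normc (wigner f x w))%:E.
Proof.
pose b : X -> R := cst 1%R.
have mb : measurable_fun setT b by exact: measurable_cst.
have b1 x : (`|b x| <= 1)%R by rewrite normr1.
have iP := integrable_autocorr_re mf f1 f2 mb b1.
have iQ := integrable_autocorr_im mf f1 f2 mb b1.
have iN := integrable_oppR iP.
have iPs := integrable_shiftR h iP; have iQs := integrable_shiftR h iQ.
pose P := autocorr_re f b; pose Q := autocorr_im f b.
have iD (g g' : X -> R) : mu.-integrable setT (EFin \o g) ->
    mu.-integrable setT (EFin \o g') -> mu.-integrable setT (EFin \o (fun t => g t - g' t)%R).
  move=> ig ig'; rewrite (_ : EFin \o _ = (EFin \o g) \- (EFin \o g'))//.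
  exact: integrableB.
have iP' := iD _ _ iP iPs; have iQ' := iD _ _ iQ iQs.
have PM t := normr_autocorr_re_le mf f2 mb b1 t.
have P'M t : (`|P t - P (t + h)| <= E + E)%R.
  by apply: le_trans (ler_normB _ _) _; exact: lerD.
have cP' t : (P (n.+1%:R^-1 *: t) - P (n.+1%:R^-1 *: t + h))%R @[n --> \oo] -->
    (P 0 - P (0 + h))%R.
  apply: cvgB.
    exact: (@autocorr_cvg0 b mb b1 t).
  rewrite add0r; apply: cvg_trans (@autocorr_cvg b mb b1 h t).
  by apply: near_eq_cvg; apply: nearW => n; rewrite addrC.
have key := inversion_inequality iP' iQ' P'M cP'.
pose be (w : X) : R := (`|1 - cos (2 * pi * dotv h w)| + `|sin (2 * pi * dotv h w)|)%R.
have be0 w : (0 <= be w)%R by rewrite addr_ge0.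
have mbe : measurable_fun setT be.
  apply: measurable_funD; apply: measurableT_comp => //.
    by apply: measurable_funB => //; exact: measurable_cos_dotv.
  exact: measurable_sin_dotv.
have i2 t := integrable_dominated2 mf f2 (measurable_wcorr_re mf mb) (normr_wcorr_re f b1) t.
have PE t : (P t)%:E = \int[mu]_x (corr_re f x t)%:E.
  by rewrite marginalE//; apply: eq_integral => x _; rewrite /wcorr_re/= mul1r.
have ic t : mu.-integrable setT (EFin \o (fun x => corr_re f x t)).
  apply: eq_integrable (i2 t) => // x _; by rewrite /wcorr_re/= mul1r.
have P0 : P 0%R = E.
  apply: EFin_inj; rewrite PE -energyE; apply: eq_integral => x _.
  by rewrite /corr_re scaler0 subr0 addr0 sqr_normc /redot /sqn !expr2.
have shiftE : shift_dist f h = (2 * (E - P h))%:E.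
  rewrite -(shift_distE mf h (- (2^-1 *: h))%R).
  have hh : (- (2^-1 *: h) + h = 2^-1 *: h)%R.
    by rewrite -[X in (_ + X)%R]scale1r -scaleNr -scalerDl; congr (_ *: _)%R; field.
  rewrite hh.
  have i1 (s : X) : mu.-integrable setT (EFin \o (fun x => normc (f (x + s)) ^+ 2)%R).
    apply/integrableP; split; first exact: mfs2.
    by under eq_integral do rewrite /= ger0_norm ?sqr_ge0//; rewrite energy_shift ltry.
  have RE (s : X) : (\int[mu]_x (normc (f (x + s)%R) ^+ 2))%R = E.
    by rewrite /Rintegral energy_shift.
  transitivity (\int[mu]_x (normc (f (x + 2^-1 *: h)) ^+ 2 + normc (f (x + - (2^-1 *: h))) ^+ 2 -
      2 * corr_re f x h)%R%:E).
    by apply: eq_integral => x _; rewrite !sqr_normc sqnB.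
  rewrite -[LHS]fineK; last first.
    apply: integrable_fin_num => //; apply: iD; last first.
      rewrite (_ : EFin \o _ = (fun x => 2%:E * (EFin \o (fun x => corr_re f x h)) x))//.
      exact: integrableZl.
    rewrite (_ : EFin \o _ = (EFin \o (fun x => normc (f (x + 2^-1 *: h)) ^+ 2)%R) \+
       (EFin \o (fun x => normc (f (x + - (2^-1 *: h))) ^+ 2)%R))//.
    by apply: integrableD; [|exact: i1|exact: i1].
  congr EFin; rewrite -/(Rintegral _ _ _).
  have -> : P h = (\int[mu]_x corr_re f x h)%R by rewrite /Rintegral -PE.
  rewrite RintegralB//; last 2 first.
  - rewrite (_ : EFin \o _ = (EFin \o (fun x => normc (f (x + 2^-1 *: h)) ^+ 2)%R) \+
       (EFin \o (fun x => normc (f (x + - (2^-1 *: h))) ^+ 2)%R))//.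
    by apply: integrableD; [|exact: i1|exact: i1].
  - rewrite (_ : EFin \o _ = (fun x => 2%:E * (EFin \o (fun x => corr_re f x h)) x))//.
    exact: integrableZl.
  rewrite RintegralD; [|exact: measurableT|exact: i1|exact: i1].
  by rewrite (RE (2^-1 *: h)%R) (RE (- (2^-1 *: h))%R) RintegralZl//; ring.
rewrite shiftE EFinM; apply: lee_wpmul2l; first by rewrite lee_fin.
apply: (@le_trans _ _ `|P 0%R - P (0 + h)%R|%:E).
  by rewrite P0 add0r lee_fin ler_norm.
apply: le_trans key _.
have mbW : measurable_fun setT (fun z : X * X => (be z.2 * normc (wigner f z.1 z.2))%:E).
  apply/measurable_EFinP; apply: measurable_funM; last exact: measurable_normc_wigner.
  exact: (measurableT_comp mbe measurable_snd).
have bW0 z : 0 <= (be z.2 * normc (wigner f z.1 z.2))%:E.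
  by rewrite lee_fin mulr_ge0// Defs.normc_ge0.
apply: ge0_le_integral => //.
- by apply/measurable_EFinP; apply: measurableT_comp => //; exact: measurable_refourier.
- exact: (measurable_fun_fubini_tonelli_G
    (fun z : X * X => (be z.2 * normc (wigner f z.1 z.2))%:E) mbW bW0).
move=> w _.
rewrite refourierB// refourier_shift//.
set c := cos _; set s := sin _.
set r := refourier _ _ w; set r' := refourier _ _ w.
have -> : (r - (c * r - s * r') = (1 - c) * r + s * r')%R by ring.
apply: (@le_trans _ _ (`|1 - c|%:E * `|r|%:E + `|s|%:E * `|r'|%:E)).
  by rewrite -!EFinM -EFinD lee_fin (le_trans (ler_normD _ _))// !normrM.
have W0 : 0 <= \int[mu]_x (normc (wigner f x w))%:E.
  by apply: integral_ge0 => x _; rewrite lee_fin Defs.normc_ge0.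
have bW (y : R) : y%:E <= \int[mu]_x (`|b x| * normc (wigner f x w))%:E ->
    y%:E <= \int[mu]_x (normc (wigner f x w))%:E.
  by under eq_integral do rewrite normr1 mul1r.
apply: (@le_trans _ _ ((be w)%:E * \int[mu]_x (normc (wigner f x w))%:E)).
  rewrite /be -/c -/s EFinD ge0_muleDl ?lee_fin//.
  apply: leeD; apply: lee_wpmul2l; rewrite ?lee_fin//; apply: bW.
    exact: normr_refourier_autocorr_re.
  exact: normr_refourier_autocorr_im.
rewrite -ge0_integralZl//.
- exact/measurable_EFinP.
- by move=> x _; rewrite lee_fin Defs.normc_ge0.
- by rewrite lee_fin.
Qed.

End wigner_bounds.

(** * Concentrated Wigner distributions: uniform tails and smoothness *)

Section cLnorm2.
Context d (T : measurableType d) (R : realType) (mu : {measure set T -> \bar R}).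
Local Open Scope ereal_scope.
Implicit Types f : T -> R[i].

Lemma cLnorm1E f : cLnorm mu 1%:E f = \int[mu]_x (normc (f x))%:E.
Proof.
rewrite /cLnorm Lnorm1; apply: eq_integral => x _.
by rewrite abse_EFin ger0_norm// Defs.normc_ge0.
Qed.

Lemma cLnorm2_sqr f :
  cLnorm mu 2%:E f * cLnorm mu 2%:E f = \int[mu]_x (normc (f x) ^+ 2)%:E.
Proof.
transitivity (cLnorm mu 2%:E f `^ 2).
  have := cLnorm_ge0 mu 2%:E f; case: (cLnorm mu 2%:E f) => [r| |] //.
    by rewrite lee_fin => r0; rewrite poweR_EFin powR_mulrn// -EFinM expr2.
  by move=> _; rewrite poweRE/= pnatr_eq0.
rewrite poweR_Lnorm//; apply: eq_integral => x _.
by rewrite abse_EFin poweR_EFin ger0_norm ?Defs.normc_ge0// powR_mulrn// Defs.normc_ge0.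
Qed.

Lemma cLnorm2_le f (M : R) : cLnorm mu 2%:E f <= M%:E ->
  \int[mu]_x (normc (f x) ^+ 2)%:E <= (M ^+ 2)%:E.
Proof.
by move=> fM; rewrite -cLnorm2_sqr expr2 EFinM lee_pmul// cLnorm_ge0.
Qed.

Lemma cLnorm2_le_sqr f (M : R) : (0 <= M)%R ->
  \int[mu]_x (normc (f x) ^+ 2)%:E <= (M ^+ 2)%:E -> cLnorm mu 2%:E f <= M%:E.
Proof.
move=> M0; rewrite -cLnorm2_sqr; move: (cLnorm_ge0 mu 2%:E f).
case: (cLnorm mu 2%:E f) => [r| |]//; rewrite -EFinM !lee_fin => r0.
by rewrite -expr2 ler_sqr.
Qed.

End cLnorm2.

Section wigner_uniform.
Context {R : realType} (d : nat).
Local Notation mu := (@lebesgue_rV R d).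
Local Notation X := ('rV[R]_d).
Local Open Scope ereal_scope.

Lemma measurable_enorm : measurable_fun setT (@enorm R d).
Proof.
apply: measurableT_comp; first by apply: continuous_measurable_fun; exact: sqrt_continuous.
apply: measurable_sum => i.
by apply: measurable_funM; exact: measurable_rV_coord.
Qed.

Lemma measurable_enorm_gt (xi : R) : measurable [set x : X | (xi < enorm x)%R].
Proof.
rewrite (_ : [set x | _] = (@enorm R d) @^-1` `]xi, +oo[%classic); last first.
  by apply/seteqP; split => x /=; rewrite in_itv/= andbT.
by rewrite -[X in measurable X]setTI; apply: measurable_enorm => //; exact: measurable_itv.
Qed.

Lemma measurable_Qbox (xi : R) : measurable (@Qbox R d xi).
Proof.
have -> : @Qbox R d xi = ~` [set x : X | (xi < enorm x)%R] `*` ~` [set x : X | (xi < enorm x)%R].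
  apply/seteqP; split => [[x w] [/= h1 h2]|[x w] [/= h1 h2]]; split => /=.
  - by apply/negP; rewrite -leNgt.
  - by apply/negP; rewrite -leNgt.
  - by rewrite leNgt; apply/negP.
  - by rewrite leNgt; apply/negP.
by apply: measurableX; apply: measurableC; exact: measurable_enorm_gt.
Qed.

Lemma normr_coord_le_enorm (x : X) i : (`|x ord0 i| <= enorm x)%R.
Proof.
rewrite -sqrtr_sqr; apply: ler_wsqrtr.
rewrite /dotv (bigD1 i)//= expr2 lerDl; apply: sumr_ge0 => j _.
by rewrite -expr2 sqr_ge0.
Qed.

Definition cube (xi : R) : set X := rect (fun _ : 'I_d => `[- xi, xi]%classic)%R.

Lemma measurable_cube xi : measurable (cube xi).
Proof. by apply: measurable_rect => i; exact: measurable_itv. Qed.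

Lemma Qbox_sub_cube xi : @Qbox R d xi `<=` cube xi `*` cube xi.
Proof.
move=> [x w] [/= hx hw]; split => i /=; rewrite in_itv/= -ler_norml.
  exact: le_trans (normr_coord_le_enorm _ _) hx.
exact: le_trans (normr_coord_le_enorm _ _) hw.
Qed.

Lemma Qbox_measure_fin xi : (mu \x mu) (@Qbox R d xi) \is a fin_num.
Proof.
have mC := measurable_cube xi.
rewrite ge0_fin_numE ?measure_ge0//.
apply: (@le_lt_trans _ _ ((mu \x mu) (cube xi `*` cube xi))).
  apply: le_measure; rewrite ?inE; [exact: measurable_Qbox|exact: measurableX|].
  exact: Qbox_sub_cube.
rewrite product_measure1E//.
have C : mu (cube xi) \is a fin_num by exact: (rect_itv_fin_num _ _ true false).
by rewrite -ge0_fin_numE ?fin_numM// mule_ge0.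
Qed.

Section one_function.
Variable f : X -> R[i].
Hypothesis mf : cmeasurable f.
Hypothesis f1 : \int[mu]_x (normc (f x))%:E < +oo.
Hypothesis f2 : \int[mu]_x (normc (f x) ^+ 2)%:E < +oo.

Let mW : measurable_fun setT (fun z : X * X => (normc (wigner f z.1 z.2))%:E).
Proof. by apply/measurable_EFinP; exact: measurable_normc_wigner. Qed.

Let W0 z : 0 <= (normc (wigner f z.1 z.2))%:E.
Proof. by rewrite lee_fin Defs.normc_ge0. Qed.

(** The strip where [xi < enorm x] does not meet [Qbox xi]. *)
Lemma energy_tail_le (xi : R) :
  \int[mu]_(x in [set x : X | (xi < enorm x)%R]) (normc (f x) ^+ 2)%:E <=
  \int[mu \x mu]_(z in ~` Qbox xi) (normc (wigner f z.1 z.2))%:E.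
Proof.
set B := [set x : X | _]; have mB : measurable B by exact: measurable_enorm_gt.
apply: le_trans (energy_le_wigner mf f1 f2 mB) _.
have mBW : measurable_fun setT (fun z : X * X => (\1_B z.1 * normc (wigner f z.1 z.2))%:E).
  apply/measurable_EFinP; apply: measurable_funM; last exact: measurable_normc_wigner.
  by apply: measurableT_comp; [exact: measurable_indic|exact: measurable_fst].
have BW0 (z : X * X) : 0 <= (\1_B z.1 * normc (wigner f z.1 z.2))%:E.
  by rewrite lee_fin mulr_ge0// ?Defs.normc_ge0.
rewrite -(fubini_tonelli2 (fun z : X * X => (\1_B z.1 * normc (wigner f z.1 z.2))%:E))//.
rewrite [leRHS]integral_mkcond; apply: ge0_le_integral => //.
- have mQ := measurableC (measurable_Qbox xi).
  by apply/(measurable_restrictT _ mQ); exact: measurable_funTS.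
move=> z _; rewrite patchE indicE.
have [zB|zB] := boolP (z.1 \in B); last by rewrite mul0r; case: ifP.
have zQ : (~` @Qbox R d xi) z.
  by move: zB; rewrite inE => zB -[zxi _]; move: zB; rewrite /B/= ltNge zxi.
by rewrite (mem_set zQ) mul1r.
Qed.

(** The constant is not optimal: each of the real and imaginary parts is bounded with
    [|cos| + |sin| <= 2]. *)
Lemma normc_wigner_le x w :
  (normc (wigner f x w) <= 4 * (2 ^+ d * fine (energy f)))%R.
Proof.
have mabs : measurable_fun setT (corr_abs f x).
  exact: (measurableT_comp (measurable_corr_abs mf) (measurable_pair1 x)).
have iabs : mu.-integrable setT (EFin \o corr_abs f x).
  apply/integrableP; split; first exact/measurable_EFinP.
  under eq_integral do rewrite /= ger0_norm ?corr_abs_ge0//.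
  apply: le_lt_trans (integral_corr_abs_fst_le mf f2 x) _.
  by rewrite -(fineK (energy_fin_num f2)) -EFinM ltry.
have mre : measurable_fun setT (corr_re f x).
  exact: (measurableT_comp (measurable_corr_re mf) (measurable_pair1 x)).
have mim : measurable_fun setT (corr_im f x).
  exact: (measurableT_comp (measurable_corr_im mf) (measurable_pair1 x)).
have dom (g : X -> R) : measurable_fun setT g -> (forall t, `|g t| <= corr_abs f x t)%R ->
    mu.-integrable setT (EFin \o g).
  move=> mg gle; apply: le_integrable iabs => //; first exact/measurable_EFinP.
  by move=> t _; rewrite lee_fin [leRHS]ger0_norm ?corr_abs_ge0.
have RF (g h : X -> R) : measurable_fun setT g -> (forall t, `|g t| <= corr_abs f x t)%R ->
    measurable_fun setT h -> (forall t, `|h t| <= corr_abs f x t)%R ->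
    (`|refourier g h w| <= 2 * (2 ^+ d * fine (energy f)))%R.
  move=> mg gle mh hle; rewrite -lee_fin -abse_EFin refourierE; [|exact: dom|exact: dom].
  have iRF := integrable_refourier w (dom _ mg gle) (dom _ mh hle).
  apply: le_trans (le_abse_integral _ _ (measurable_int _ iRF)) _ => //.
  apply: (@le_trans _ _ (\int[mu]_t (2%:E * (corr_abs f x t)%:E))).
    apply: ge0_le_integral => //.
    - by apply: measurableT_comp => //; exact: measurable_int iRF.
    - by apply: measurable_funeM; exact/measurable_EFinP.
    move=> t _; rewrite lee_fin; apply: le_trans (ler_normD _ _) _.
    rewrite !normrM [leRHS](_ : _ = corr_abs f x t + corr_abs f x t)%R; last by ring.
    apply: lerD.
      by apply: le_trans (gle t); rewrite ler_piMr// normr_cos_le1.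
    by apply: le_trans (hle t); rewrite ler_piMr// normr_sin_le1.
  rewrite ge0_integralZl//; last 2 first.
  - exact/measurable_EFinP.
  - by move=> t _; rewrite lee_fin corr_abs_ge0.
  rewrite EFinM; apply: lee_wpmul2l => //.
  apply: le_trans (integral_corr_abs_fst_le mf f2 x) _.
  by rewrite -(fineK (energy_fin_num f2)) -EFinM.
apply: le_trans (normc_le_ReIm _) _.
rewrite (_ : 4 * _ = 2 * (2 ^+ d * fine (energy f)) + 2 * (2 ^+ d * fine (energy f)))%R; last by ring.
apply: lerD.
  rewrite Re_wignerE; apply: RF => // t; [exact: normr_corr_re|exact: normr_corr_im].
rewrite Im_wignerE; apply: RF => //; first by move=> t; exact: normr_corr_im.
  exact: measurable_funN.
by move=> t; rewrite normrN; exact: normr_corr_re.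
Qed.

End one_function.

End wigner_uniform.

Section uniform_smoothness.
Context {R : realType} (d : nat).
Local Notation mu := (@lebesgue_rV R d).
Local Notation X := ('rV[R]_d).
Local Open Scope ereal_scope.

Lemma normr_dotv_le (h w : X) (a b : R) : (0 <= a)%R ->
  (forall i, `|h ord0 i| <= a)%R -> (enorm w <= b)%R ->
  (`|dotv h w| <= d%:R * (a * b))%R.
Proof.
move=> a0 ha wb; rewrite /dotv; apply: le_trans (ler_norm_sum _ _ _) _.
apply: (@le_trans _ _ (\sum_(i < d) a * b)%R); last first.
  by rewrite sumr_const card_ord mulr_natl.
apply: ler_sum => i _; rewrite normrM ler_pM//.
exact: le_trans (normr_coord_le_enorm _ _) wb.
Qed.

Lemma cos_sin_near0 (e : R) : (0 < e)%R -> exists2 r : R, (0 < r)%R &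
  forall t : R, (`|t| <= r -> `|1 - cos t| + `|sin t| <= e)%R.
Proof.
move=> e0.
have c : ((fun t : R => `|1 - cos t| + `|sin t|) @ (0:R) --> (0:R))%R.
  rewrite [X in _ --> X](_ : _ = `|1 - cos (0:R)| + `|sin (0:R)|)%R; last first.
    by rewrite cos0 sin0 subrr !normr0 addr0.
  apply: cvgD; apply: cvg_norm; last exact: continuous_sin.
  by apply: cvgB; [exact: cvg_cst|exact: continuous_cos].
have /cvgrPdist_le/(_ e e0) := c.
move=> /nbhs_ballP[r /= r0 H]; exists (r / 2)%R; first by rewrite divr_gt0.
move=> t tr; have := H t; rewrite sub0r normrN ger0_norm ?addr_ge0//; apply.
rewrite /ball/= sub0r normrN; apply: le_lt_trans tr _.
by rewrite ltr_pdivrMr// ltr_pMr// ltr1n.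
Qed.

Variable K : set (X -> R[i]).
Hypothesis Km : forall f, K f -> cmeasurable f.
Hypothesis K1 : forall f, K f -> \int[mu]_x (normc (f x))%:E < +oo.
Variable M : R.
Hypothesis K2 : forall f, K f -> \int[mu]_x (normc (f x) ^+ 2)%:E <= M%:E.
Hypothesis KW : forall e : R, (0 < e)%R -> exists2 xi : R, (0 < xi)%R & forall f, K f ->
  \int[mu \x mu]_(z in ~` Qbox xi) (normc (wigner f z.1 z.2))%:E <= e%:E.

Let K2oo f : K f -> \int[mu]_x (normc (f x) ^+ 2)%:E < +oo.
Proof. by move=> Kf; apply: le_lt_trans (K2 Kf) _; exact: ltry. Qed.

Lemma uniform_tails (e : R) : (0 < e)%R -> exists2 xi : R, (0 < xi)%R & forall f, K f ->
  \int[mu]_(x in [set x : X | (xi < enorm x)%R]) (normc (f x) ^+ 2)%:E <= e%:E.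
Proof.
move=> /KW[xi xi0 H]; exists xi => // f Kf.
by apply: le_trans (H f Kf); apply: energy_tail_le; [exact: Km|exact: K1|exact: K2oo].
Qed.

(** In [shift_dist_le_wigner], the weight is at most 3 off [Qbox xi], where the Wigner
    distributions of [K] have small mass; on [Qbox xi] it is uniformly small with [h],
    because [|h.w| <= d * r * xi] there, while the Wigner distributions are uniformly
    bounded. *)
Lemma uniform_shift (e : R) : (0 < e)%R -> exists2 r : R, (0 < r)%R & forall f, K f ->
  forall h : X, (forall i, `|h ord0 i| <= r)%R -> shift_dist f h <= e%:E.
Proof.
move=> e0.
(* The factor 2 of [shift_dist_le_wigner] leaves [e / 4] for each of the two regions;
   off the box the weight 3 turns [e / 12] into [e / 4]. *)
have [xi xi0 Hxi] := KW (divr_gt0 e0 (ltr0n R 12)).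
set V := fine ((mu \x mu) (@Qbox R d xi)).
set C := (4 * (2 ^+ d * `|M|))%R.
have V0 : (0 <= V)%R by rewrite fine_ge0.
have C0 : (0 <= C)%R by rewrite !mulr_ge0// exprn_ge0.
have e'0 : (0 < e / (4 * (C * V + 1)))%R.
  by rewrite divr_gt0// mulr_gt0// ltr_wpDl// mulr_ge0.
have [q q0 Hq] := cos_sin_near0 e'0.
have D0 : (0 < 2 * pi * d%:R * xi + 1)%R.
  by rewrite ltr_wpDl// !mulr_ge0// ?pi_ge0// ltW.
exists (q / (2 * pi * d%:R * xi + 1))%R; first exact: divr_gt0.
move=> f Kf h hr.
apply: le_trans (shift_dist_le_wigner (Km Kf) (K1 Kf) (K2oo Kf) h) _.
pose b (w : X) := (`|1 - cos (2 * pi * dotv h w)| + `|sin (2 * pi * dotv h w)|)%R.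
have b0 w : (0 <= b w)%R by rewrite addr_ge0.
have b3 w : (b w <= 3)%R.
  rewrite /b (_ : 3 = (1 + 1) + 1)%R; last by ring.
  rewrite lerD ?normr_sin_le1//; apply: le_trans (ler_normB _ _) _.
  by rewrite normr1 lerD2l normr_cos_le1.
have mb : measurable_fun setT b.
  apply: measurable_funD; apply: measurableT_comp => //.
    by apply: measurable_funB => //; exact: measurable_cos_dotv.
  exact: measurable_sin_dotv.
pose G (z : X * X) : \bar R := (b z.2 * normc (wigner f z.1 z.2))%:E.
have G0 z : 0 <= G z by rewrite lee_fin mulr_ge0// Defs.normc_ge0.
have mW := measurable_normc_wigner (Km Kf).
have mG : measurable_fun setT G.
  apply/measurable_EFinP; apply: measurable_funM => //.
  by apply: measurableT_comp mb _; exact: measurable_snd.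
have mQ : measurable (@Qbox R d xi) := measurable_Qbox xi.
have mQc : measurable (~` @Qbox R d xi) := measurableC mQ.
have nQ : \int[mu \x mu]_(z in Qbox xi) G z <= (e / 4)%:E.
  apply: (@le_trans _ _ (\int[mu \x mu]_(z in @Qbox R d xi) (e / (4 * (C * V + 1)) * C)%:E)).
    apply: ge0_le_integral => //.
    - exact: measurable_funTS.
    move=> [x w] [/= _ wxi]; rewrite lee_fin ler_pM ?Defs.normc_ge0//.
      apply: Hq; rewrite normrM ger0_norm ?mulr_ge0 ?pi_ge0//.
      apply: le_trans (_ : 2 * pi * (d%:R * (q / (2 * pi * d%:R * xi + 1) * xi)) <= _)%R.
        apply: ler_wpM2l; first by rewrite mulr_ge0 ?pi_ge0.
        by apply: normr_dotv_le => //; rewrite ltW// divr_gt0.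
      rewrite (_ : 2 * pi * _ = q * ((2 * pi * d%:R * xi) / (2 * pi * d%:R * xi + 1)))%R; last by ring.
      rewrite ler_piMr ?(ltW q0)// ler_pdivrMr// mul1r.
      by rewrite lerDl.
    apply: le_trans (normc_wigner_le (Km Kf) (K2oo Kf) x w) _.
    rewrite ler_wpM2l// ler_wpM2l ?exprn_ge0//.
    apply: le_trans (ler_norm M); rewrite -lee_fin.
    by rewrite fineK ?energy_fin_num ?K2oo// K2.
  have QV : (mu \x mu) (@Qbox R d xi) = V%:E by rewrite fineK// Qbox_measure_fin.
  rewrite integral_cst// [X in _ * X]QV -EFinM lee_fin.
  have CV0 : (0 <= C * V)%R by rewrite mulr_ge0.
  rewrite (_ : _ * _ * V = (e / 4) * ((C * V) / (C * V + 1)))%R; last first.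
    by field; rewrite ?gt_eqF// ltr_wpDl.
  rewrite ler_piMr ?divr_ge0 ?(ltW e0)// ler_pdivrMr ?ltr_wpDl// mul1r.
  by rewrite lerDl.
have nQc : \int[mu \x mu]_(z in ~` Qbox xi) G z <= (e / 4)%:E.
  have m' : measurable_fun (~` @Qbox R d xi) (fun z : X * X => (normc (wigner f z.1 z.2))%:E).
    by apply: measurable_funTS; exact/measurable_EFinP.
  have p' z : (~` @Qbox R d xi) z -> 0 <= (normc (wigner f z.1 z.2))%:E.
    by rewrite lee_fin Defs.normc_ge0.
  apply: (@le_trans _ _ (\int[mu \x mu]_(z in ~` @Qbox R d xi) (3%:E * (normc (wigner f z.1 z.2))%:E))).
    apply: ge0_le_integral => //.
    - exact: measurable_funTS.
    - exact: measurable_funeM.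
    by move=> z _; rewrite lee_fin ler_wpM2r// Defs.normc_ge0.
  rewrite ge0_integralZl// (_ : e / 4 = 3 * (e / 12))%R; last by field.
  by rewrite EFinM lee_wpmul2l// Hxi.
have -> : \int[mu]_w \int[mu]_x
    ((`|1 - cos (2 * pi * dotv h w)| + `|sin (2 * pi * dotv h w)|) * normc (wigner f x w))%:E =
    \int[mu \x mu]_z G z.
  by rewrite (fubini_tonelli2 G mG G0).
rewrite -(setUv (@Qbox R d xi)) ge0_integral_setU//; last 2 first.
- by rewrite setUv.
- exact/disj_setPCl.
rewrite [leRHS](_ : _ = 2%:E * ((e / 4)%:E + (e / 4)%:E)); last first.
  by rewrite -EFinD -EFinM; congr EFin; field.
by rewrite lee_wpmul2l// leeD.
Qed.

End uniform_smoothness.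

(** * Precompactness and completeness in L^2 *)

Section finite_partitions.
Context {R : realType} (M : pseudoMetricType R).

(** An ultrafilter on the closure of [K] contains a neighbourhood of one of the finitely
    many classes, hence a small ball, for every [e]: it is Cauchy. *)
Lemma precompact_finite_partitions (K : set M) :
  (forall F : set_system M, ProperFilter F -> cauchy_ex F -> exists p : M, F --> p) ->
  (forall e : R, 0 < e -> exists (T : finType) (psi : M -> T),
    forall f g, K f -> K g -> psi f = psi g -> ball f e g) ->
  precompact K.
Proof.
move=> complete part; rewrite precompactE compact_ultra => U UU UK.
have UP : ProperFilter U by exact: ultra_proper.
have [p Up] : exists p : M, U --> p; last first.
  exists p; split=> //.
  exact: (@closed_cvg _ _ U UP id (closure K) (@closed_closure _ K) UK p Up).
apply: complete => e e0.
have e20 : 0 < e / 2 by rewrite divr_gt0.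
have [T [psi Hpsi]] := part _ e20.
pose A (t : T) := [set f : M | exists g, [/\ K g, psi g = t & ball g (e / 2) f]].
have [t Ut] : exists t, U (A t).
  apply: contrapT => /forallNP noA.
  have : \forall f \near U, forall t, ~ A t f.
    apply: filter_forall => t.
    by have [//|] := in_ultra_setVsetC (A t) UU; have := noA t.
  move=> nA; have [f [Kf nAf]] := filter_ex (filterI UK nA : U (_ `&` _)).
  have /= [g [Kg fg]] := Kf _ (nbhsx_ballx f _ e20).
  by apply: (nAf (psi g)); exists g; split=> //; exact: ball_sym.
have [f [g [Kg gt _]]] := filter_ex Ut.
exists g; apply: filterS Ut => f' [g' [Kg' g't g'f']].
rewrite [e]splitr; apply: ball_triangle g'f'.
by apply: Hpsi => //; rewrite gt g't.
Qed.

End finite_partitions.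

Section geometric_cvg.
Context {R : realType}.

Lemma geometric_cvg (a : R^nat) (c : R) : 0 <= c ->
  (forall n, `|a n.+1 - a n| <= c * 2^-1 ^+ n) ->
  exists2 l : R, a @ \oo --> l & forall n, `|a n - l| <= 2 * c * 2^-1 ^+ n.
Proof.
move=> c0 ac.
have dist n m : `|a (n + m)%N - a n| <= 2 * c * 2^-1 ^+ n * (1 - 2^-1 ^+ m).
  elim: m => [|m IH]; first by rewrite addn0 subrr normr0 expr0 subrr mulr0.
  rewrite -(subrKA (a (n + m)%N)) addnS; apply: le_trans (ler_normD _ _) _.
  apply: le_trans (lerD (ac _) IH) _.
  by rewrite exprD exprS le_eqVlt; apply/orP; left; apply/eqP; field.
have dist' n m : (n <= m)%N -> `|a n - a m| <= 2 * c * 2^-1 ^+ n.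
  move=> /subnKC <-; rewrite distrC; apply: le_trans (dist _ _) _.
  by rewrite ler_piMr ?mulr_ge0 ?exprn_ge0// gerBl exprn_ge0.
have small : (2 * c * 2^-1 ^+ n) @[n --> \oo] --> (0 : R).
  rewrite -(mulr0 (2 * c)); apply: cvgMr; apply: cvg_expr.
  by rewrite ger0_norm// invf_lt1// ltr1n.
have /cvg_ex[/= l al] : cvgn a.
  apply: cauchy_cvg; apply: cauchy_exP => e e0.
  have /cvgrPdist_lt/(_ e e0)[n _ Hn] := small.
  exists (a n); exists n => // m nm; rewrite /ball/=.
  apply: le_lt_trans (dist' _ _ nm) _.
  by have := Hn n (leqnn n); rewrite sub0r normrN => /(le_lt_trans (ler_norm _)).
exists l => // n.
have c' : (`|a n - a m|) @[m --> \oo] --> `|a n - l|.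
  by apply: cvg_norm; apply: cvgB => //; exact: cvg_cst.
by apply: (cvgr_to_le c'); exists n => // m /=; exact: dist'.
Qed.

(** The limit is taken for [v] multiplied by the indicator of [A], so as to exist, and be
    measurable, everywhere. *)
Lemma measurable_geometric_limit d (T : measurableType d) (v : nat -> T -> R)
    (A : set T) (c : T -> R) :
  measurable A -> (forall n, measurable_fun setT (v n)) ->
  (forall x, A x -> 0 <= c x) ->
  (forall n x, A x -> `|v n.+1 x - v n x| <= c x * 2^-1 ^+ n) ->
  exists2 p : T -> R, measurable_fun setT p &
    forall n x, A x -> `|v n x - p x| <= 2 * c x * 2^-1 ^+ n.
Proof.
move=> mA mv c0 vc.
pose a x n := \1_A x * v n x.
have ax x : exists2 l : R, a x @ \oo --> l &
    forall n, A x -> `|v n x - l| <= 2 * c x * 2^-1 ^+ n.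
  have [Ax|nAx] := pselect (A x).
    have aE : a x = v ^~ x by apply/funext => n; rewrite /a indicE mem_set// mul1r.
    have [l al H] := geometric_cvg (a := v ^~ x) (c0 x Ax) (fun n => vc n x Ax).
    by exists l; rewrite ?aE.
  exists 0 => //; rewrite (_ : a x = cst 0); first exact: cvg_cst.
  by apply/funext => n; rewrite /a indicE memNset// mul0r.
exists (fun x => lim (a x @ \oo)).
  apply: (measurable_fun_cvg (h := fun n x => a x n)) => [n|x _].
    by apply: measurable_funM => //; exact: measurable_indic.
  by have [l al _] := ax x; rewrite (cvg_lim _ al).
by move=> n x Ax; have [l al H] := ax x; rewrite (cvg_lim _ al)//; exact: H.
Qed.

Local Open Scope ereal_scope.

Lemma nneseries_expr_half : \sum_(0 <= n <oo) (2^-1 ^+ n : R)%:E = 2%:E.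
Proof.
have h1 : (`|2^-1 : R| < 1)%R by rewrite ger0_norm// invf_lt1// ltr1n.
rewrite (_ : (fun n => _) = EFin \o series (geometric 1%R 2^-1%R)).
  apply/cvg_lim => //; apply: cvg_EFin; first exact: nearW.
  have := @cvg_geometric_series _ 1%R _ h1.
  by rewrite (_ : 1 / (1 - 2^-1) = 2 :> R)%R//; field.
apply/funext => n /=; rewrite /series/= sumEFin; congr EFin.
by apply: eq_bigr => i _; rewrite mul1r.
Qed.

End geometric_cvg.

Section cL2_completeness.
Context d (T : measurableType d) (R : realType) (mu : {measure set T -> \bar R}).
Local Open Scope ereal_scope.

Lemma sqr_cL2_distE (f g : cL2 mu) :
  ((cL2_dist f g) ^+ 2)%:E = \int[mu]_x (normc (f x - g x) ^+ 2)%:E.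
Proof. by rewrite -cLnorm2_sqr -cL2_distE -EFinM expr2. Qed.

Lemma cmeasurable_cL2 (f : cL2 mu) : cmeasurable f.
Proof. by case: (cL2_Lfun f). Qed.

(** The representative of a class is only almost everywhere equal to the function that
    the class was built from. *)
Lemma cL2_of_Lfun (p : T -> R[i]) : cLfun mu 2%:E p ->
  exists P : cL2 mu, {ae mu, forall x, P x = p x}.
Proof.
move=> Lp; exists (\pi_(cL2 mu) (CL2fun Lp))%qT.
by have /eqmodP/asboolP := reprK (\pi_(cL2 mu) (CL2fun Lp))%qT.
Qed.

Lemma ae_eq_cL2_dist (u : T -> R[i]) (p q : T -> R[i]) :
  cmeasurable u -> cmeasurable p -> cmeasurable q ->
  {ae mu, forall x, p x = q x} ->
  \int[mu]_x (normc (u x - p x) ^+ 2)%:E = \int[mu]_x (normc (u x - q x) ^+ 2)%:E.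
Proof.
move=> mu_ mp mq pq; apply: ae_eq_integral => //.
- by apply/measurable_EFinP/measurable_funX/measurable_normc/cmeasurableB.
- by apply/measurable_EFinP/measurable_funX/measurable_normc/cmeasurableB.
by apply: filterS pq => x -> _.
Qed.

Section rapid_sequence.
Variable u : nat -> T -> R[i].
Hypothesis mu_ : forall n, cmeasurable (u n).
Hypothesis du : forall n,
  \int[mu]_x (normc (u n.+1 x - u n x) ^+ 2)%:E <= (8^-1 ^+ n)%:E.

(** The weights [4 ^+ n] leave the integral of [g] finite and bound the [n]-th increment
    by [2^-1 ^+ n] times the square root of [g]. *)
Let g x : \bar R := \sum_(0 <= n <oo) (4 ^+ n * normc (u n.+1 x - u n x) ^+ 2)%:E.

Let g_ge x n : (4 ^+ n * normc (u n.+1 x - u n x) ^+ 2)%:E <= g x.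
Proof.
have p0 k : 0 <= (4 ^+ k * normc (u k.+1 x - u k x) ^+ 2)%:E.
  by rewrite lee_fin mulr_ge0// ?exprn_ge0// Defs.normc_ge0.
apply: le_trans (nneseries_lim_ge n.+1 _) => //.
by rewrite big_nat_recr//= leeDr// sume_ge0.
Qed.

Let mg : measurable_fun setT g.
Proof.
apply: ge0_emeasurable_sum => [k x _ _|k _].
  by rewrite lee_fin mulr_ge0// ?exprn_ge0// Defs.normc_ge0.
apply/measurable_EFinP; apply: measurable_funM => //.
by apply: measurable_funX; apply: measurable_normc; exact: cmeasurableB.
Qed.

Let g0 x : 0 <= g x.
Proof.
by apply: nneseries_ge0 => n _ _; rewrite lee_fin mulr_ge0// ?exprn_ge0// Defs.normc_ge0.
Qed.

Let intg : \int[mu]_x g x <= 2%:E.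
Proof.
rewrite integral_nneseries//; last 2 first.
- move=> n; apply/measurable_EFinP; apply: measurable_funM => //.
  by apply: measurable_funX; apply: measurable_normc; exact: cmeasurableB.
- by move=> n x _; rewrite lee_fin mulr_ge0// ?exprn_ge0// Defs.normc_ge0.
rewrite -nneseries_expr_half; apply: lee_nneseries => [n _ _|n _].
  by apply: integral_ge0 => x _; rewrite lee_fin mulr_ge0// ?exprn_ge0// Defs.normc_ge0.
under eq_integral do rewrite EFinM.
rewrite ge0_integralZl//; last 2 first.
- apply/measurable_EFinP.
  by apply: measurable_funX; apply: measurable_normc; exact: cmeasurableB.
- by move=> x _; rewrite lee_fin exprn_ge0// Defs.normc_ge0.
apply: le_trans (lee_wpmul2l _ (du n)) _; first by rewrite lee_fin exprn_ge0.
rewrite -EFinM -exprMn lee_fin (_ : 4 * 8^-1 = 2^-1 :> R)%R//.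
by field.
Qed.

(** Where [g] is finite, that is almost everywhere, the increments are summable, and the
    distance from [u n] to the pointwise limit is at most a geometric tail times the
    square root of [g]; integrating [g] bounds the distance in L^2. *)
Lemma rapid_limit : exists2 p : T -> R[i], cmeasurable p &
  forall n, \int[mu]_x (normc (u n x - p x) ^+ 2)%:E <= (16 * 4^-1 ^+ n)%:E.
Proof.
have gi : mu.-integrable setT g.
  apply/integrableP; split=> //; under eq_integral do rewrite gee0_abs//.
  by apply: le_lt_trans intg _; exact: ltry.
pose A := [set x | g x < +oo].
have mA : measurable A.
  rewrite (_ : A = setT `&` [set x | g x < +oo]); last by rewrite setTI.
  by apply: emeasurable_fun_infty_o.
pose c x := Num.sqrt (fine (g x)).
have c0 x : A x -> (0 <= c x)%R by rewrite sqrtr_ge0.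
have dc n x : A x -> (normc (u n.+1 x - u n x) <= c x * 2^-1 ^+ n)%R.
  move=> Ax; have := g_ge x n.
  have gfin : g x \is a fin_num by rewrite ge0_fin_numE.
  rewrite -(fineK gfin) lee_fin => h.
  rewrite -ler_sqr ?nnegrE ?mulr_ge0 ?exprn_ge0 ?Defs.normc_ge0 ?sqrtr_ge0//.
  rewrite exprMn sqr_sqrtr ?fine_ge0// -exprM mulnC exprM exprVn -exprVn.
  rewrite (_ : 2^-1 ^+ 2 = 4^-1 :> R)%R; last by field.
  by rewrite exprVn ler_pdivlMr ?exprn_gt0// mulrC.
have [pr mpr Hr] : exists2 p : T -> R, measurable_fun setT p &
    forall n x, A x -> (`|complex.Re (u n x) - p x| <= 2 * c x * 2^-1 ^+ n)%R.
  apply: measurable_geometric_limit => //; first by move=> n; case: (mu_ n).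
  move=> n x Ax; apply: le_trans (dc n x Ax).
  by rewrite -raddfB; exact: normr_Re_le.
have [pi mpi Hi] : exists2 p : T -> R, measurable_fun setT p &
    forall n x, A x -> (`|complex.Im (u n x) - p x| <= 2 * c x * 2^-1 ^+ n)%R.
  apply: measurable_geometric_limit => //; first by move=> n; case: (mu_ n).
  move=> n x Ax; apply: le_trans (dc n x Ax).
  by rewrite -raddfB; exact: normr_Im_le.
pose p x := (pr x +i* pi x)%C.
have mp : cmeasurable p by split.
exists p => // n.
have mI : measurable_fun setT (fun x => (normc (u n x - p x) ^+ 2)%:E).
  by apply/measurable_EFinP/measurable_funX/measurable_normc/cmeasurableB.
apply: (@le_trans _ _ (\int[mu]_x ((8 * 4^-1 ^+ n)%:E * g x))).
  apply: ae_ge0_le_integral => //.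
  - by move=> x _; rewrite lee_fin exprn_ge0// Defs.normc_ge0.
  - by move=> x _; rewrite mule_ge0// lee_fin mulr_ge0// exprn_ge0.
  - exact: measurable_funeM.
  have := integrable_ae measurableT gi; apply: filterS => x /(_ Logic.I) gfin _.
  have Ax : A x by rewrite /A/= -ge0_fin_numE.
  rewrite -(fineK gfin) -EFinM lee_fin sqr_normc /sqn.
  have q0 : (0 <= 2 * c x * 2^-1 ^+ n)%R by rewrite !mulr_ge0 ?exprn_ge0 ?c0.
  have q2 : ((2 * c x * 2^-1 ^+ n) ^+ 2 = 4 * 4^-1 ^+ n * fine (g x))%R.
    rewrite !exprMn sqr_sqrtr ?fine_ge0// -exprM mulnC exprM.
    by rewrite (_ : 2^-1 ^+ 2 = 4^-1 :> R)%R; [ring|field].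
  rewrite (_ : 8 * _ * _ = 4 * 4^-1 ^+ n * fine (g x) + 4 * 4^-1 ^+ n * fine (g x))%R; last by ring.
  rewrite -q2 -real_normK ?num_real// -[X in (_ + X)%R]real_normK ?num_real//.
  rewrite lerD// ler_sqr ?nnegrE//.
    by have := Hr n x Ax; rewrite /p; case: (u n x).
  by have := Hi n x Ax; rewrite /p; case: (u n x).
rewrite ge0_integralZl//.
apply: le_trans (lee_wpmul2l _ intg) _; first by rewrite lee_fin mulr_ge0// exprn_ge0.
by rewrite -EFinM lee_fin le_eqVlt; apply/orP; left; apply/eqP; ring.
Qed.

End rapid_sequence.

(** The centres of rapidly shrinking balls of the filter form a rapidly convergent
    sequence, and its limit is that of the filter. *)
Lemma cL2_complete (F : set_system (cL2 mu)) : ProperFilter F -> cauchy_ex F ->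
  exists p : cL2 mu, F --> p.
Proof.
move=> FF Fc.
(* Successive centres are then at distance at most [4^-1 ^+ n], whose square is below
   the [8^-1 ^+ n] of [rapid_limit]. *)
pose e n : R := (2^-1 * 4^-1 ^+ n)%R.
have e0 n : (0 < e n)%R by rewrite mulr_gt0// exprn_gt0.
have /choice[u Fu] : forall n, exists v : cL2 mu, F (ball v (e n)) by move=> n; exact: Fc.
have du n : (cL2_dist (u n) (u n.+1) ^+ 2 <= 8^-1 ^+ n)%R.
  have [f [fn fn1]] := filter_ex (filterI (Fu n) (Fu n.+1) : F (_ `&` _)).
  have : ball (u n) (e n + e n.+1) (u n.+1) by apply: ball_triangle fn _; exact: ball_sym.
  rewrite -metricType_numDomainType.ball_mdistE /= => /ltW dn.
  apply: (@le_trans _ _ ((4^-1 ^+ n) ^+ 2)%R).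
    have {}dn := le_trans dn (_ : _ <= 4^-1 ^+ n)%R.
    rewrite ler_sqr ?nnegrE ?exprn_ge0// ?fine_ge0 ?cLnorm_ge0//; apply: dn.
    rewrite /e exprS; have : (0 <= 4^-1 ^+ n :> R)%R by rewrite exprn_ge0.
    by lra.
  rewrite -exprM mulnC exprM lerXn2r ?nnegrE ?exprn_ge0 ?invr_ge0//.
  by lra.
have [p mp Hp] : exists2 p : T -> R[i], cmeasurable p &
    forall n, \int[mu]_x (normc (u n x - p x) ^+ 2)%:E <= (16 * 4^-1 ^+ n)%:E.
  apply: rapid_limit => n; first exact: cmeasurable_cL2.
  apply: le_trans (_ : (cL2_dist (u n) (u n.+1) ^+ 2)%:E <= _); last by rewrite lee_fin.
  rewrite sqr_cL2_distE le_eqVlt; apply/orP; left; apply/eqP; apply: eq_integral => x _.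
  by rewrite -opprB normcN.
have mu_ n : cmeasurable (u n) := cmeasurable_cL2 (u n).
have norm n : cLnorm mu 2%:E (fun x => u n x - p x)%R <= (4 * 2^-1 ^+ n)%:E.
  apply: cLnorm2_le_sqr; first by rewrite mulr_ge0// exprn_ge0.
  rewrite exprMn -exprM mulnC exprM (_ : 2^-1 ^+ 2 = 4^-1 :> R)%R; last by field.
  by rewrite (_ : 4 ^+ 2 = 16 :> R)%R; [exact: Hp|ring].
have Lp : cLfun mu 2%:E p.
  split=> //; have m0 : cmeasurable (cst 0%R : T -> R[i]) by split; exact: measurable_cst.
  have le12 : 1 <= 2%:E :> \bar R by rewrite lee_fin ler1n.
  have := cLnorm_triangle mu mp (mu_ 0%N) m0 le12.
  rewrite (_ : (fun x => p x - cst 0 x)%R = p); last by apply/funext => x; rewrite subr0.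
  move=> /le_lt_trans; apply; apply: lte_add_pinfty.
    rewrite /cLnorm; under eq_fun do rewrite -opprB normcN.
    by apply: le_lt_trans (norm 0%N) _; exact: ltry.
  by rewrite /cLnorm; under eq_fun do rewrite subr0; case: (cL2_Lfun (u 0%N)).
have [P PE] := cL2_of_Lfun Lp.
have dP n : (cL2_dist (u n) P <= 4 * 2^-1 ^+ n)%R.
  rewrite -ler_sqr ?nnegrE ?fine_ge0 ?cLnorm_ge0 ?mulr_ge0 ?exprn_ge0//.
  rewrite -lee_fin sqr_cL2_distE (ae_eq_cL2_dist (mu_ n) (cmeasurable_cL2 P) mp PE).
  exact: cLnorm2_le (norm n).
exists P; apply/cvg_ballP => r r0.
have h1 : (`|2^-1 : R| < 1)%R by rewrite ger0_norm// invf_lt1// ltr1n.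
have small : ((5 * 2^-1 ^+ n)%R @[n --> \oo] --> (0 : R))%R.
  by rewrite -(mulr0 (5 : R)%R); apply: cvgMr; exact: cvg_expr.
have /cvgrPdist_lt/(_ r r0)[n _ /(_ n (leqnn n))/= nr] := small.
apply: filterS (Fu n) => f unf; rewrite -metricType_numDomainType.ball_mdistE /=.
have {}unf : (cL2_dist (u n) f < e n)%R.
  by move: unf; rewrite -metricType_numDomainType.ball_mdistE.
apply: le_lt_trans (metric_triangle P (u n) f) _.
rewrite metric_sym; apply: le_lt_trans (lerD (dP n) (ltW unf)) _.
apply: le_lt_trans nr; rewrite sub0r normrN ger0_norm ?mulr_ge0 ?exprn_ge0//.
have : (e n <= 2^-1 ^+ n)%R.
  apply: (@le_trans _ _ (4^-1 ^+ n)%R).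
    by rewrite /e ler_piMl ?exprn_ge0// invf_le1// ler1n.
  by rewrite lerXn2r ?nnegrE// lef_pV2 ?posrE// ler_nat.
lra.
Qed.

End cL2_completeness.

(** * The Kolmogorov-Riesz criterion *)

Section variance.
Context d (T : measurableType d) (R : realType) (mu : {measure set T -> \bar R}).
Local Open Scope ereal_scope.
Variables (Q : set T) (q : R).
Hypothesis mQ : measurable Q.
Hypothesis muQ : mu Q = q%:E.

Let q0 : (0 <= q)%R. Proof. by rewrite -lee_fin -muQ. Qed.

Let ic (c : R) : mu.-integrable Q (EFin \o cst c).
Proof.
apply/integrableP; split; first by apply/measurable_EFinP; exact: measurable_cst.
by under eq_integral do rewrite /=; rewrite integral_cst// muQ -EFinM ltry.
Qed.

Lemma integrable_sqr_integrable (u : T -> R) : measurable_fun setT u ->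
  mu.-integrable Q (EFin \o (fun x => u x ^+ 2)%R) -> mu.-integrable Q (EFin \o u).
Proof.
move=> mu_ u2; apply: le_integrable (integrableD mQ (ic 1) u2) => //.
  by apply/measurable_EFinP; exact: measurable_funTS.
move=> x _; rewrite /= lee_fin [leRHS]ger0_norm ?addr_ge0 ?sqr_ge0//.
rewrite -[X in (_ <= _ + X)%R]real_normK ?num_real//.
have := sqr_ge0 (`|u x| - 1)%R; have := normr_ge0 (u x).
by nra.
Qed.

Lemma integral_sqrB (u : T -> R) x : measurable_fun setT u ->
  mu.-integrable Q (EFin \o (fun x => u x ^+ 2)%R) ->
  \int[mu]_(y in Q) ((u x - u y) ^+ 2)%:E =
  (\int[mu]_(y in Q) (u y ^+ 2) +
    (- 2 * (\int[mu]_(y in Q) u y) * u x + q * u x ^+ 2))%:E.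
Proof.
move=> mu_ u2; have u1 := integrable_sqr_integrable mu_ u2.
have i1 : mu.-integrable Q (fun y => (- 2 * u x)%:E * (u y)%:E) by exact: integrableZl.
have -> : \int[mu]_(y in Q) ((u x - u y) ^+ 2)%:E =
    \int[mu]_(y in Q) ((u x ^+ 2)%:E + ((- 2 * u x)%:E * (u y)%:E + (u y ^+ 2)%:E)).
  by apply: eq_integral => y _; rewrite -EFinM -!EFinD; congr EFin; ring.
rewrite integralD//=; [|exact: ic|exact: integrableD].
rewrite integralD// integral_cst// muQ integralZl//.
rewrite -(fineK (integrable_fin_num mQ u1)) -(fineK (integrable_fin_num mQ u2)).
by rewrite -!EFinM -!EFinD; congr EFin; rewrite /Rintegral; ring.
Qed.

Lemma measurable_integral_sqrB (u : T -> R) : measurable_fun setT u ->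
  mu.-integrable Q (EFin \o (fun x => u x ^+ 2)%R) ->
  measurable_fun Q (fun x => \int[mu]_(y in Q) ((u x - u y) ^+ 2)%:E).
Proof.
move=> mu_ u2; under eq_fun do rewrite integral_sqrB//.
apply/measurable_EFinP/measurable_funTS/measurable_funD => //.
by apply: measurable_funD; apply: measurable_funM => //; exact: measurable_funX.
Qed.

(** Both sides expand to twice the product of [q] and the integral of the square. *)
Lemma variance_identity (u : T -> R) : measurable_fun setT u ->
  mu.-integrable Q (EFin \o (fun x => u x ^+ 2)%R) ->
  (2 * q)%:E * \int[mu]_(x in Q) (u x ^+ 2)%:E =
  \int[mu]_(x in Q) \int[mu]_(y in Q) ((u x - u y) ^+ 2)%:E +
  (2 * (\int[mu]_(x in Q) u x) ^+ 2)%:E.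
Proof.
move=> mu_ u2; have u1 := integrable_sqr_integrable mu_ u2.
under [X in _ = X + _]eq_integral do rewrite integral_sqrB//.
set I := (\int[mu]_(x in Q) u x)%R.
set J := (\int[mu]_(x in Q) (u x ^+ 2))%R.
have i1 : mu.-integrable Q (fun y => (- 2 * I)%:E * (u y)%:E) by exact: integrableZl.
have i2 : mu.-integrable Q (fun y => q%:E * (u y ^+ 2)%:E) by exact: integrableZl.
have -> : \int[mu]_(x in Q) (J + ((- 2 * I) * u x + q * u x ^+ 2))%:E =
    \int[mu]_(x in Q) (J%:E + ((- 2 * I)%:E * (u x)%:E + q%:E * (u x ^+ 2)%:E)).
  by apply: eq_integral => y _; rewrite -!EFinM -!EFinD.
rewrite integralD//=; [|exact: ic|exact: integrableD].
rewrite integralD// integral_cst// muQ !integralZl//.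
rewrite -(fineK (integrable_fin_num mQ u1)) -(fineK (integrable_fin_num mQ u2)).
by rewrite -!EFinM -!EFinD; congr EFin; rewrite /I /J /Rintegral; ring.
Qed.

Lemma sqr_Rintegral_le (u : T -> R) : measurable_fun setT u ->
  mu.-integrable Q (EFin \o (fun x => u x ^+ 2)%R) ->
  ((\int[mu]_(x in Q) u x) ^+ 2)%:E <= q%:E * \int[mu]_(x in Q) (u x ^+ 2)%:E.
Proof.
move=> mu_ u2; have := variance_identity mu_ u2.
set S := \int[mu]_(x in Q) (\int[mu]_(y in Q) _) => vE.
have S0 : 0 <= S.
  by apply: integral_ge0 => x _; apply: integral_ge0 => y _; rewrite lee_fin sqr_ge0.
rewrite -(@lee_pmul2l _ 2%:E)// muleA -!EFinM vE.
by rewrite leeDr.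
Qed.

End variance.

Section cells.
Context {R : realType} (d : nat).
Local Notation mu := (@lebesgue_rV R d).
Local Notation X := ('rV[R]_d).
Local Open Scope ereal_scope.
Variables (L r : R) (n : nat).
Hypothesis r0 : (0 < r)%R.

(** Cells of side [r], numbered from the corner of the cube of half-side [L] centred at
    the origin; see [cell_cover]. *)
Definition cell (k : {ffun 'I_d -> 'I_n}) : set X :=
  rect (fun i => `[(k i)%:R * r - L, (k i).+1%:R * r - L[%classic)%R.

Lemma cellP k (x : X) :
  cell k x <-> forall i, ((k i)%:R <= (x ord0 i + L) / r < (k i).+1%:R)%R.
Proof.
split=> H i; have := H i; rewrite /= in_itv/= ler_pdivlMr// ltr_pdivrMr//.
  by rewrite lerBlDr ltrBrDr.
by rewrite lerBlDr ltrBrDr.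
Qed.

Lemma measurable_cell k : measurable (cell k).
Proof. by apply: measurable_rect => i; exact: measurable_itv. Qed.

Lemma lebesgue_cell k : mu (cell k) = (r ^+ d)%:E.
Proof.
rewrite lebesgue_rV_box; last by move=> i; exact: measurable_itv.
under eq_bigr => i _.
  rewrite lebesgue_measure_itv/= lte_fin.
  rewrite ltrD2r ltr_pM2r// ltr_nat ltnSn -EFinB.
  rewrite (_ : _ - _ = r)%R; last by rewrite -addn1 natrD; ring.
  over.
by rewrite prodEFin prodr_const card_ord.
Qed.

Lemma cell_inj k k' (x : X) : cell k x -> cell k' x -> k = k'.
Proof.
move=> /cellP kx /cellP k'x; apply/ffunP => i; apply: val_inj => /=.
by rewrite -(truncn_def (kx i)) -(truncn_def (k'x i)).
Qed.

Lemma cell_cover (x : X) : (2 * L <= n%:R * r)%R ->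
  (forall i, `|x ord0 i| < L)%R -> exists k, cell k x.
Proof.
move=> Ln xL.
have pos i : (0 <= (x ord0 i + L) / r)%R.
  rewrite divr_ge0 ?(ltW r0)//; have := xL i; rewrite ltr_norml; lra.
have lt i : (Num.truncn ((x ord0 i + L) / r) < n)%N.
  rewrite truncn_lt_nat// ltr_pdivrMr//; apply: lt_le_trans Ln.
  by have := xL i; rewrite ltr_norml; lra.
exists [ffun i => Ordinal (lt i)]; apply/cellP => i; rewrite ffunE/=.
exact: truncn_itv.
Qed.

Lemma cell_diameter k (x y : X) i : cell k x -> cell k y -> (`|y ord0 i - x ord0 i| <= r)%R.
Proof.
move=> /(_ i) + /(_ i); rewrite /= !in_itv/= -!natr1 mulrDl mul1r => /andP[a b] /andP[c e].
by rewrite ler_norml; apply/andP; split; lra.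
Qed.

Section cell_estimate.
Variables (F : X -> R[i]) (eta : R).
Hypothesis mF : cmeasurable F.
Hypothesis F2 : \int[mu]_x (normc (F x) ^+ 2)%:E < +oo.
Hypothesis Feta : forall h : X, (forall i, `|h ord0 i| <= r)%R -> shift_dist F h <= eta%:E.

Let mF2 : measurable_fun setT (fun x => (normc (F x) ^+ 2)%:E).
Proof. exact/measurable_EFinP/measurable_funX/measurable_normc. Qed.

Let q := (r ^+ d)%R.

Lemma integrable_sqr_ReIm (Q : set X) : measurable Q ->
  mu.-integrable Q (EFin \o (fun x => complex.Re (F x) ^+ 2)%R) /\
  mu.-integrable Q (EFin \o (fun x => complex.Im (F x) ^+ 2)%R).
Proof.
move=> mQ; have [mr mi] := mF.
have iF : mu.-integrable Q (fun x => (normc (F x) ^+ 2)%:E).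
  apply: (integrableS measurableT) => //; apply/integrableP; split=> //.
  by under eq_integral do rewrite gee0_abs ?lee_fin ?exprn_ge0 ?Defs.normc_ge0//.
split; apply: (le_integrable mQ _ _ iF).
- by apply/measurable_EFinP/measurable_funTS/measurable_funX.
- move=> x _; rewrite /= !ger0_norm ?sqr_ge0// lee_fin sqr_normc.
  by rewrite lerDl sqr_ge0.
- by apply/measurable_EFinP/measurable_funTS/measurable_funX.
- move=> x _; rewrite /= !ger0_norm ?sqr_ge0// lee_fin sqr_normc.
  by rewrite lerDr sqr_ge0.
Qed.

Lemma cell_variance k :
  (2 * q)%:E * \int[mu]_(x in cell k) (normc (F x) ^+ 2)%:E =
  \int[mu]_(x in cell k) \int[mu]_(y in cell k) (normc (F x - F y) ^+ 2)%:E +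
  (2 * ((\int[mu]_(x in cell k) complex.Re (F x)) ^+ 2 +
        (\int[mu]_(x in cell k) complex.Im (F x)) ^+ 2))%:E.
Proof.
have mQ := measurable_cell k; have muQ := lebesgue_cell k.
have [ir ii] := integrable_sqr_ReIm mQ; have [mr mi] := mF.
have -> : \int[mu]_(x in cell k) (normc (F x) ^+ 2)%:E =
    \int[mu]_(x in cell k) (complex.Re (F x) ^+ 2)%:E +
    \int[mu]_(x in cell k) (complex.Im (F x) ^+ 2)%:E.
  rewrite -ge0_integralD//.
  - by apply: eq_integral => x _; rewrite sqr_normc EFinD.
  - by move=> x _; rewrite lee_fin sqr_ge0.
  - by apply/measurable_EFinP/measurable_funTS/measurable_funX.
  - by move=> x _; rewrite lee_fin sqr_ge0.
  - by apply/measurable_EFinP/measurable_funTS/measurable_funX.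
have ve u := @variance_identity _ _ _ mu (cell k) q mQ muQ u.
have mI u := @measurable_integral_sqrB _ _ _ mu (cell k) q mQ muQ u.
rewrite ge0_muleDr; last 2 first.
- by apply: integral_ge0 => x _; rewrite lee_fin sqr_ge0.
- by apply: integral_ge0 => x _; rewrite lee_fin sqr_ge0.
rewrite !ve// addeACA mulrDr EFinD; congr (_ + _).
rewrite -ge0_integralD//; last 4 first.
- by move=> x _; apply: integral_ge0 => y _; rewrite lee_fin sqr_ge0.
- exact: mI.
- by move=> x _; apply: integral_ge0 => y _; rewrite lee_fin sqr_ge0.
- exact: mI.
apply: eq_integral => x _; rewrite -ge0_integralD//; last 4 first.
- by move=> y _; rewrite lee_fin sqr_ge0.
- apply/measurable_EFinP/measurable_funTS/measurable_funX/measurable_funB => //.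
- by move=> y _; rewrite lee_fin sqr_ge0.
- apply/measurable_EFinP/measurable_funTS/measurable_funX/measurable_funB => //.
by apply: eq_integral => y _; rewrite sqr_normc /sqn !raddfB EFinD.
Qed.

Let D (z : X * X) := ((normc (F z.1 - F z.2)) ^+ 2)%R.

Let mD : measurable_fun setT (fun z : X * X => (D z)%:E).
Proof.
apply/measurable_EFinP/measurable_funX/measurable_normc.
case: mF => mr mi; split; under eq_fun do rewrite raddfB /=; apply: measurable_funB.
- exact: (measurableT_comp mr measurable_fst).
- exact: (measurableT_comp mr measurable_snd).
- exact: (measurableT_comp mi measurable_fst).
- exact: (measurableT_comp mi measurable_snd).
Qed.

Let D0 z : 0 <= (D z)%:E.
Proof. by rewrite lee_fin exprn_ge0// Defs.normc_ge0. Qed.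

Let small_cube : set X := cube r.

(** With [y = x + h], the integral over [x] is [shift_dist F h], and [h] ranges over a
    cube of measure [(2 * r) ^+ d]. *)
Lemma integral_near_diagonal :
  \int[mu]_x \int[mu]_y (\1_small_cube (y - x)%R * D (x, y))%:E <=
  ((2 * r) ^+ d * eta)%:E.
Proof.
have mS : measurable small_cube by exact: measurable_cube.
have m1 : measurable_fun setT (fun z : X * X => (\1_small_cube z.2 * D (z.1, (z.2 + z.1)%R))%:E).
  apply/measurable_EFinP; apply: measurable_funM.
    apply: measurableT_comp; [exact: measurable_indic|exact: measurable_snd].
  have /measurable_EFinP mD' := mD.
  apply: (measurableT_comp mD' (f := D) (g := fun z : X * X => (z.1, z.2 + z.1)%R)).
  apply/measurable_fun_pairP; split; first exact: measurable_fst.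
  by under eq_fun do rewrite addrC; exact: measurable_add2.
have p1 z : 0 <= (\1_small_cube z.2 * D (z.1, (z.2 + z.1)%R))%:E.
  by rewrite lee_fin mulr_ge0//; have := D0 (z.1, (z.2 + z.1)%R); rewrite lee_fin.
have -> : \int[mu]_x \int[mu]_y (\1_small_cube (y - x)%R * D (x, y))%:E =
    \int[mu]_x \int[mu]_h (\1_small_cube h * D (x, (h + x)%R))%:E.
  apply: eq_integral => x _; rewrite -[LHS](ge0_integral_shift x); last 2 first.
  - apply/measurable_EFinP; apply: measurable_funM.
      apply: measurableT_comp; first exact: measurable_indic.
      exact: measurable_shift.
    have /measurable_EFinP mD' := mD.
    exact: (measurableT_comp mD' (measurable_pair1 x)).
  - by move=> y; rewrite lee_fin mulr_ge0//; have := D0 (x, y); rewrite lee_fin.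
  by apply: eq_integral => h _; rewrite addrK.
rewrite (fubini_tonelli _ m1 p1).
have sE h : \int[mu]_x (\1_small_cube h * D (x, (h + x)%R))%:E =
    (\1_small_cube h)%:E * shift_dist F h.
  rewrite /shift_dist -ge0_integralZl//; last 2 first.
  - have := measurable_shift_dist mF h 0.
    by under eq_fun do rewrite addr0.
  - by move=> x _; rewrite lee_fin exprn_ge0// Defs.normc_ge0.
  apply: eq_integral => x _; rewrite -EFinM /D /= -opprB normcN.
  by rewrite (addrC h x).
have s0 h : 0 <= shift_dist F h.
  by apply: integral_ge0 => x _; rewrite lee_fin exprn_ge0// Defs.normc_ge0.
have eta0 : 0 <= eta%:E.
  by apply: le_trans (s0 0%R) (Feta _) => i; rewrite mxE normr0 ltW.
have mi : measurable_fun setT (fun h : X => (\1_small_cube h : R)%:E).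
  by apply/measurable_EFinP; exact: measurable_indic.
under eq_integral do rewrite sE.
apply: (@le_trans _ _ (\int[mu]_h (eta%:E * (\1_small_cube h)%:E))).
  apply: ge0_le_integral => //.
  - by move=> h _; rewrite mule_ge0// lee_fin.
  - have := measurable_fun_fubini_tonelli_G (m1 := mu) _ m1 p1.
    by apply: eq_measurable_fun => h _; exact: sE.
  - exact: measurable_funeM.
  move=> h _; rewrite indicE; have [hS|hS] := boolP (h \in small_cube); last first.
    by rewrite mul0e mule0.
  rewrite mul1e mule1; apply: Feta => i; move: hS; rewrite inE => /(_ i).
  by rewrite /= in_itv/= -ler_norml.
rewrite ge0_integralZl// integral_indic// setIT muleC EFinM lee_wpmul2r//.
rewrite [leLHS](_ : _ = \prod_(i < d) lebesgue_measure (`[- r, r]%classic : set R)%R).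
  2: by apply: lebesgue_rV_box => i; exact: measurable_itv.
under eq_bigr => i _.
  rewrite lebesgue_measure_itv/= lte_fin gtrN// -EFinB.
  rewrite (_ : _ - _ = 2 * r)%R; last by ring.
  over.
by rewrite prodEFin prodr_const card_ord.
Qed.

(** Summing [cell_variance] over the cells: pairs of points of a same cell are near the
    diagonal, and cells are disjoint, so [integral_near_diagonal] bounds the double
    integrals. *)
Lemma cell_estimate : (2 * L <= n%:R * r)%R ->
  (2 * q)%:E * \int[mu]_(x in [set x : X | forall i, `|x ord0 i| < L]%R) (normc (F x) ^+ 2)%:E <=
  ((2 * r) ^+ d * eta)%:E +
  (2 * \sum_k ((\int[mu]_(x in cell k) complex.Re (F x)) ^+ 2 +
        (\int[mu]_(x in cell k) complex.Im (F x)) ^+ 2))%:E.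
Proof.
move=> Ln; set A := [set x : X | _].
have mA : measurable A.
  rewrite (_ : A = rect (fun _ => `]- L, L[%classic)%R).
    by apply: measurable_rect => i; exact: measurable_itv.
  by apply/seteqP; split => x /= Ax i; have := Ax i; rewrite /= in_itv/= ltr_norml.
set s := index_enum _.
have ts : trivIset [set` s] cell.
  by move=> k k' _ _ [x [kx k'x]]; exact: cell_inj kx k'x.
pose U := \big[setU/set0]_(k <- s) cell k.
have mU : measurable U by apply: bigsetU_measurable => k _; exact: measurable_cell.
have AU : A `<=` U.
  move=> x Ax; have [k kx] := cell_cover Ln Ax.
  by rewrite /U -bigcup_seq; exists k => //=; rewrite mem_index_enum.
have le1 : \int[mu]_(x in A) (normc (F x) ^+ 2)%:E <=
    \sum_(k <- s) \int[mu]_(x in cell k) (normc (F x) ^+ 2)%:E.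
  rewrite -(ge0_integral_bigsetU mu measurable_cell (index_enum_uniq _) ts).
  - apply: ge0_subset_integral => //; first exact: measurable_funTS.
    by move=> x _; rewrite lee_fin exprn_ge0// Defs.normc_ge0.
  - exact: measurable_funTS.
  - by move=> x _; rewrite lee_fin exprn_ge0// Defs.normc_ge0.
have q0 : 0 <= (2 * q)%:E by rewrite lee_fin mulr_ge0// exprn_ge0// ltW.
apply: le_trans (lee_wpmul2l q0 le1) _.
rewrite ge0_sume_distrr; last first.
  by move=> k _; apply: integral_ge0 => x _; rewrite lee_fin exprn_ge0// Defs.normc_ge0.
under eq_bigr do rewrite cell_variance.
rewrite big_split/= sumEFin -mulr_sumr leeD2r//.
apply: le_trans integral_near_diagonal.
pose G k (z : X * X) : \bar R := (\1_(cell k) z.1 * \1_(cell k) z.2 * D z)%:E.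
have mG k : measurable_fun setT (G k).
  have mi := measurable_indic (R := R) (measurable_cell k).
  apply/measurable_EFinP; apply: measurable_funM; last exact/measurable_EFinP.
  apply: measurable_funM.
    exact: (measurableT_comp (mi setT) measurable_fst).
  exact: (measurableT_comp (mi setT) measurable_snd).
have G0 k z : 0 <= G k z.
  by rewrite lee_fin !mulr_ge0// ?exprn_ge0// ?Defs.normc_ge0.
have GE k : \int[mu]_(x in cell k) \int[mu]_(y in cell k) (normc (F x - F y) ^+ 2)%:E =
    \int[mu]_x \int[mu]_y G k (x, y).
  rewrite [LHS]integral_mkcond; apply: eq_integral => x _; rewrite patchE.
  case: ifPn => xk.
    rewrite integral_mkcond; apply: eq_integral => y _; rewrite patchE /G/= !indicE xk mul1r.
    by case: ifPn => yk; rewrite ?mul1r ?mul0r.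
  by under eq_integral do rewrite /G/= indicE (negbTE xk) !mul0r; rewrite integral0.
under eq_bigr do rewrite GE.
rewrite -ge0_integral_sum//; last 2 first.
- by move=> k; exact: measurable_fun_fubini_tonelli_F (G k) (mG k) (G0 k).
- by move=> k x _; exact: integral_ge0.
have m2 : measurable_fun setT (fun z : X * X => (\1_small_cube (z.2 - z.1) * D z)%:E).
  have mS : measurable small_cube by exact: measurable_cube.
  apply/measurable_EFinP; apply: measurable_funM; last exact/measurable_EFinP.
  apply: measurableT_comp; first exact: measurable_indic.
  have := measurable_addZ (-1 : R); move=> /(_ d) m.
  have m' : measurable_fun setT (fun z : X * X => (z.2, z.1)).
    by apply/measurable_fun_pairP; split; [exact: measurable_snd|exact: measurable_fst].
  have := measurableT_comp m m'.
  by apply: eq_measurable_fun => z _ /=; rewrite scaleN1r.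
have p2 z : 0 <= (\1_small_cube (z.2 - z.1)%R * D z)%:E.
  by rewrite lee_fin mulr_ge0// exprn_ge0// Defs.normc_ge0.
apply: ge0_le_integral => //.
- by move=> x _; apply: sume_ge0 => k _; apply: integral_ge0.
- by apply: emeasurable_sum => k; exact: measurable_fun_fubini_tonelli_F (G k) (mG k) (G0 k).
- exact: measurable_fun_fubini_tonelli_F _ m2 p2.
move=> x _; rewrite -ge0_integral_sum//; last first.
  by move=> k; exact: (measurableT_comp (mG k) (measurable_pair1 x)).
apply: ge0_le_integral => //.
- by move=> y _; exact: sume_ge0.
- by apply: emeasurable_sum => k; exact: (measurableT_comp (mG k) (measurable_pair1 x)).
- exact: (measurableT_comp m2 (measurable_pair1 x)).
move=> y _; rewrite /G /= sumEFin lee_fin -mulr_suml ler_wpM2r//.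
  by rewrite exprn_ge0// Defs.normc_ge0.
have [[k [kx ky]]|nk] := pselect (exists k, cell k x /\ cell k y).
  rewrite [leRHS]indicE mem_set; last first.
    by move=> i /=; rewrite in_itv/= -ler_norml !mxE; exact: (cell_diameter i kx ky).
  rewrite (bigD1_seq k) ?mem_index_enum ?index_enum_uniq//= big1 ?addr0.
    by rewrite !indicE !mem_set// mulr1.
  move=> k' k'k; rewrite indicE memNset ?mul0r// => k'x.
  by move: k'k; rewrite (cell_inj k'x kx) eqxx.
rewrite big1// => k _; rewrite !indicE.
have [/set_mem kx|_] := boolP (x \in cell k); last by rewrite mul0r.
have [/set_mem ky|_] := boolP (y \in cell k); last by rewrite mulr0.
by case: nk; exists k.
Qed.

End cell_estimate.

End cells.

Section kolmogorov_riesz.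
Context {R : realType} (d : nat).
Local Notation mu := (@lebesgue_rV R d).
Local Notation X := ('rV[R]_d).
Local Open Scope ereal_scope.

(** Two numbers with the same integer part are at distance at most 1. The bound [B] keeps
    the integer parts below the size of the ordinal type, where [inord] is injective. *)
Lemma truncn_quantize (a b B rho : R) : (0 < rho)%R -> (`|a| <= B)%R -> (`|b| <= B)%R ->
  (inord (Num.truncn ((a + B) / rho)) : 'I_(Num.truncn (2 * B / rho)).+1) =
    inord (Num.truncn ((b + B) / rho)) ->
  (`|a - b| <= rho)%R.
Proof.
move=> rho0; have trunc c : (`|c| <= B)%R -> (Num.truncn ((c + B) / rho) <
    (Num.truncn (2 * B / rho)).+1)%N /\ (0 <= (c + B) / rho)%R.
  rewrite ler_norml => /andP[Bc cB]; have cB0 : (0 <= (c + B) / rho)%R.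
    by rewrite divr_ge0 ?(ltW rho0)//; lra.
  split=> //; rewrite truncn_lt_nat//; apply: le_lt_trans (truncnS_gt _).
  by rewrite ler_pM2r ?invr_gt0//; lra.
move=> /trunc[alt a0] /trunc[blt b0] /(congr1 val); rewrite /= !inordK// => abE.
have /andP[] := truncn_itv a0; have /andP[] := truncn_itv b0; rewrite abE.
set t := Num.truncn _; rewrite -natr1 !ler_pdivlMr// !ltr_pdivrMr// !mulrDl mul1r => *.
by rewrite ler_norml; apply/andP; split; lra.
Qed.

Lemma sqr_normcB_le (z w : R[i]) :
  (normc (z - w) ^+ 2 <= 2 * normc z ^+ 2 + 2 * normc w ^+ 2)%R.
Proof.
rewrite !sqr_normc /sqn !raddfB /=.
have := sqr_ge0 (complex.Re z + complex.Re w); have := sqr_ge0 (complex.Im z + complex.Im w).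
by nra.
Qed.

Lemma integral_sqr_normcB_le (D : set X) (f g : X -> R[i]) (a b : R) :
  measurable D -> cmeasurable f -> cmeasurable g ->
  \int[mu]_(x in D) (normc (f x) ^+ 2)%:E <= a%:E ->
  \int[mu]_(x in D) (normc (g x) ^+ 2)%:E <= b%:E ->
  \int[mu]_(x in D) (normc (f x - g x) ^+ 2)%:E <= (2 * a + 2 * b)%:E.
Proof.
move=> mD mf mg fa gb.
have m2 (u : X -> R[i]) : cmeasurable u -> measurable_fun D (fun x => (normc (u x) ^+ 2)%:E).
  by move=> mu_; apply/measurable_EFinP/measurable_funTS/measurable_funX/measurable_normc.
have p2 (u : X -> R[i]) x : 0 <= (normc (u x) ^+ 2)%:E.
  by rewrite lee_fin exprn_ge0// Defs.normc_ge0.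
apply: (@le_trans _ _ (\int[mu]_(x in D)
    (2%:E * (normc (f x) ^+ 2)%:E + 2%:E * (normc (g x) ^+ 2)%:E))).
  apply: ge0_le_integral => //.
  - by move=> x _; rewrite lee_fin exprn_ge0// Defs.normc_ge0.
  - exact: (m2 _ (cmeasurableB mf mg)).
  - by apply: emeasurable_funD; apply: measurable_funeM; exact: m2.
  by move=> x _; rewrite -!EFinM -EFinD lee_fin sqr_normcB_le.
rewrite ge0_integralD//; last 4 first.
- by move=> x _; rewrite mule_ge0.
- by apply: measurable_funeM; exact: m2.
- by move=> x _; rewrite mule_ge0.
- by apply: measurable_funeM; exact: m2.
rewrite (ge0_integralZl _ mD (m2 _ mf))// (ge0_integralZl _ mD (m2 _ mg))//.
rewrite (EFinD (2 * a)) (EFinM 2 a) (EFinM 2 b).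
by apply: leeD; apply: lee_wpmul2l.
Qed.

Variables (K : set (L2Rd R d)) (M : R).
Hypothesis KM : forall f, K f -> \int[mu]_x (normc (f x) ^+ 2)%:E <= M%:E.
Hypothesis Ktails : forall e : R, (0 < e)%R -> exists2 xi : R, (0 < xi)%R & forall f, K f ->
  \int[mu]_(x in [set x : X | (xi < enorm x)%R]) (normc (f x) ^+ 2)%:E <= e%:E.
Hypothesis Kshift : forall e : R, (0 < e)%R -> exists2 r : R, (0 < r)%R & forall f, K f ->
  forall h : X, (forall i, `|h ord0 i| <= r)%R -> shift_dist f h <= e%:E.

Let K2 (f : L2Rd R d) : K f -> \int[mu]_x (normc (f x) ^+ 2)%:E < +oo.
Proof. by move=> /KM/le_lt_trans; apply; exact: ltry. Qed.

Let sqr_dist_split (f g : L2Rd R d) (L xi : R) : (xi < L)%R ->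
  ((cL2_dist f g) ^+ 2)%:E <=
  \int[mu]_(x in [set x : X | (xi < enorm x)%R]) (normc (f x - g x) ^+ 2)%:E +
  \int[mu]_(x in [set x : X | forall i, `|x ord0 i| < L]%R) (normc (f x - g x) ^+ 2)%:E.
Proof.
move=> xiL; rewrite sqr_cL2_distE.
set B := [set x : X | (xi < enorm x)%R]; have mB : measurable B by exact: measurable_enorm_gt.
have mBc : measurable (~` B) := measurableC mB.
set A := [set x : X | _]; have mA : measurable A.
  rewrite (_ : A = rect (fun _ => `]- L, L[%classic)%R).
    by apply: measurable_rect => i; exact: measurable_itv.
  by apply/seteqP; split => x /= Ax i; have := Ax i; rewrite /= in_itv/= ltr_norml.
have m2 : measurable_fun setT (fun x => (normc (f x - g x) ^+ 2)%:E).
  apply/measurable_EFinP/measurable_funX/measurable_normc/cmeasurableB;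
    exact: cmeasurable_cL2.
have p2 x : 0 <= (normc (f x - g x) ^+ 2)%:E.
  by rewrite lee_fin exprn_ge0// Defs.normc_ge0.
rewrite -(setUv B) ge0_integral_setU//; last 2 first.
- by rewrite setUv.
- exact/disj_setPCl.
apply: leeD => //; apply: ge0_subset_integral => //; first exact: measurable_funTS.
move=> x /= /negP; rewrite -leNgt => xxi i.
by apply: le_lt_trans (le_trans (normr_coord_le_enorm x i) xxi) xiL.
Qed.

(** The boolean distinguishes real and imaginary parts, so that one finite function
    records all the integrals. *)
Let cell_int (L r : R) n (f : X -> R[i]) (kb : {ffun 'I_d -> 'I_n} * bool) : R :=
  if kb.2 then (\int[mu]_(x in cell L r kb.1) complex.Re (f x))%R
  else (\int[mu]_(x in cell L r kb.1) complex.Im (f x))%R.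

Let cell_int_bound (L r : R) n (f : L2Rd R d) (kb : {ffun 'I_d -> 'I_n} * bool) :
  (0 < r)%R -> K f -> (`|cell_int L r f kb| <= Num.sqrt (r ^+ d * `|M|))%R.
Proof.
move=> r0 Kf; have mf := cmeasurable_cL2 f.
have mQ := measurable_cell L r kb.1; have muQ := lebesgue_cell L r0 kb.1.
have [ir ii] := integrable_sqr_ReIm mf (K2 Kf) mQ; have [mr mi] := mf.
rewrite -sqrtr_sqr; apply: ler_wsqrtr.
have low (u : X -> R) : (forall x, u x ^+ 2 <= normc (f x) ^+ 2)%R ->
    measurable_fun setT u -> mu.-integrable (cell L r kb.1) (EFin \o (fun x => u x ^+ 2)%R) ->
    ((\int[mu]_(x in cell L r kb.1) u x) ^+ 2 <= r ^+ d * `|M|)%R.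
  move=> uf mu_ iu; rewrite -lee_fin.
  apply: le_trans (sqr_Rintegral_le mQ muQ mu_ iu) _.
  rewrite EFinM; apply: lee_wpmul2l; first by rewrite lee_fin exprn_ge0// ltW.
  apply: (@le_trans _ _ M%:E); last by rewrite lee_fin ler_norm.
  apply: le_trans (KM Kf).
  have m2 : measurable_fun setT (fun x => (normc (f x) ^+ 2)%:E).
    exact/measurable_EFinP/measurable_funX/measurable_normc.
  apply: (@le_trans _ _ (\int[mu]_(x in cell L r kb.1) (normc (f x) ^+ 2)%:E)).
    apply: ge0_le_integral => //.
    - by move=> x _; rewrite lee_fin sqr_ge0.
    - by apply/measurable_EFinP/measurable_funTS/measurable_funX.
    - exact: measurable_funTS.
    by move=> x _; rewrite lee_fin.
  apply: ge0_subset_integral => //.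
  by move=> x _; rewrite lee_fin exprn_ge0// Defs.normc_ge0.
rewrite /cell_int; case: ifP => _; apply: low => // x; rewrite sqr_normc.
  by rewrite lerDl sqr_ge0.
by rewrite lerDr sqr_ge0.
Qed.

Let cell_intB (L r : R) n (f g : L2Rd R d) (kb : {ffun 'I_d -> 'I_n} * bool) :
  (0 < r)%R -> K f -> K g ->
  cell_int L r (fun x => f x - g x)%R kb = (cell_int L r f kb - cell_int L r g kb)%R.
Proof.
move=> r0 Kf Kg; have mf := cmeasurable_cL2 f; have mg := cmeasurable_cL2 g.
have mQ := measurable_cell L r kb.1; have muQ := lebesgue_cell L r0 kb.1.
have [fr fi] := integrable_sqr_ReIm mf (K2 Kf) mQ; have [mfr mfi] := mf.
have [gr gi] := integrable_sqr_ReIm mg (K2 Kg) mQ; have [mgr mgi] := mg.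
rewrite /cell_int; case: ifP => _.
  rewrite -RintegralB//; last 2 first.
  - exact: (integrable_sqr_integrable mQ muQ mfr fr).
  - exact: (integrable_sqr_integrable mQ muQ mgr gr).
  by apply: eq_Rintegral => x _; rewrite raddfB.
rewrite -RintegralB//; last 2 first.
- exact: (integrable_sqr_integrable mQ muQ mfi fi).
- exact: (integrable_sqr_integrable mQ muQ mgi gi).
by apply: eq_Rintegral => x _; rewrite raddfB.
Qed.

Let dist_le (f g : L2Rd R d) (a b L r xi rho : R) n :
  (0 < r)%R -> (xi < L)%R -> (2 * L <= n%:R * r)%R -> K f -> K g ->
  (forall f, K f ->
    \int[mu]_(x in [set x : X | (xi < enorm x)%R]) (normc (f x) ^+ 2)%:E <= a%:E) ->
  (forall f, K f -> forall h : X, (forall i, `|h ord0 i| <= r)%R -> shift_dist f h <= b%:E) ->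
  (forall kb : {ffun 'I_d -> 'I_n} * bool, `|cell_int L r f kb - cell_int L r g kb| <= rho)%R ->
  (cL2_dist f g ^+ 2 <= 4 * a + (2 ^+ d * (2 * b) +
     (r ^+ d)^-1 * (#|{ffun 'I_d -> 'I_n}|%:R * (2 * rho ^+ 2))))%R.
Proof.
move=> r0 xiL Ln Kf Kg Ka Kb Kint.
have mf := cmeasurable_cL2 f; have mg := cmeasurable_cL2 g.
have mF := cmeasurableB mf mg.
rewrite -lee_fin; apply: le_trans (sqr_dist_split f g xiL) _.
rewrite EFinD leeD//.
  rewrite (_ : 4 * a = 2 * a + 2 * a)%R; last by ring.
  by apply: integral_sqr_normcB_le (Ka f Kf) (Ka g Kg) => //; exact: measurable_enorm_gt.
have F2 : \int[mu]_x (normc (f x - g x) ^+ 2)%:E < +oo.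
  apply: le_lt_trans (integral_sqr_normcB_le measurableT mf mg (KM Kf) (KM Kg)) _.
  exact: ltry.
have Fshift (h : X) : (forall i, `|h ord0 i| <= r)%R ->
    shift_dist (fun x => f x - g x)%R h <= (4 * b)%:E.
  move=> hr; rewrite (_ : 4 * b = 2 * b + 2 * b)%R; last by ring.
  have := integral_sqr_normcB_le measurableT
    (cmeasurableB (cmeasurable_shift mf h) mf) (cmeasurableB (cmeasurable_shift mg h) mg)
    (Kb f Kf h hr) (Kb g Kg h hr).
  apply: le_trans; rewrite le_eqVlt; apply/orP; left; apply/eqP.
  by apply: eq_integral => x _; congr ((normc _ ^+ 2)%:E); ring.
have q0 : (0 < r ^+ d)%R by rewrite exprn_gt0.
have := cell_estimate r0 mF F2 Fshift Ln.
move=> est; rewrite -(@lee_pmul2l _ (2 * r ^+ d)%:E)//; last first.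
  by rewrite lte_fin mulr_gt0.
apply: le_trans est _; rewrite -EFinD -EFinM lee_fin.
rewrite [leRHS](_ : _ = (2 * r) ^+ d * (4 * b) +
    2 * (#|{ffun 'I_d -> 'I_n}|%:R * (2 * rho ^+ 2)))%R; last first.
  by rewrite exprMn; field; rewrite gt_eqF.
rewrite lerD2l ler_wpM2l//.
rewrite -sum1_card natr_sum mulr_suml; apply: ler_sum => k _; rewrite mul1r.
have kr := Kint (k, true); have ki := Kint (k, false).
rewrite -!cell_intB// in kr ki; rewrite /cell_int/= in kr ki.
have rho0 := le_trans (normr_ge0 _) kr.
rewrite mulr_natl mulr2n; apply: lerD.
  by rewrite -real_normK ?num_real// ler_sqr ?nnegrE.
by rewrite -real_normK ?num_real// ler_sqr ?nnegrE.
Qed.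

(** Classes are given by the rounded integrals over the cells. By [dist_le], the squared
    distance between two elements of a class is at most [e^2 / 4] for the tails, as much
    for the translates and as much for the integrals, hence below [e^2]. *)
Lemma kolmogorov_riesz : precompact K.
Proof.
apply: precompact_finite_partitions => [F FF Fc|e e0]; first exact: cL2_complete.
have a0 : (0 < e ^+ 2 / 16)%R by rewrite divr_gt0// exprn_gt0.
have b0 : (0 < e ^+ 2 / (8 * 2 ^+ d))%R by rewrite divr_gt0 ?exprn_gt0// mulr_gt0// exprn_gt0.
have [xi xi0 Ka] := Ktails a0.
have [r r0 Kb] := Kshift b0.
pose L := (xi + 1)%R; have xiL : (xi < L)%R by rewrite ltrDl.
pose n := (Num.truncn (2 * L / r)).+1.
have Ln : (2 * L <= n%:R * r)%R.
  by rewrite -ler_pdivrMr// ltW// truncnS_gt.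
set N : R := #|{ffun 'I_d -> 'I_n}|%:R.
have N0 : (0 <= N)%R by rewrite ler0n.
have q0 : (0 < r ^+ d)%R by rewrite exprn_gt0.
pose rho := Num.sqrt (r ^+ d * (e ^+ 2 / (8 * (N + 1))))%R.
have N10 : (0 < N + 1)%R by rewrite ltr_wpDl.
have rhoI : (0 < r ^+ d * (e ^+ 2 / (8 * (N + 1))))%R.
  by rewrite mulr_gt0// divr_gt0 ?exprn_gt0// mulr_gt0.
have rho0 : (0 < rho)%R by rewrite sqrtr_gt0.
pose B := Num.sqrt (r ^+ d * `|M|).
exists {ffun ({ffun 'I_d -> 'I_n} * bool) -> 'I_(Num.truncn (2 * B / rho)).+1}.
exists (fun f : L2Rd R d => [ffun kb => inord (Num.truncn ((cell_int L r f kb + B) / rho))]).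
move=> f g Kf Kg /ffunP fg.
rewrite -metricType_numDomainType.ball_mdistE /= -[X in (X < _)%R]/(cL2_dist f g).
have close (kb : {ffun 'I_d -> 'I_n} * bool) :
    (`|cell_int L r (f : L2Rd R d) kb - cell_int L r (g : L2Rd R d) kb| <= rho)%R.
  by have := fg kb; rewrite !ffunE; apply: truncn_quantize => //; exact: cell_int_bound.
have dle := dist_le r0 xiL Ln Kf Kg Ka Kb close.
rewrite -(ltr_pXn2r (n := 2))// ?nnegrE ?fine_ge0 ?cLnorm_ge0 ?ltW//.
apply: le_lt_trans dle _.
rewrite -/N sqr_sqrtr ?(ltW rhoI)//.
have e20 : (0 < e ^+ 2)%R by rewrite exprn_gt0.
rewrite [ltLHS](_ : _ = e ^+ 2 / 2 + (e ^+ 2 / 4) * (N / (N + 1)))%R; last first.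
  by field; rewrite !gt_eqF// exprn_gt0.
have N1 : (N / (N + 1) <= 1)%R by rewrite ler_pdivrMr// mul1r lerDl.
have := ler_wpM2l (ltW (divr_gt0 e20 (ltr0n R 4))) N1.
by rewrite mulr1; lra.
Qed.

End kolmogorov_riesz.

(** * Relative compactness from concentrated Wigner distributions *)

Theorem proposition2p1 (R : realType) (d : nat) (hd : (1 <= d)%N)
  (K : set (L2Rd R d))
  (K_bounded : exists M : R, forall f : L2Rd R d, K f ->
    (cLnorm (lebesgue_rV d) 2%:E f <= M%:E)%E)
  (K_L1 : forall f : L2Rd R d, K f ->
    [/\ cLfun (lebesgue_rV d) 1%:E f,
        cLfun (lebesgue_rV d) 1%:E (fourier f) &
        cLfun (lebesgue_rV d) 2%:E (fourier f)])
  (K_wigner :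
    ereal_sup
      [set (\int[lebesgue_rV d \x lebesgue_rV d]_(z in ~` Qbox xi)
              (ComplexField.Normc.normc (wigner f z.1 z.2))%:E)%E
      | f in K] @[xi --> +oo] --> 0%E) :
  precompact K.
Proof.
have [M KM] := K_bounded.
pose K' := [set (f : 'rV[R]_d -> R[i]) | f in K].
have K'W (e : R) : 0 < e -> exists2 xi : R, 0 < xi & forall f, K' f ->
    (\int[lebesgue_rV d \x lebesgue_rV d]_(z in ~` Qbox xi)
       (normc (wigner f z.1 z.2))%:E <= e%:E)%E.
  move=> e0.
  have near_e := cvge0_le (FF := proper_pinfty_nbhs) K_wigner e0.
  have [xi [xi0 supe]] := @filter_ex _ (pinfty_nbhs R) _ _
    (filterI (nbhs_pinfty_gt (num_real (0 : R))) near_e).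
  exists xi => // _ [f Kf <-]; apply: le_trans supe.
  by apply: ereal_sup_ubound; exists f.
have K'm f : K' f -> cmeasurable f by move=> [g _ <-]; exact: cmeasurable_cL2.
have K'1 f : K' f -> (\int[lebesgue_rV d]_x (normc (f x))%:E < +oo)%E.
  by move=> [g /K_L1[[_ g1] _ _] <-]; rewrite -cLnorm1E.
have K'2 f : K' f -> (\int[lebesgue_rV d]_x (normc (f x) ^+ 2)%:E <= (M ^+ 2)%:E)%E.
  by move=> [g Kg <-]; apply: cLnorm2_le; exact: KM.
have KK' (f : L2Rd R d) : K f -> K' f by move=> Kf; exists f.
apply: (kolmogorov_riesz (M := M ^+ 2)) => [f /KK'|e e0|e e0]; first exact: K'2.
  have [xi xi0 H] := uniform_tails K'm K'1 K'2 K'W e0.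
  by exists xi => // f /KK'; exact: H.
have [r r0 H] := uniform_shift K'm K'1 K'2 K'W e0.
by exists r => // f /KK'; exact: H.
Qed.
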